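(* Let $q$ be a power of a prime $p$ and let $\mathcal{O}$ be a semisimple conjugacy class of $\mathrm{PSL}(2,q)$ whose elements have order $o(\mathcal{O})\ge4$. Then $\mathcal{O}$ has the following subracks (the list being meant as the complete list of subracks of $\mathcal{O}$ up to isomorphism): (1) the subracks $\{y\}$ and $\{y,y^{-1}\}$ with $y\in\mathcal{O}$; (2) if $16\mid q^2-1$ and $o(\mathcal{O})=4$, then subracks isomorphic to $(1\,2\,3\,4)^{\mathbb{S}_4}$; (3) if $5\mid q^2-1$ and $o(\mathcal{O})=5$, then subracks isomorphic to $(1\,2\,3\,4\,5)^{\mathbb{A}_5}$; (4) if $\mathcal{O}$ is split semisimple, then subracks of the form $A\rtimes_q\{z\}\subseteq A\rtimes_qC$ or $A\rtimes_q\{z,z^{-1}\}\subseteq A\rtimes_qC$, where $z\in\mathbb{F}_q^{\times2}$ with $\mathrm{ord}\,z=o(\mathcal{O})$, and $C$ is the cyclic group generated by $z$; (5) if $[\chi_{\mathcal{O}}]=x^2+x+d$ with $d\in\mathbb{F}_{q_0}^\times$ for a subfield $\mathbb{F}_{q_0}$ of $\mathbb{F}_q$ with $q_0>4$, then subracks isomorphic to the class $\dot{\mathcal{O}}$ in $\mathrm{PGL}(2,q_0)$ with $[\chi_{\dot{\mathcal{O}}}]=x^2+x+d$.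
   Context: $\mathrm{PGL}(2,q)$ is the group of invertible $2\times2$ matrices over $\mathbb{F}_q$ modulo nonzero scalars, acting on the projective line $\mathbb{P}(1,q)$; $\begin{bmatrix}a&b\\c&d\end{bmatrix}$ is the class of a matrix. $\mathbb{F}_q^{\times2}$ is the group of squares in $\mathbb{F}_q^\times$, and $\mathrm{PSL}(2,q)$ is the subgroup of classes with $ad-bc\in\mathbb{F}_q^{\times2}$. A non-trivial conjugacy class is split (resp. non-split) semisimple if its elements have two (resp. no) fixed points in $\mathbb{P}(1,q)$, and semisimple if it is one of these. The characteristic polynomial $[\chi_g(x)]=x^2-(a+d)x+(ad-bc)$ of $g=\begin{bmatrix}a&b\\c&d\end{bmatrix}$ is taken modulo the equivalence relation $r(\lambda x)\sim\lambda^n r(x)$ for $\lambda\in\mathbb{F}_q^\times$, $n=\deg r$ (so it is well defined on $\mathrm{PGL}(2,q)$); $[\chi_{\mathcal{O}}]$ is the characteristic polynomial of the elements of the class $\mathcal{O}$. A semisimple class of $\mathrm{PSL}(2,q)$ or $\mathrm{PGL}(2,q)$ is determined by its characteristic polynomial. For a subgroup $C\le\mathbb{F}_q^{\times2}$ and a vector space $A$ over the smallest subfield of $\mathbb{F}_q$ containing $C$, $A\rtimes_qC$ denotes the semidirect product in which $C$ acts on $A$ by multiplication; for $S\subseteq C$, $A\rtimes_qS$ is the subset of pairs $(a,c)$ with $a\in A$, $c\in S$. In (4), $A$ is such a vector space with $1<|A|\le q$. $\mathbb{S}_n$, $\mathbb{A}_n$ are the symmetric and alternating groups; $g^G$ is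 the conjugacy class of $g$ in $G$; $\mathrm{ord}\,z$ is the order of $z$. A rack is a non-empty set $X$ with a binary operation $\triangleright$ such that every map $y\mapsto x\triangleright y$ is bijective and $x\triangleright(y\triangleright z)=(x\triangleright y)\triangleright(x\triangleright z)$. Groups and unions of conjugacy classes are racks via $g\triangleright h=ghg^{-1}$. A subrack is a non-empty subset closed under $\triangleright$.
   Formalization: In (4), z is also required to belong to the class, i.e. the class of diag(z,1) lies in O (such z is shown to exist); for an arbitrary square z of order o(O) the racks need not occur, e.g. q=11, o(O)=5, with z replaced by its square. *)

(* Defs.v *)
From HB Require Import structures.
From mathcomp Require Import all_boot all_order all_algebra.
From mathcomp Require Import all_fingroup all_solvable.

Set Implicit Arguments.
Unset Strict Implicit.
Unset Printing Implicit Defensive.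

Import GRing.Theory.
Local Open Scope ring_scope.

Record finRack := FinRack {
  rack_sort :> finType;
  rack_op : rack_sort -> rack_sort -> rack_sort;
  rack_inhabited : (0 < #|rack_sort|)%N;
  rack_bij : forall x, bijective (rack_op x);
  rack_distr : forall x y z,
    rack_op x (rack_op y z) = rack_op (rack_op x y) (rack_op x z)
}.

Definition subrack (R : finRack) (X : {set R}) : Prop :=
  X != set0 /\ {in X &, forall x y, rack_op x y \in X}.

(* The values of [f] outside [X] are irrelevant; subracks are non-empty, so the
   totality of [f] is no restriction. *)
Definition subrack_isom (R1 R2 : finRack) (X : {set R1}) (Y : {set R2}) : Prop :=
  exists f : R1 -> R2,
    [/\ {in X &, injective f}, f @: X = Y
      & {in X &, {morph f : x y / rack_op x y >-> rack_op x y}}].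

Section ConjRack.
Variable gT : finGroupType.
Local Open Scope group_scope.

Definition conj_op (g h : gT) : gT := g * h * g^-1.

Lemma conj_inhabited : (0 < #|gT|)%N.
Proof. by apply/card_gt0P; exists 1. Qed.

Lemma conj_bij (g : gT) : bijective (conj_op g).
Proof.
by exists (conj_op g^-1) => h; rewrite /conj_op !mulgA ?invgK ?mulVg ?mulgV
  ?mul1g -?mulgA ?mulVg ?mulgV ?mulg1.
Qed.

Lemma conj_distr (x y z : gT) :
  conj_op x (conj_op y z) = conj_op (conj_op x y) (conj_op x z).
Proof. by rewrite /conj_op !invMg invgK !mulgA !mulgKV. Qed.

Definition conj_rack : finRack := FinRack conj_inhabited conj_bij conj_distr.
End ConjRack.

Definition is_subrack (gT : finGroupType) (O X : {set gT}) : Prop :=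
  @subrack (conj_rack gT) X /\ X \subset O.

Definition rack_isom (gT hT : finGroupType) (X : {set gT}) (Y : {set hT}) : Prop :=
  @subrack_isom (conj_rack gT) (conj_rack hT) X Y.

Definition has_subrack (gT hT : finGroupType) (O : {set gT}) (Y : {set hT}) : Prop :=
  exists2 X : {set gT}, is_subrack O X & rack_isom X Y.

(* The cycle (1 2 ... n), with letters shifted to {0, ..., n-1}. *)
Definition long_cycle (n : nat) : 'S_n := perm (@ordS_inj n).

Definition subfieldb (F : finFieldType) (S : {set F}) : bool :=
  [&& 1 \in S,
      [forall x in S, forall y in S, x - y \in S]
    & [forall x in S, forall y in S, x / y \in S]].

Record subfield (F : finFieldType) := Subfield {
  subfield_set : {set F};
  subfieldP : subfieldb subfield_set
}.

Section SubfieldType.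
Variables (F : finFieldType) (K : subfield F).

Definition in_subfield : {pred F} := fun x => x \in subfield_set K.

Lemma in_subfield_closed : GRing.divring_closed in_subfield.
Proof.
have /and3P[K1 /forall_inP Ksub /forall_inP Kdiv] := subfieldP K.
split=> // x y Kx Ky.
- exact: (forall_inP (Ksub x Kx)).
- exact: (forall_inP (Kdiv x Kx)).
Qed.

HB.instance Definition _ := GRing.isDivringClosed.Build F in_subfield
  in_subfield_closed.

Record subfield_elt : predArgType :=
  SubfieldElt { sfval : F; _ : in_subfield sfval }.

HB.instance Definition _ := [isSub for sfval].
HB.instance Definition _ := [Finite of subfield_elt by <:].
HB.instance Definition _ := [SubChoice_isSubComUnitRing of subfield_elt by <:].
HB.instance Definition _ :=
  [SubComUnitRing_isSubIntegralDomain of subfield_elt by <:].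
HB.instance Definition _ := [SubIntegralDomain_isSubField of subfield_elt by <:].

Definition subfield_finField : finFieldType := subfield_elt.
End SubfieldType.

Coercion subfield_finField : subfield >-> finFieldType.

Section GeneratedSubfield.
Variables (F : finFieldType) (S : {set F}).

Definition gen_subfield_set : {set F} :=
  \bigcap_(T : {set F} | subfieldb T && (S \subset T)) T.

Lemma gen_subfield_subproof : subfieldb gen_subfield_set.
Proof.
apply/and3P; split.
- by apply/bigcapP=> T /andP[/and3P[]].
- apply/forall_inP=> x /bigcapP gx; apply/forall_inP=> y /bigcapP gy.
  apply/bigcapP=> T sT; case/andP: (sT) => /and3P[_ /forall_inP sub _] _.
  exact: (forall_inP (sub x (gx T sT)) y (gy T sT)).
- apply/forall_inP=> x /bigcapP gx; apply/forall_inP=> y /bigcapP gy.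
  apply/bigcapP=> T sT; case/andP: (sT) => /and3P[_ _ /forall_inP div] _.
  exact: (forall_inP (div x (gx T sT)) y (gy T sT)).
Qed.

Definition gen_subfield : subfield F := Subfield gen_subfield_subproof.

Lemma mem_gen_subfield x : x \in S -> in_subfield gen_subfield x.
Proof.
by move=> Sx; apply/bigcapP=> T /andP[_ /subsetP]; apply.
Qed.
End GeneratedSubfield.

(* The group A x|_q C of pairs (a, c), with A a vector space over the smallest
   subfield of [F] containing [C] and C acting by multiplication. *)
Section SemidirectProduct.
Variables (F : finFieldType) (C : {group {unit F}}).

Definition units_val (S : {set {unit F}}) : {set F} := FinRing.uval @: S.

Definition base_field : subfield F := gen_subfield (units_val C).

Lemma scalar_subproof (c : subg_of C) :
  in_subfield base_field (FinRing.uval (sgval c)).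
Proof. by apply: mem_gen_subfield; apply/imset_f/subgP. Qed.

Definition scalar (c : subg_of C) : base_field := SubfieldElt (scalar_subproof c).

Variable A : finLmodType base_field.

Record sdprodq := SDpair { sdfst : A; sdsnd : subg_of C }.

Definition sdprodq_pair (x : sdprodq) := (sdfst x, sdsnd x).
Definition pair_sdprodq (x : A * subg_of C) := SDpair x.1 x.2.
Lemma sdprodq_pairK : cancel sdprodq_pair pair_sdprodq.
Proof. by case. Qed.

HB.instance Definition _ := Finite.copy sdprodq (can_type sdprodq_pairK).

Definition sdprodq_mul (x y : sdprodq) : sdprodq :=
  SDpair (sdfst x + scalar (sdsnd x) *: sdfst y) (sdsnd x * sdsnd y)%g.
Definition sdprodq_one : sdprodq := SDpair 0 1%g.
Definition sdprodq_inv (x : sdprodq) : sdprodq :=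
  SDpair (- (scalar (sdsnd x)^-1%g *: sdfst x)) (sdsnd x)^-1%g.

Lemma scalarM (c d : subg_of C) : scalar (c * d)%g = scalar c * scalar d.
Proof. exact/val_inj. Qed.
Lemma scalar1 : scalar 1%g = 1.
Proof. exact/val_inj. Qed.

Lemma sdprodq_mulA : associative sdprodq_mul.
Proof.
move=> [a c] [b d] [e f]; congr SDpair; rewrite /= ?mulgA //.
by rewrite scalarM scalerDr scalerA addrA.
Qed.
Lemma sdprodq_mul1 : left_id sdprodq_one sdprodq_mul.
Proof.
by case=> a c; congr SDpair; rewrite /= ?mul1g // scalar1 scale1r add0r.
Qed.
Lemma sdprodq_mulV : left_inverse sdprodq_one sdprodq_inv sdprodq_mul.
Proof. by case=> a c; congr SDpair; rewrite /= ?mulVg // addNr. Qed.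

HB.instance Definition _ :=
  Finite_isGroup.Build sdprodq sdprodq_mulA sdprodq_mul1 sdprodq_mulV.

(* The subset A x|_q S, meant for S \subset C. *)
Definition sdprodq_set (S : {set {unit F}}) : {set sdprodq} :=
  [set x | sgval (sdsnd x) \in S].
End SemidirectProduct.

Section PGL2.
Variable F : finFieldType.
Local Open Scope group_scope.

Definition squares : {set F} := [set (b ^+ 2)%R | b : F & b != 0%R].

Definition scalar_GL2 : {set {'GL_2[F]}} := [set g | is_scalar_mx (GLval g)].

Lemma scalar_GL2_group_set : group_set scalar_GL2.
Proof.
apply/group_setP; split=> [|g h]; rewrite !inE.
  by rewrite GL_1E scalar_mx_is_scalar.
case/is_scalar_mxP=> a ga /is_scalar_mxP[b hb].
by rewrite GL_MxE ga hb -scalar_mxM scalar_mx_is_scalar.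
Qed.
Canonical scalar_GL2_group := Group scalar_GL2_group_set.

(* Scalar matrices being normalised by all of GL, [PGL2] is the whole of
   [PGL2_type]. *)
Definition PGL2_type : finGroupType := coset_of scalar_GL2.
Definition PGL2 : {set PGL2_type} := 'GL_2[F] / scalar_GL2.
Definition PSL2 : {set PGL2_type} :=
  [set coset scalar_GL2 g | g : {'GL_2[F]} & \det (GLval g) \in squares].

(* A point of P(1,q) is the set of vectors of a line of F^2. *)
Definition proj_point (v : 'cV[F]_2) : {set 'cV[F]_2} := [set (a *: v)%R | a : F].
Definition proj_line : {set {set 'cV[F]_2}} :=
  [set proj_point v | v : 'cV[F]_2 & v != 0%R].
Definition fixed_points (x : PGL2_type) : {set {set 'cV[F]_2}} :=
  [set L in proj_line |
    [forall g in set_of_coset x, [set (GLval g *m v)%R | v in L] == L]].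

Definition split_class (O : {set PGL2_type}) : Prop :=
  O != [set 1] /\ forall x, x \in O -> #|fixed_points x| = 2.
Definition nonsplit_class (O : {set PGL2_type}) : Prop :=
  O != [set 1] /\ forall x, x \in O -> #|fixed_points x| = 0.
Definition semisimple_class (O : {set PGL2_type}) : Prop :=
  split_class O \/ nonsplit_class O.

Local Open Scope ring_scope.

(* The equivalence r(lam x) ~ lam^n r(x), n = deg r, read on polynomials with a
   fixed leading coefficient: r(x) ~ lam^-n r(lam x). *)
Definition poly_sim (r s : {poly F}) : Prop :=
  exists2 lam : F, lam != 0 & r \Po (lam *: 'X) = lam ^+ (size r).-1 *: s.

Definition class_charpoly (O : {set PGL2_type}) (r : {poly F}) : Prop :=
  forall x, x \in O -> forall g, g \in set_of_coset x ->
    poly_sim (char_poly (GLval g)) r.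

Definition diag_z1 (z : {unit F}) : 'M[F]_2 :=
  diag_mx (\row_j if j == 0 then FinRing.uval z else 1).

Lemma diag_z1_unit (z : {unit F}) : diag_z1 z \is a GRing.unit.
Proof.
rewrite [_ \is a _]unitmxE det_diag big_ord_recl big_ord1 !mxE /= mulr1.
exact: (valP z).
Qed.

Definition pgl_diag (z : {unit F}) : PGL2_type :=
  coset scalar_GL2 (FinRing.unit _ (diag_z1_unit z) : {'GL_2[F]}).
End PGL2.

(* The squares [z] of order [o] such that the class of diag(z, 1) lies in [O],
   i.e. such that the copy {[z a; 0 1]} of A x|_q {z} is a subset of [O]; the
   order alone would only determine [z] up to powers prime to [o]. *)
Definition eigenvalue_ratio (F : finFieldType) (O : {set PGL2_type F}) (o : nat)
    (z : {unit F}) : Prop :=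
  [/\ FinRing.uval z \in squares F, #[z]%g = o & pgl_diag z \in O].

Definition class_with_charpoly (F : finFieldType) (d : F)
    (O : {set PGL2_type F}) : Prop :=
  O \in classes (PGL2 F) /\ class_charpoly O ('X^2 + 'X + d%:P).

(* Main.v *)
Require Import Defs.
From mathcomp Require Import all_boot all_order all_algebra.
From mathcomp Require Import all_fingroup all_solvable all_field.
From mathcomp Require Import ring zify.

(** The class [O] is first replaced by a set of matrices. A representative of an element of
    order at least 4 has nonzero trace, so it can be scaled to trace one, and [O] becomes the
    set [trdet d] of all matrices of trace 1 and determinant [d] ([class_pglT]). In this form
    the quotient by scalars has disappeared, two elements commute only if they are equal or
    inverse ([trdet_comm]), and [d] decides the order: 2d = 1 for order 4, d^2 - 3d + 1 = 0
    for order 5.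

    The listed subracks exist for the following reasons. Two matrices [N1], [N2] of [trdet d]
    satisfy relations that depend only on [d] and on the trace of [N1 N2], by the
    Cayley-Hamilton theorem. When that trace is [d], and the order is 4 or 5, the words in
    [N1] and [N2] close up after 6 or 12 elements, and their conjugation table is that of
    (1 2 3 4)^Sym(4) or (1 2 3 4 5)^Alt(5); the tables are checked by symbolic computation
    ([trdet_table_Sym4], [trdet_table_Alt5]), and a suitable pair exists because a norm form
    of a quadratic algebra over a finite field is onto ([trdet_pair]). In a split class the
    affine maps t |-> zt + b with b in an embedded copy of A form the racks A x {z}, and for a
    subfield K that contains [d] the matrices of [trdet d] with entries in K form the class of
    PGL(2,K).

    For the converse let X be a subrack with two noncommuting elements, and H the group that
    it generates; X is stable under conjugation by H. Let H act on the projective line over an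
    extension E of F in which all quadratic polynomials over F have a root. An element of H
    other than 1 fixes one point if it is unipotent and two otherwise. Counting orbits as for
    the finite subgroups of PGL(2), and using that H contains an element of order at least 4,
    leaves four possibilities ([count_outcome]).
    - H fixes a point. It is not abelian, so it contains a unipotent element, the point is
      rational, and X is an affine rack ([affine_case]).
    - H is dihedral. Then X consists of rotations and is commutative, a contradiction.
    - H has order 24 or 60 and a stabiliser of order 4 or 5. Counting fixed points bounds the
      size of X by 6 or 12, and a computation of mutual traces produces two elements of mutual
      trace [d] in X or among the inverses. The rack they generate has the maximal size, so it
      is X ([small_case]).
    - Some orbit has q' + 1 points, where q' is the order of the unipotent radical of a
      stabiliser. After conjugation the translations in H form an additive group V of order q'
      which, because there are enough dilations, equals the field K of its multipliers
      ([trans_multK]). Then H contains SL(2,K), the matrices of X have entries in K, and X is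
      the whole of [trdet e] over K ([big_subT]). For K with 3 or 4 elements this is again one
      of the two polyhedral racks, by size ([pglT_F3], [pglT_F4]).
    The divisibility conditions come from 8th and 5th roots of unity in E ([dvd_card8],
    [dvd_card5]). *)

Set Implicit Arguments.
Unset Strict Implicit.
Unset Printing Implicit Defensive.

Import GRing.Theory.

(** * Two-by-two matrices and their classes in PGL(2,q) *)

Section Mx2.
Variable R : comNzRingType.
Local Open Scope ring_scope.
Implicit Types (M N : 'M[R]_2).

Definition mx2 (a b c e : R) : 'M[R]_2 :=
  \matrix_(i, j) if i == 0 then (if j == 0 then a else b)
                 else (if j == 0 then c else e).

Lemma ord2P (i : 'I_2) : i = 0 \/ i = 1.
Proof. by case: i => [[|[|//]]] ?; [left | right]; apply/val_inj. Qed.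

Lemma mx2_eta M : M = mx2 (M 0 0) (M 0 1) (M 1 0) (M 1 1).
Proof.
by apply/matrixP => i j; rewrite mxE; case: (ord2P i) => ->; case: (ord2P j) => ->.
Qed.

Lemma mx2P M : exists a b c e, M = mx2 a b c e.
Proof. by do 4!eexists; exact: mx2_eta. Qed.

Lemma mx2_inj a b c e a' b' c' e' :
  mx2 a b c e = mx2 a' b' c' e' -> [/\ a = a', b = b', c = c' & e = e'].
Proof.
by move=> /matrixP eqM; have := (eqM 0 0, eqM 0 1, eqM 1 0, eqM 1 1);
   rewrite !mxE /= => -[[[-> ->] ->] ->].
Qed.

Lemma mulmx2 a b c e a' b' c' e' :
  mx2 a b c e *m mx2 a' b' c' e' =
  mx2 (a * a' + b * c') (a * b' + b * e') (c * a' + e * c') (c * b' + e * e').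
Proof.
by apply/matrixP => i j; rewrite !mxE !big_ord_recl big_ord0 addr0 !mxE /=;
   case: (ord2P i) => ->; case: (ord2P j) => ->.
Qed.

Lemma scalemx2 k a b c e : k *: mx2 a b c e = mx2 (k * a) (k * b) (k * c) (k * e).
Proof.
by apply/matrixP => i j; rewrite !mxE; case: (ord2P i) => ->; case: (ord2P j) => ->.
Qed.

Lemma addmx2 a b c e a' b' c' e' :
  mx2 a b c e + mx2 a' b' c' e' = mx2 (a + a') (b + b') (c + c') (e + e').
Proof.
by apply/matrixP => i j; rewrite !mxE; case: (ord2P i) => ->; case: (ord2P j) => ->.
Qed.

Lemma oppmx2 a b c e : - mx2 a b c e = mx2 (- a) (- b) (- c) (- e).
Proof.
by apply/matrixP => i j; rewrite !mxE; case: (ord2P i) => ->; case: (ord2P j) => ->.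
Qed.

Lemma scalar_mx2 k : k%:M = mx2 k 0 0 k :> 'M[R]_2.
Proof.
by apply/matrixP => i j; rewrite !mxE; case: (ord2P i) => ->; case: (ord2P j) => ->.
Qed.

Lemma one_mx2 : (1 : 'M[R]_2) = mx2 1 0 0 1.
Proof. exact: scalar_mx2. Qed.

Lemma det_mx2 a b c e : \det (mx2 a b c e) = a * e - b * c.
Proof.
rewrite (expand_det_row _ 0) !big_ord_recl big_ord0 addr0 /cofactor.
rewrite !det_mx11 !mxE /=; ring.
Qed.

Lemma tr_mx2 a b c e : \tr (mx2 a b c e) = a + e.
Proof. by rewrite /mxtrace !big_ord_recl big_ord0 addr0 !mxE. Qed.

Definition mx2E := (mulmx2, scalemx2, addmx2, oppmx2, scalar_mx2, one_mx2, det_mx2, tr_mx2).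

(** Cayley-Hamilton. *)
Lemma mx2_CH M : M *m M = \tr M *: M - (\det M)%:M.
Proof.
have [a [b [c [e ->]]]] := mx2P M; rewrite !mx2E; congr mx2; ring.
Qed.

(** Polarised Cayley-Hamilton: together with [mx2_CH] it reduces every word in two
    matrices to a combination of 1, M, N and MN whose coefficients are polynomials in the
    traces and determinants. *)
Lemma mx2_mulC M N :
  N *m M = \tr M *: N + \tr N *: M + (\tr (M *m N) - \tr M * \tr N)%:M - M *m N.
Proof.
have [a [b [c [e ->]]]] := mx2P M; have [a' [b' [c' [e' ->]]]] := mx2P N.
rewrite !mx2E; congr mx2; ring.
Qed.

End Mx2.

Lemma map_mx2 (R S : comNzRingType) (f : {rmorphism R -> S}) a b c e :
  map_mx f (mx2 a b c e) = mx2 (f a) (f b) (f c) (f e).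
Proof.
by apply/matrixP => i j; rewrite !mxE; case: (ord2P i) => ->; case: (ord2P j) => ->.
Qed.

Lemma coset_mulE (gT : finGroupType) (A : {set gT}) (x y : gT) :
  (x \in 'N(A) -> y \in 'N(A) -> coset A (x * y) = coset A x * coset A y)%g.
Proof. exact: morphM. Qed.

Section Pgl.
Variable F : finFieldType.
Local Open Scope ring_scope.
Implicit Types (M N P : 'M[F]_2) (x y : PGL2_type F).

Lemma scalar_GL2_normal (g : {'GL_2[F]}) : g \in ('N(scalar_GL2 F))%g.
Proof.
rewrite inE; apply/subsetP => _ /imsetP[h /[!inE] /is_scalar_mxP[a ha] ->].
rewrite /conjg !GL_MxE ha -scalar_mxC mulmxA.
by rewrite -GL_MxE mulVg GL_1E mul1mx scalar_mx_is_scalar.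
Qed.

(** On singular matrices the value is the default 1. *)
Definition toGL M : {'GL_2[F]} := insubd (1%g : {'GL_2[F]}) M.

Lemma toGLK M : M \in unitmx -> GLval (toGL M) = M.
Proof. by move=> uM; apply: (@insubdK _ _ _ (1%g : {unit 'M[F]_2})). Qed.

Lemma toGL_val (g : {'GL_2[F]}) : toGL (GLval g) = g.
Proof. exact: (@valKd _ _ {unit 'M[F]_2} (1%g)). Qed.

Lemma toGLM M N : M \in unitmx -> N \in unitmx ->
  toGL (M *m N) = (toGL M * toGL N)%g.
Proof.
move=> uM uN; apply/val_inj.
by rewrite -[LHS]/(GLval _) toGLK ?unitmx_mul ?uM // -[RHS]/(GLval _) GL_MxE !toGLK.
Qed.

Definition pgl M : PGL2_type F := coset (scalar_GL2 F) (toGL M).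

Definition pglmx x : 'M[F]_2 := GLval (repr x).

Lemma pgl_coset (g : {'GL_2[F]}) : pgl (GLval g) = coset (scalar_GL2 F) g.
Proof. by rewrite /pgl toGL_val. Qed.

Lemma unit_pglmx x : pglmx x \in unitmx.
Proof. exact: (@GL_unit 2 F (repr x)). Qed.

Lemma pglmxK x : pgl (pglmx x) = x.
Proof. by rewrite pgl_coset coset_reprK. Qed.

Lemma pglM M N : M \in unitmx -> N \in unitmx ->
  pgl (M *m N) = (pgl M * pgl N)%g.
Proof. by move=> uM uN; rewrite /pgl toGLM //; apply: coset_mulE; apply: scalar_GL2_normal.
Qed.

Lemma pgl1 : pgl 1%:M = 1%g.
Proof.
apply: coset_id; rewrite inE toGLK ?unitmx1 //; exact: scalar_mx_is_scalar.
Qed.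

Lemma pglV M : M \in unitmx -> pgl (invmx M) = (pgl M)^-1%g.
Proof.
move=> uM; apply: (mulgI (pgl M)).
by rewrite mulgV -pglM ?unitmx_inv // mulmxV // pgl1.
Qed.

Lemma pgl_conj M N : M \in unitmx -> N \in unitmx ->
  pgl (M *m N *m invmx M) = conj_op (pgl M) (pgl N).
Proof.
by move=> uM uN; rewrite /conj_op !pglM ?pglV // ?unitmx_mul ?unitmx_inv ?uM.
Qed.

Lemma pgl_eq1 M : M \in unitmx -> reflect (exists k, M = k%:M) (pgl M == 1%g).
Proof.
move=> uM; rewrite /pgl; apply: (iffP eqP) => [|[k Mk]].
  move/coset_idr => /(_ (scalar_GL2_normal _)).
  by rewrite inE toGLK // => /is_scalar_mxP[k ->]; exists k.
by apply: coset_id; rewrite inE toGLK // Mk scalar_mx_is_scalar.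
Qed.

Lemma pgl_eq M N : M \in unitmx -> N \in unitmx ->
  reflect (exists2 k, k != 0 & M = k *: N) (pgl M == pgl N).
Proof.
move=> uM uN; apply: (iffP eqP) => [eqMN|[k k0 MN]].
  have uMN : M *m invmx N \in unitmx by rewrite unitmx_mul uM unitmx_inv.
  have /(pgl_eq1 uMN)[k kE] : pgl (M *m invmx N) == 1%g.
    by rewrite pglM ?unitmx_inv // pglV // eqMN mulgV.
  have ME : M = k *: N by rewrite -mul_scalar_mx -kE mulmxKV.
  exists k => //; apply/eqP => k0; move: uM.
  by rewrite ME k0 scale0r unitmxE det0 unitr0.
have uk : k%:M \in @unitmx F 2 by rewrite unitmxE det_scalar unitrX // unitfE.
rewrite MN -mul_scalar_mx pglM // (_ : pgl k%:M = 1%g) ?mul1g //.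
by apply/eqP/pgl_eq1 => //; exists k.
Qed.

Lemma pgl_scale k M : k != 0 -> M \in unitmx -> pgl (k *: M) = pgl M.
Proof.
move=> k0 uM; apply/eqP/pgl_eq => //; last by exists k.
by rewrite unitmxZ ?unitfE.
Qed.

Lemma set_of_cosetP x (g : {'GL_2[F]}) : (g \in set_of_coset x) = (pgl (GLval g) == x).
Proof.
rewrite pgl_coset; apply/idP/eqP => [gx|<-]; first by rewrite (coset_mem gx).
by rewrite val_coset ?scalar_GL2_normal // rcoset_refl.
Qed.

Lemma PGL2_setT : PGL2 F = setT.
Proof.
apply/setP => x; rewrite inE -[x]pglmxK; apply/morphimP.
by exists (toGL (pglmx x)); rewrite ?scalar_GL2_normal ?inE.
Qed.

Lemma PSL2P M : M \in unitmx -> (pgl M \in PSL2 F) = (\det M \in squares F).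
Proof.
move=> uM; apply/imsetP/idP => [[g /[swap]]|dM].
  rewrite inE -pgl_coset => /eqP/pgl_eq-/(_ uM (@GL_unit 2 F g))[k k0 ->] /imsetP[b].
  rewrite inE detZ => b0 ->; apply/imsetP.
  by exists (k * b); rewrite ?inE ?mulf_neq0 // exprMn.
by exists (toGL M); rewrite ?inE ?toGLK // -pgl_coset toGLK.
Qed.

End Pgl.

(** * Matrices of trace one *)

Section FieldFacts.
Variable F : finFieldType.
Local Open Scope ring_scope.

(** Squaring is at most two-to-one, and 0 has a single preimage. *)
Lemma card_sqr_image : (#|F| < 2 * #|[set x ^+ 2 | x : F]|)%N.
Proof.
set S := [set x ^+ 2 | x : F].
have S0 : 0 \in S by apply/imsetP; exists 0; rewrite ?inE // expr0n.
rewrite -[#|F|]sum1_card (partition_big_imset (fun x : F => x ^+ 2)) /= -/S.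
rewrite (bigD1 0) //= (cardsD1 0 S) S0 mulnDr muln1 -addn1 addnC [X in (_ <= X)%N]addnC.
rewrite addnA.
have -> : (\sum_(i : F | (i ^+ 2 == 0)%R) 1 = 1)%N.
  by rewrite (big_pred1 0) // => x; rewrite expf_eq0.
rewrite -[(1 + 1)%N]/2%N addnC leq_add2r -sum1_card big_distrr /=.
rewrite (eq_bigl (fun i => i \in S :\ 0)); last by move=> i; rewrite !inE andbC.
apply: leq_sum => s; rewrite !inE => /andP[s0 /imsetP[x _ sE]]; rewrite muln1.
rewrite sum1dep_card; apply: leq_trans (_ : #|[set x; - x]| <= 2)%N; last first.
  by rewrite cards2; case: eqP.
apply: subset_leq_card; apply/subsetP => y; rewrite !inE sE => /eqP e.
by rewrite -eqf_sqr e.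
Qed.

(** Pigeonhole: the sets of values a x^2 and c - b y^2 each fill more than half of the
    field. *)
Lemma diag_form_surj (a b c : F) : a != 0 -> b != 0 ->
  exists x y, a * x ^+ 2 + b * y ^+ 2 = c.
Proof.
move=> a0 b0; set S := [set x ^+ 2 | x : F].
pose A := [set a * s | s in S]; pose B := [set c - b * s | s in S].
have cA : #|A| = #|S| by apply: card_imset; apply: mulfI.
have cB : #|B| = #|S|.
  by apply: card_imset => s t /addrI/oppr_inj; apply: mulfI.
have : A :&: B != set0.
  rewrite -card_gt0; have := cardsUI A B; rewrite cA cB.
  have := card_sqr_image; rewrite -/S; have := max_card (A :|: B).
  move: #|A :|: B| #|A :&: B| #|S| #|F| => n1 n2 n3 n4. lia.
case/set0Pn => _ /setIP[/imsetP[_ /imsetP[x _ ->] ->] /imsetP[_ /imsetP[y _ ->] e]].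
by exists x, y; rewrite e subrK.
Qed.

Lemma char2_sqrt (c : F) : (2 : F) = 0 -> exists x : F, x ^+ 2 = c.
Proof.
move=> two0; suff /imsetP[x _ ->] : c \in [set x ^+ 2 | x : F] by exists x.
rewrite (_ : [set _ | x : F] = setT) ?inE //; apply/eqP.
rewrite eqEcard subsetT cardsT /= card_imset // => x y /eqP.
have eN (z : F) : - z = z.
  by apply/eqP; rewrite eq_sym -subr_eq0 opprK -mulr2n -mulr_natl two0 mul0r.
by rewrite eqf_sqr eN orbb => /eqP.
Qed.

(** The norm form of F[X]/(X^2 - X + d). In odd characteristic it can be diagonalised; in
    characteristic 2 its restriction to squares is already onto. *)
Lemma norm_form_surj (d c : F) : 1 - 4 * d != 0 ->
  exists x y, x ^+ 2 + x * y + d * y ^+ 2 = c.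
Proof.
move=> dd; have [two0|two0] := eqVneq (2 : F) 0.
  by have [x <-] := char2_sqrt c two0; exists x, 0; ring.
have four0 : (4 : F) != 0 by rewrite (_ : 4 = 2 * 2) ?mulf_neq0 //; ring.
have h4 : d - 1 / 4 != 0.
  apply: contra_neq dd => e; have -> : d = 1 / 4 by apply/eqP; rewrite -subr_eq0 e.
  by field.
have [x [y e]] := diag_form_surj c (oner_neq0 F) h4.
exists (x - y / 2), y; rewrite -e.
by field; rewrite ?two0 ?four0.
Qed.

End FieldFacts.

Section Conj.
Variable F : finFieldType.
Local Open Scope ring_scope.
Implicit Types (M N P : 'M[F]_2) (d : F).

(** A vector v such that v and Mv are independent gives the change of basis. It exists
    unless M is scalar, as the quadratic form det(v, Mv) is then nonzero somewhere. *)
Lemma companion_conj M : ~~ is_scalar_mx M ->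
  exists2 P, P \in unitmx & M *m P = P *m mx2 0 (- \det M) 1 (\tr M).
Proof.
have [a [b [c [e ->]]]] := mx2P M => nsc.
suff [x [y xy]] : exists x y, c * x ^+ 2 + (e - a) * x * y - b * y ^+ 2 != 0.
  exists (mx2 x (a * x + b * y) y (c * x + e * y)).
    rewrite unitmxE unitfE !mx2E; apply: contraNneq xy => h; apply/eqP.
    by rewrite -h; ring.
  by rewrite !mx2E; congr mx2; ring.
have [c0|c0] := eqVneq c 0; last by exists 1, 0; apply: contraNneq c0 => h; apply/eqP; rewrite -h; ring.
have [b0|b0] := eqVneq b 0; last first.
  by exists 0, 1; apply: contraNneq b0 => h; apply/eqP; rewrite -[b]opprK -oppr0 -h; ring.
exists 1, 1; apply: contraNneq nsc; rewrite b0 c0 => h.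
have -> : a = e by apply/eqP; rewrite eq_sym -subr_eq0 -h; apply/eqP; ring.
by rewrite -scalar_mx2 scalar_mx_is_scalar.
Qed.

(** Scaling representatives to trace one turns the elements of a class of PGL(2,q) into
    matrices, with [d] the invariant det / tr^2 of the class. *)
Definition trdet d : {set 'M[F]_2} := [set N | (\tr N == 1) && (\det N == d)].

Lemma trdetP d N : reflect (\tr N = 1 /\ \det N = d) (N \in trdet d).
Proof. by rewrite inE; apply: (iffP andP) => -[/eqP ? /eqP ?]. Qed.

Section Trdet.
Variable d : F.
Hypotheses (d0 : d != 0) (disc : 1 - 4 * d != 0).

Lemma trdet_unit N : N \in trdet d -> N \in unitmx.
Proof. by case/trdetP => _ dN; rewrite unitmxE unitfE dN. Qed.

Lemma trdet_nscalar N : N \in trdet d -> ~~ is_scalar_mx N.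
Proof.
case/trdetP => tN dN; apply/is_scalar_mxP => -[k Nk]; move: tN dN.
rewrite Nk !mx2E => tN dN; case/eqP: disc.
by transitivity ((k + k) ^+ 2 - 4 * d); [rewrite tN expr1n | rewrite -dN; ring].
Qed.

Lemma trdet_sqr N : N \in trdet d -> N *m N = N - d%:M.
Proof. by case/trdetP => tN dN; rewrite mx2_CH tN dN scale1r. Qed.

Lemma trdet_conj N P : P \in unitmx -> N \in trdet d -> P *m N *m invmx P \in trdet d.
Proof.
move=> uP /trdetP[tN dN]; apply/trdetP; split.
  by rewrite mxtrace_mulC mulKmx.
by rewrite !det_mulmx det_inv dN mulrAC mulrV ?mul1r // -unitmxE.
Qed.

(** Over a finite field the centraliser of M contains matrices of every determinant, since
    the norm form is onto; so conjugacy under GL is conjugacy under SL. *)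
Lemma trdet_SL_conj N M : N \in trdet d -> M \in trdet d ->
  exists2 P, \det P = 1 & N *m P = P *m M.
Proof.
move=> TN TM.
have [tN dN] := trdetP _ _ TN; have [tM dM] := trdetP _ _ TM.
have [P uP eP] := companion_conj (trdet_nscalar TN).
have [Q uQ eQ] := companion_conj (trdet_nscalar TM).
rewrite tN dN in eP; rewrite tM dM in eQ.
pose R := P *m invmx Q.
have eR : N *m R = R *m M.
  by rewrite /R mulmxA eP -!mulmxA; congr (_ *m _);
     rewrite -[in RHS](mulmxK uQ M) eQ !mulmxA mulVmx // mul1mx.
have [x [y xy]] := norm_form_surj (\det R)^-1 disc.
have uR : R \in unitmx by rewrite unitmx_mul uP unitmx_inv.
exists (R *m (x%:M + y *: M)).
  rewrite det_mulmx (_ : \det (x%:M + _) = (\det R)^-1) ?mulfV //.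
    by rewrite -unitfE -unitmxE.
  rewrite -xy -dM; have := tM.
  have [a [b [c [e ->]]]] := mx2P M; rewrite !mx2E => h.
  by transitivity (x ^+ 2 + x * y * (a + e) + (a * e - b * c) * y ^+ 2); [ring | rewrite h mulr1].
rewrite mulmxA eR -!mulmxA; congr (_ *m _).
by rewrite mulmxDl mulmxDr -scalar_mxC -scalemxAl -scalemxAr.
Qed.

Lemma trdet_adj N : N \in trdet d -> 1%:M - N \in trdet d.
Proof.
case/trdetP => tN dN; apply/trdetP; move: tN dN.
have [a [b [c [e ->]]]] := mx2P N.
rewrite !mx2E => h <-; have -> : e = 1 - a by rewrite -h; ring.
by split; ring.
Qed.

Lemma trdet_invmx N : N \in trdet d -> invmx N = d^-1 *: (1%:M - N).
Proof.
move=> TN; apply: (can_inj (mulKmx (trdet_unit TN))).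
rewrite mulmxV ?(trdet_unit TN) // -scalemxAr mulmxBr mulmx1 trdet_sqr // opprB addrC subrK.
by rewrite scale_scalar_mx mulVf.
Qed.

(** Commuting with N forces M = a + bN, and the conditions on the trace and determinant
    then leave a (1 - a) (1 - 4d) = 0. *)
Lemma trdet_comm N M : N \in trdet d -> M \in trdet d -> N *m M = M *m N ->
  M = N \/ M = 1%:M - N.
Proof.
move=> TN TM cNM.
have [P uP eP] := companion_conj (trdet_nscalar TN).
have [tN dN] := trdetP _ _ TN; rewrite tN dN in eP.
pose C := mx2 0 (- d) 1 1.
have NE : N = P *m C *m invmx P by rewrite -eP mulmxK.
pose M' := invmx P *m M *m P.
have ME : M = P *m M' *m invmx P by rewrite /M' !mulmxA mulmxV // mul1mx mulmxK.
have TM' : M' \in trdet d.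
  by rewrite /M' -{2}[P]invmxK; apply: trdet_conj; rewrite ?unitmx_inv.
have hC : C *m M' = M' *m C.
  have: invmx P *m (N *m M) *m P = invmx P *m (M *m N) *m P by rewrite cNM.
  by rewrite NE ME !mulmxA !(mulmxKV uP, mulVmx uP, mul1mx).
have [a [b [c [e M'E]]]] := mx2P M'; rewrite M'E /C !mx2E in hC.
case/mx2_inj: hC => h1 h2 h3 h4.
have [h5 h6] := trdetP _ _ TM'; rewrite M'E !mx2E in h5 h6.
have aE : a = 1 - e by rewrite -h5; ring.
have cE : c = 2 * e - 1.
  have: 1 * b + 1 * e = c * - d + e * 1 by [].
  by move: h3; rewrite aE => h3 _; transitivity (c * 0 + e * 1 - (1 * (1 - e)));
     [rewrite -h3; ring | ring].
have bE : b = - d * c by rewrite -[b]mul1r -[1 * b](addrK (1 * e)) h4; ring.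
have : (1 - e) * e * (1 - 4 * d) = 0.
  have -> : (1 - e) * e * (1 - 4 * d) = (a * e - b * c) - d.
    by rewrite aE bE cE; ring.
  by rewrite h6 subrr.
move/eqP; rewrite !mulf_eq0 (negPf disc) orbF => /orP[|/eqP e0].
  rewrite subr_eq0 eq_sym => /eqP e1; left.
  rewrite ME M'E NE /C; congr (_ *m _ *m _).
  by rewrite bE cE aE e1; congr mx2; ring.
right; have -> : 1%:M - N = P *m (1%:M - C) *m invmx P.
  by rewrite NE mulmxBr mulmx1 mulmxBl mulmxV.
rewrite ME M'E /C !mx2E; congr (_ *m _ *m _).
by rewrite bE cE aE e0; congr mx2; ring.
Qed.

(** The trace detects the scalar between two representatives. *)
Lemma pgl_trdet_inj : {in trdet d &, injective (@pgl F)}.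
Proof.
move=> N M TN TM /eqP/pgl_eq => /(_ (trdet_unit TN) (trdet_unit TM))[k _ NM].
have [tN _] := trdetP _ _ TN; have [tM _] := trdetP _ _ TM.
by move: tN; rewrite NM mxtraceZ tM mulr1 => ->; rewrite scale1r.
Qed.

Lemma pgl_trdet_conj N M : N \in trdet d -> M \in trdet d ->
  pgl (N *m M *m invmx N) = conj_op (pgl N) (pgl M).
Proof. by move=> /trdet_unit uN /trdet_unit uM; apply: pgl_conj. Qed.

Lemma pgl_trdetV N : N \in trdet d -> (pgl N)^-1%g = pgl (1%:M - N).
Proof.
move=> TN; rewrite -pglV ?trdet_unit // trdet_invmx // pgl_scale ?invr_eq0 //.
exact/trdet_unit/trdet_adj.
Qed.

Lemma pgl_trdet_comm N M : N \in trdet d -> M \in trdet d ->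
  commute (pgl N) (pgl M) -> pgl M = pgl N \/ pgl M = (pgl N)^-1%g.
Proof.
move=> TN TM cNM.
have : pgl (N *m M *m invmx N) = pgl M.
  by rewrite pgl_trdet_conj // /conj_op cNM mulgK.
move/(pgl_trdet_inj (trdet_conj (trdet_unit TN) TM) TM) => e.
have [] := trdet_comm TN TM; first by rewrite -{2}e mulmxKV // trdet_unit.
  by move=> ->; left.
by move=> ->; right; rewrite pgl_trdetV.
Qed.

Definition pglT : {set PGL2_type F} := [set pgl N | N in trdet d].

Lemma pglT_conj g x : x \in pglT -> conj_op g x \in pglT.
Proof.
case/imsetP => N TN ->; rewrite -[g]pglmxK -pgl_conj ?unit_pglmx ?trdet_unit //.
by apply/imset_f/trdet_conj; rewrite ?unit_pglmx.
Qed.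

Lemma pglTV x : x \in pglT -> x^-1%g \in pglT.
Proof. by case/imsetP => N TN ->; rewrite pgl_trdetV //; apply/imset_f/trdet_adj. Qed.

Lemma pglT_comm x y : x \in pglT -> y \in pglT -> commute x y -> y = x \/ y = x^-1%g.
Proof. by case/imsetP => N TN -> /imsetP[M TM ->]; apply: pgl_trdet_comm. Qed.

End Trdet.
End Conj.

(** * Racks of group elements *)

Section Racks.
Local Open Scope group_scope.

Lemma is_subrackP (gT : finGroupType) (O X : {set gT}) :
  is_subrack O X <-> [/\ X != set0, {in X &, forall x y, conj_op x y \in X} & X \subset O].
Proof. by split=> [[[? ?] ?]|[? ? ?]]; split => //; split. Qed.

Lemma rack_isomP (gT hT : finGroupType) (X : {set gT}) (Y : {set hT}) :
  rack_isom X Y <-> exists f : gT -> hT, [/\ {in X &, injective f}, f @: X = Y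
     & {in X &, forall x y, f (conj_op x y) = conj_op (f x) (f y)}].
Proof. by split=> -[f [? ? ?]]; exists f; split. Qed.

Lemma rack_isom_trans (gT hT kT : finGroupType) (X : {set gT}) (Y : {set hT}) (Z : {set kT}) :
  rack_isom X Y -> rack_isom Y Z -> rack_isom X Z.
Proof.
move=> /rack_isomP[f [f_inj <- fM]] /rack_isomP[g [g_inj <- gM]].
apply/rack_isomP; exists (g \o f); split=> [x y Xx Xy /g_inj||x y Xx Xy] /=.
- by move=> /(_ (imset_f _ Xx) (imset_f _ Xy)); apply: f_inj.
- by rewrite imset_comp.
- by rewrite fM // gM // imset_f.
Qed.

(** The inverse bijection is a morphism since X is closed. *)
Lemma rack_isom_sym (gT hT : finGroupType) (X : {set gT}) (Y : {set hT}) :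
  {in X &, forall x y, conj_op x y \in X} -> rack_isom X Y -> rack_isom Y X.
Proof.
move=> Xc /rack_isomP[f [f_inj <- fM]].
pose g y := odflt 1 [pick x in X | f x == y].
have gK : {in X, cancel f g}.
  move=> x Xx; rewrite /g; case: pickP => [z /andP[Xz /eqP]|/(_ x)]; first exact: f_inj.
  by rewrite Xx eqxx.
apply/rack_isomP; exists g; split.
- by move=> _ _ /imsetP[x Xx ->] /imsetP[y Xy ->]; rewrite !gK // => ->.
- by rewrite -imset_comp -[RHS]imset_id; apply: eq_in_imset => x Xx /=; rewrite gK.
- by move=> _ _ /imsetP[x Xx ->] /imsetP[y Xy ->]; rewrite -fM // !gK ?Xc.
Qed.

Lemma rack_isom_conj (gT : finGroupType) (X : {set gT}) (g : gT) :
  rack_isom X [set conj_op g x | x in X].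
Proof.
apply/rack_isomP; exists (conj_op g); split=> // [x y _ _|x y _ _].
  exact: (bij_inj (conj_bij g)).
exact: conj_distr.
Qed.

(** Isomorphisms with the classes of Sym(4) and Alt(5) are obtained in this way, from
    enumerations of both racks by the same indices. *)
Lemma rack_isom_table (gT hT : finGroupType) (I : finType) (t : I -> I -> I)
    (a : I -> gT) (b : I -> hT) :
  injective a -> injective b ->
  (forall i j, conj_op (a i) (a j) = a (t i j)) ->
  (forall i j, conj_op (b i) (b j) = b (t i j)) ->
  rack_isom (a @: setT) (b @: setT).
Proof.
move=> a_inj b_inj aM bM.
pose f x := odflt 1 (omap b [pick i | a i == x]).
have fa i : f (a i) = b i.
  by rewrite /f; case: pickP => [j /eqP/a_inj->|/(_ i)] //=; rewrite eqxx.
apply/rack_isomP; exists f; split.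
- by move=> _ _ /imsetP[i _ ->] /imsetP[j _ ->]; rewrite !fa => /b_inj->.
- by rewrite -imset_comp; apply: eq_imset => i /=; rewrite fa.
- by move=> _ _ /imsetP[i _ ->] /imsetP[j _ ->]; rewrite aM !fa bM.
Qed.

(** By finiteness a conjugation that maps X into itself permutes X; so X is normalised by
    its elements, hence by the group that they generate. *)
Lemma subrack_norm (gT : finGroupType) (X : {set gT}) :
  {in X &, forall x y, conj_op x y \in X} ->
  forall h, h \in <<X>> -> {in X, forall y, conj_op h y \in X}.
Proof.
move=> Xc; have sXN : X \subset 'N(X).
  apply/subsetP => x Xx; rewrite -groupV inE.
  apply/subsetP => _ /imsetP[y Xy ->].
  by rewrite conjgE invgK mulgA; apply: Xc.
move=> h; have := sXN; rewrite -gen_subG => /subsetP sHN /sHN; rewrite -groupV.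
move=> Nh y Xy; rewrite /conj_op -{1}[h]invgK -mulgA -conjgE.
by rewrite memJ_norm.
Qed.

End Racks.

(** * Semisimple classes and matrices of trace one *)

Section Classes.
Variable F : finFieldType.
Local Open Scope ring_scope.
Implicit Types (M N P : 'M[F]_2) (d : F).

Lemma pglX M n : M \in unitmx -> (pgl M ^+ n)%g = pgl (M ^+ n).
Proof.
move=> uM; have uMn k : M ^+ k \in unitmx by apply: unitrX.
elim: n => [|n IHn]; first by rewrite expg0 expr0 pgl1.
by rewrite expgS exprS pglM // IHn.
Qed.

Section Order.
Variables (d : F) (N : 'M[F]_2).
Hypotheses (d0 : d != 0) (disc : 1 - 4 * d != 0) (TN : N \in trdet d).

(** N is not a scalar matrix. *)
Lemma pgl_trdet_lin_eq1 n a b : N ^+ n = a *: N + b%:M -> (pgl N ^+ n == 1)%g = (a == 0).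
Proof.
move=> NE; have uN := trdet_unit d0 TN; have uNn : N ^+ n \in unitmx by apply: unitrX.
rewrite pglX //; apply/(pgl_eq1 uNn)/eqP => [[k]|a0].
  rewrite NE => e; apply/eqP; apply: contraT => a0; case/negP: (trdet_nscalar disc TN).
  apply/is_scalar_mxP; exists (a^-1 * (k - b)).
  by rewrite -scale_scalar_mx raddfB /= -e addrK scalerA mulVf // scale1r.
by exists b; rewrite NE a0 scale0r add0r.
Qed.

Lemma trdet_exp2 : N ^+ 2 = 1 *: N + (- d)%:M.
Proof. by rewrite scale1r raddfN /= expr2; apply: trdet_sqr. Qed.

Lemma trdet_expS n a b : N ^+ n = a *: N + b%:M ->
  N ^+ n.+1 = (a + b) *: N + (- a * d)%:M.
Proof.
move=> NE; rewrite exprS NE mulrDr -scalerAr -[N * N]/(N *m N) (trdet_sqr TN).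
rewrite scalerBr -[N * b%:M]/(N *m b%:M) scalar_mxC mul_scalar_mx scale_scalar_mx.
by rewrite scalerDl addrAC mulNr raddfN.
Qed.

Lemma trdet_exp3 : N ^+ 3 = (1 - d) *: N + (- d)%:M.
Proof. by rewrite (trdet_expS trdet_exp2) mulN1r. Qed.

Lemma trdet_exp4 : N ^+ 4 = (1 - 2 * d) *: N + (- (1 - d) * d)%:M.
Proof. by rewrite (trdet_expS trdet_exp3); congr (_ *: _ + _); ring. Qed.

Lemma trdet_exp5 : N ^+ 5 = (d ^+ 2 - 3 * d + 1) *: N + (- (1 - 2 * d) * d)%:M.
Proof. by rewrite (trdet_expS trdet_exp4); congr (_ *: _ + _); ring. Qed.

Lemma pgl_trdet_exp3 : (pgl N ^+ 3 == 1)%g = (1 - d == 0).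
Proof. exact: pgl_trdet_lin_eq1 trdet_exp3. Qed.

Lemma pgl_trdet_exp4 : (pgl N ^+ 4 == 1)%g = (1 - 2 * d == 0).
Proof. exact: pgl_trdet_lin_eq1 trdet_exp4. Qed.

Lemma pgl_trdet_exp5 : (pgl N ^+ 5 == 1)%g = (d ^+ 2 - 3 * d + 1 == 0).
Proof. exact: pgl_trdet_lin_eq1 trdet_exp5. Qed.

End Order.

Lemma eig_root d N (v : 'cV_2) c : N \in trdet d -> v != 0 -> N *m v = c *: v ->
  c ^+ 2 - c + d = 0.
Proof.
move=> TN v0 Nv; have : (c ^+ 2 - c + d) *: v = 0.
  have := congr1 (fun M => M *m v) (trdet_sqr TN).
  rewrite mulmxBl -mulmxA Nv -scalemxAr Nv scalerA -expr2 mul_scalar_mx => e.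
  by rewrite scalerDl scalerBl e addrAC subrK subrr.
by move/eqP; rewrite scaler_eq0 (negPf v0) orbF => /eqP.
Qed.

Lemma fixed_pointsP M v : M \in unitmx -> v != 0 ->
  reflect (exists c, M *m v = c *: v) (proj_point v \in fixed_points (pgl M)).
Proof.
move=> uM v0; rewrite inE.
have -> : proj_point v \in proj_line F by apply/imsetP; exists v; rewrite ?inE.
apply: (iffP forall_inP) => /= [fixv|[c Mv] g].
  have /fixv/eqP e : toGL M \in set_of_coset (pgl M) by rewrite set_of_cosetP toGLK.
  have : M *m v \in proj_point v.
    rewrite -e toGLK //; apply/imsetP; exists v => //.
    by apply/imsetP; exists 1; rewrite ?scale1r.
  by case/imsetP => c _ ->; exists c.
have c0 : c != 0.
  apply: contraNneq v0 => c0; move: Mv; rewrite c0 scale0r => Mv.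
  by rewrite -(mulKmx uM v) Mv mulmx0.
rewrite set_of_cosetP => /pgl_eq-/(_ (@GL_unit 2 F g) uM)[k k0 ->].
rewrite eqEsubset; apply/andP; split; apply/subsetP => w.
  case/imsetP => _ /imsetP[a _ ->] ->; rewrite -scalemxAr -scalemxAl Mv !scalerA.
  by apply/imsetP; exists (a * (k * c)); rewrite ?mulrA.
case/imsetP => a _ ->; apply/imsetP; exists ((a / (k * c)) *: v).
  by apply/imsetP; exists (a / (k * c)).
by rewrite -scalemxAr -scalemxAl Mv !scalerA -mulrA divfK ?mulf_neq0.
Qed.

Lemma proj_lineP L : L \in proj_line F -> exists2 v, v != 0 & L = proj_point v.
Proof. by case/imsetP => v; rewrite inE => v0 ->; exists v. Qed.

Lemma proj_point_eqP (v w : 'cV[F]_2) : v != 0 -> w != 0 ->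
  v 0 0 * w 1 0 = v 1 0 * w 0 0 -> proj_point v = proj_point w.
Proof.
move=> v0 w0 e; suff [k k0 ->] : exists2 k, k != 0 & v = k *: w.
  apply/setP => u; apply/imsetP/imsetP => -[a _ ->].
    by exists (a * k); rewrite ?scalerA.
  by exists (a / k); rewrite ?scalerA ?divfK.
have wE : exists i, w i 0 != 0.
  apply/existsP; apply: contraNT w0 => /existsPn w0; apply/eqP/matrixP => i j.
  by rewrite ord1 mxE; apply/eqP; move: (w0 i); rewrite negbK.
have [k vE] : exists k, v = k *: w.
  case: wE => i wi; exists (v i 0 / w i 0); apply/matrixP => j l; rewrite ord1 mxE.
  apply: (mulIf wi); rewrite mulrAC divfK //.
  by case: (ord2P i) wi => ->; case: (ord2P j) => -> // _; rewrite e.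
by exists k => //; apply: contraNneq v0 => k0; rewrite vE k0 scale0r.
Qed.

(** With 1 - 4d = 0 the eigenvalue is double, and its eigenspace is a line unless N is
    scalar. *)
Lemma fixed_points_disc0 d N : N \in trdet d -> d != 0 -> 1 - 4 * d = 0 ->
  ~~ is_scalar_mx N -> #|fixed_points (pgl N)| = 1%N.
Proof.
move=> TN d0 disc nsc; have uN := trdet_unit d0 TN.
have l1 : 2 * (2 * d) = 1 by apply/eqP; rewrite eq_sym -subr_eq0 -disc; apply/eqP; ring.
pose l := 2 * d.
have ll : l ^+ 2 = d by transitivity (d * (2 * (2 * d))); [rewrite /l; ring | rewrite l1 mulr1].
have eig c : c ^+ 2 - c + d = 0 -> c = l.
  move=> e; apply/eqP; rewrite -subr_eq0 -sqrf_eq0; apply/eqP.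
  transitivity (c ^+ 2 - c * (2 * (2 * d)) + l ^+ 2); first by rewrite /l; ring.
  by rewrite l1 mulr1 ll.
have S : (N - l%:M) *m (N - l%:M) = 0.
  rewrite mulmxBl !mulmxBr (trdet_sqr TN) scalar_mxC !mul_scalar_mx scale_scalar_mx.
  rewrite -expr2 ll opprB addrACA subrK -opprD -scalerDl (_ : l + l = 1) ?scale1r ?subrr //.
  by rewrite -l1 /l; ring.
have [v v0 Nv] : exists2 v : 'cV[F]_2, v != 0 & N *m v = l *: v.
  have : N - l%:M != 0.
    by apply: contraNneq nsc => /eqP; rewrite subr_eq0 => /eqP->; apply: scalar_mx_is_scalar.
  case/matrix0Pn => i [j nij]; exists (col j (N - l%:M)).
    by apply: contraNneq nij => /matrixP/(_ i 0); rewrite mxE [RHS]mxE => ->.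
  apply/eqP; rewrite -subr_eq0 -mul_scalar_mx -mulmxBl.
  by rewrite [X in _ *m X]colE mulmxA S mul0mx.
apply/eqP/cards1P; exists (proj_point v); apply/setP => L; rewrite inE.
apply/idP/eqP => [LF|->]; last by apply/fixed_pointsP => //; exists l.
have /proj_lineP[w w0 LE] : L \in proj_line F by move: LF; rewrite inE => /andP[].
rewrite LE in LF *; have /(fixed_pointsP uN w0)[c Nw] := LF.
have cl : c = l by apply: eig; apply: (eig_root TN w0).
rewrite cl in Nw; apply: proj_point_eqP => //; apply/eqP; apply: contraNT nsc => h.
pose P := mx2 (w 0 0) (v 0 0) (w 1 0) (v 1 0).
have uP : P \in unitmx.
  by rewrite unitmxE unitfE det_mx2 subr_eq0 [v 0 0 * _]mulrC.
suff e' : N *m P = l *: P.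
   rewrite -(mulmxK uP N) e' -scalemxAl mulmxV // scale_scalar_mx.
  exact: scalar_mx_is_scalar.
have [a [b [c' [e NE]]]] := mx2P N.
have comp (u : 'cV_2) : N *m u = l *: u ->
    a * u 0 0 + b * u 1 0 = l * u 0 0 /\ c' * u 0 0 + e * u 1 0 = l * u 1 0.
  rewrite NE => /matrixP E; have := (E 0 0, E 1 0).
  by rewrite !mxE !big_ord_recl !big_ord0 !addr0 !mxE /= => -[<- <-]; split; congr (_ + _ * u _ 0); apply/val_inj.
have [w1 w2] := comp w Nw; have [v1 v2] := comp v Nv.
by rewrite NE /P mulmx2 scalemx2 w1 w2 v1 v2.
Qed.

(** A representative of trace 0 would have order 2, so every representative can be scaled
    to trace one; the discriminant is not 0, otherwise there would be a single fixed point.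
    Conversely all matrices of trace one and determinant d are conjugate under SL(2,q). *)
Lemma class_pglT (O : {set PGL2_type F}) o :
  O \in classes (PSL2 F) -> semisimple_class O ->
  (forall y, y \in O -> #[y]%g = o) -> (4 <= o)%N ->
  exists d, [/\ d != 0, 1 - 4 * d != 0, d \in squares F & O = pglT d].
Proof.
case/imsetP => x Px ->{O} ss ord o4.
have ssx : x \in (x ^: PSL2 F)%g.
  apply/imsetP; exists 1%g; rewrite ?conjg1 // -pgl1 PSL2P ?unitmx1 //.
  by apply/imsetP; exists 1; rewrite ?inE ?oner_eq0 // det1 expr1n.
have ox : #[x]%g = o := ord x ssx.
pose M := pglmx x; have uM : M \in unitmx := unit_pglmx x.
have dM0 : \det M != 0 by rewrite -unitfE -unitmxE.
have sM : \det M \in squares F by rewrite -PSL2P // pglmxK.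
have t0 : \tr M != 0.
  apply/eqP => t0; have : (#[x]%g %| 2)%N.
    rewrite order_dvdn -[x]pglmxK pglX // -/M.
    apply/pgl_eq1; first exact: unitrX.
    by exists (- \det M); rewrite expr2 -[M * M]/(M *m M) mx2_CH t0 scale0r sub0r raddfN.
  by move/dvdn_leq; rewrite ox; lia.
pose N := (\tr M)^-1 *: M.
have uN : N \in unitmx by rewrite unitmxZ // unitfE invr_eq0.
have xN : x = pgl N by rewrite pgl_scale ?invr_eq0 // pglmxK.
pose d := \det N.
have TN : N \in trdet d by apply/trdetP; rewrite mxtraceZ mulVf.
have dE : d = (\tr M)^-1 ^+ 2 * \det M by rewrite /d detZ.
have d0 : d != 0 by rewrite -unitfE -unitmxE.
have nsc : ~~ is_scalar_mx N.
  apply/is_scalar_mxP => -[k Nk]; move: o4; rewrite -ox.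
  suff -> : x = 1%g by rewrite order1.
  by rewrite xN; apply/eqP/pgl_eq1 => //; exists k.
have disc : 1 - 4 * d != 0.
  apply/eqP => disc; have := fixed_points_disc0 TN d0 disc nsc.
  by rewrite -xN; case: ss => -[_ /(_ x ssx)->].
exists d; split => //.
  case/imsetP: sM => b; rewrite inE => b0 bE; apply/imsetP; exists ((\tr M)^-1 * b).
    by rewrite inE mulf_neq0 // invr_eq0.
  by rewrite dE bE exprMn.
apply/setP => y; apply/imsetP/imsetP => [[g _ ->]|[N' TN' ->]].
  have /imsetP[N' TN' e] : conj_op g^-1%g x \in pglT d.
    by apply: pglT_conj => //; rewrite xN; apply: imset_f.
  by exists N' => //; rewrite -e /conj_op invgK conjgE mulgA.
have [P dP eP] := trdet_SL_conj disc TN TN'.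
have uP : P \in unitmx by rewrite unitmxE dP unitr1.
exists (pgl P).
  by rewrite PSL2P // dP; apply/imsetP; exists 1; rewrite ?inE ?oner_eq0 // expr1n.
by apply: (mulgI (pgl P)); rewrite -conjgC xN -!pglM ?eP // (trdet_unit d0 TN').
Qed.

End Classes.

(** * Characteristic polynomials up to scaling *)

Section CharPoly.
Variable F : finFieldType.
Local Open Scope ring_scope.
Implicit Types (M N P : 'M[F]_2) (d : F).

Lemma char_poly_mx2 M : char_poly M = 'X^2 - \tr M *: 'X + (\det M)%:P.
Proof.
have sz : size (char_poly M) = 3 by rewrite size_char_poly.
have c0 : (char_poly M)`_0 = \det M by rewrite char_poly_det sqrrN expr1n mul1r.
have c1 : (char_poly M)`_1 = - \tr M.
  exact: (@char_poly_trace _ 2 M isT).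
have c2 : (char_poly M)`_2 = 1.
  by have /monicP := char_poly_monic M; rewrite lead_coefE sz.
move: (char_poly M) sz c0 c1 c2 => p sz c0 c1 c2.
apply/polyP => -[|[|[|n]]]; rewrite !coefE /=.
- by rewrite c0 mulr0 subr0 add0r.
- by rewrite c1 mulr1 addr0 sub0r.
- by rewrite c2 mulr0 subr0 addr0.
by rewrite nth_default ?sz // mulr0 subr0 addr0.
Qed.

Lemma char_poly_simP M d : M \in unitmx ->
  poly_sim (char_poly M) ('X^2 + 'X + d%:P) <-> \tr M != 0 /\ \det M = \tr M ^+ 2 * d.
Proof.
move=> uM; have sz : size (char_poly M) = 3 by rewrite size_char_poly.
rewrite /poly_sim sz -[3.-1]/2%N char_poly_mx2.
have E l : ('X^2 - \tr M *: 'X + (\det M)%:P) \Po (l *: 'X) =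
    l ^+ 2 *: 'X^2 - (\tr M * l) *: 'X + (\det M)%:P.
  by rewrite comp_polyD comp_polyB comp_polyC comp_polyZ comp_polyX comp_Xn_poly
     exprZn scalerA.
split=> [[l l0]|[t0 dM]].
  rewrite E => /polyP e; have := (e 0, e 1); rewrite !coefE /= => -[].
  rewrite !(mulr0, mulr1, addr0, add0r, subr0, sub0r) => e0 e1.
  have tl : \tr M = - l.
    by apply/eqP; rewrite -eqr_oppLR; apply/eqP/(mulIf l0); rewrite mulNr e1 expr2.
  by rewrite tl sqrrN oppr_eq0; split=> //; rewrite -e0 oppr0 add0r.
exists (- \tr M); rewrite ?oppr_eq0 // E dM sqrrN mulrN scaleNr opprK -expr2.
by rewrite !scalerDr polyCM -[(_ ^+ 2)%:P * _]/(_ * _) mul_polyC.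
Qed.

Lemma pglT_class d : d != 0 -> 1 - 4 * d != 0 -> pglT d \in classes (PGL2 F).
Proof.
move=> d0 disc; pose N := mx2 0 (- d) 1 1.
have TN : N \in trdet d by apply/trdetP; rewrite !mx2E; split; ring.
apply/imsetP; exists (pgl N); first by rewrite PGL2_setT inE.
apply/setP => y; apply/imsetP/imsetP => [[N' TN' ->]|[g _ ->]].
  have [P dP eP] := trdet_SL_conj disc TN TN'.
  have uP : P \in unitmx by rewrite unitmxE dP unitr1.
  exists (pgl P); first by rewrite PGL2_setT inE.
  by apply: (mulgI (pgl P)); rewrite -conjgC -!pglM ?eP // (trdet_unit d0).
have /imsetP[N' TN' e] : conj_op g^-1%g (pgl N) \in pglT d.
  by apply: pglT_conj => //; apply: imset_f.
by exists N' => //; rewrite -e /conj_op invgK conjgE mulgA.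
Qed.

Lemma pglT_neq0 d : pglT d != set0.
Proof.
apply/set0Pn; exists (pgl (mx2 0 (- d) 1 1)); apply/imset_f/trdetP.
by rewrite !mx2E; split; ring.
Qed.

Lemma pglT_charpoly d : d != 0 -> class_charpoly (pglT d) ('X^2 + 'X + d%:P).
Proof.
move=> d0 _ /imsetP[N TN ->] g; rewrite set_of_cosetP => /pgl_eq.
move/(_ (@GL_unit 2 F g) (trdet_unit d0 TN)) => [k k0 gE].
have [tN dN] := trdetP _ _ TN.
apply/char_poly_simP; first exact: (@GL_unit 2 F g).
by rewrite gE mxtraceZ detZ tN dN mulr1.
Qed.

(** The scaling freedom in the characteristic polynomial is used up by fixing the trace. *)
Lemma charpoly_pglT (O : {set PGL2_type F}) d : d != 0 ->
  class_charpoly O ('X^2 + 'X + d%:P) -> O \subset pglT d.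
Proof.
move=> d0 Od; apply/subsetP => x Ox.
have : toGL (pglmx x) \in set_of_coset x.
  by rewrite set_of_cosetP toGLK ?unit_pglmx // pglmxK.
move/(Od x Ox); rewrite toGLK ?unit_pglmx //.
case/char_poly_simP => [|t0 dM]; first exact: unit_pglmx.
apply/imsetP; exists ((\tr (pglmx x))^-1 *: pglmx x).
  apply/trdetP; rewrite mxtraceZ detZ mulVf // dM mulrA -exprMn mulVf //.
  by rewrite expr1n mul1r.
by rewrite pgl_scale ?invr_eq0 ?unit_pglmx // pglmxK.
Qed.

Lemma class_with_charpolyP d (O : {set PGL2_type F}) : d != 0 -> 1 - 4 * d != 0 ->
  class_with_charpoly d O <-> O = pglT d.
Proof.
move=> d0 disc; split=> [[/imsetP[x _ ->] /(charpoly_pglT d0) sO]|->]; last first.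
  by split; [apply: pglT_class | apply: pglT_charpoly].
apply/eqP; rewrite eqEsubset sO /=; apply/subsetP => y Ty.
have xO : x \in (x ^: PGL2 F)%g.
  by apply/imsetP; exists 1%g; rewrite ?conjg1 // PGL2_setT inE.
have /imsetP[z _ Tz] := pglT_class d0 disc.
have := subsetP sO x xO; rewrite Tz in Ty *; move: Ty.
rewrite PGL2_setT => /imsetP[g _ ->] /imsetP[h _ ->].
by apply/imsetP; exists (h^-1 * g)%g; rewrite ?inE // conjgM conjgK.
Qed.

Lemma charpoly_pglT_eq d e : d != 0 -> e != 0 ->
  class_charpoly (pglT d) ('X^2 + 'X + e%:P) -> e = d.
Proof.
move=> d0 e0 /(charpoly_pglT e0) /subsetP sde.
have /set0Pn[x Tx] := pglT_neq0 d; move: (sde x Tx); case/imsetP: Tx => N TN ->.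
case/imsetP => M TM /eqP/pgl_eq-/(_ (trdet_unit d0 TN) (trdet_unit e0 TM))[k k0].
have [tN dN] := trdetP _ _ TN; have [tM dM] := trdetP _ _ TM.
move=> e'; move: tN dN; rewrite e' mxtraceZ tM mulr1 => ->.
by rewrite scale1r dM.
Qed.

End CharPoly.

(** * Symbolic multiplication tables *)

Definition qscal := (int * int)%type.
Definition qelt := (qscal * qscal * qscal * qscal)%type.

(** Products in the algebra generated by two matrices are computed once and for all, with
    coefficients a + b t in Z[t] / (t^2 - t - f): an element is c0 + c1 A + c2 B + c3 AB, where
    A^2 = uA - v, B^2 = uB - v and AB + BA = uA + uB + w. *)
Section Symbolic.
Variables (f : int) (u v w : qscal).
Local Open Scope ring_scope.

Definition qadd (x y : qscal) : qscal := (x.1 + y.1, x.2 + y.2).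
Definition qopp (x : qscal) : qscal := (- x.1, - x.2).
Definition qmul (x y : qscal) : qscal :=
  (x.1 * y.1 + f * (x.2 * y.2), x.1 * y.2 + x.2 * y.1 + x.2 * y.2).

Definition qeadd (a b : qelt) : qelt :=
  let: (a0, a1, a2, a3) := a in let: (b0, b1, b2, b3) := b in
  (qadd a0 b0, qadd a1 b1, qadd a2 b2, qadd a3 b3).
Definition qescale (s : qscal) (b : qelt) : qelt :=
  let: (b0, b1, b2, b3) := b in (qmul s b0, qmul s b1, qmul s b2, qmul s b3).

(** Left multiplication by A in the basis 1, A, B, AB; the next definition is that by B. *)
Definition qemulA (b : qelt) : qelt :=
  let: (b0, b1, b2, b3) := b in
  (qopp (qmul v b1), qadd b0 (qmul u b1), qopp (qmul v b3), qadd b2 (qmul u b3)).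
Definition qemulB (b : qelt) : qelt :=
  let: (b0, b1, b2, b3) := b in
  (qadd (qadd (qmul w b1) (qopp (qmul v b2))) (qopp (qmul (qmul u v) b3)),
   qadd (qmul u b1) (qmul v b3),
   qadd (qadd (qadd b0 (qmul u b1)) (qmul u b2)) (qmul (qadd (qmul u u) w) b3),
   qopp b1).
Definition qemul (a b : qelt) : qelt :=
  let: (a0, a1, a2, a3) := a in
  qeadd (qeadd (qescale a0 b) (qescale a1 (qemulA b)))
        (qeadd (qescale a2 (qemulB b)) (qescale a3 (qemulA (qemulB b)))).
Definition qetr (a : qelt) : qscal :=
  let: (a0, a1, a2, a3) := a in
  qadd (qadd a0 a0) (qadd (qmul u (qadd a1 a2)) (qmul (qadd (qmul u u) w) a3)).

Section Eval.
Variables (F : comNzRingType) (t : F) (A B : 'M[F]_2).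

Definition qev (x : qscal) : F := x.1%:~R + x.2%:~R * t.
Definition qeev (a : qelt) : 'M[F]_2 :=
  let: (a0, a1, a2, a3) := a in
  (qev a0)%:M + qev a1 *: A + qev a2 *: B + qev a3 *: (A *m B).

Hypothesis tt : t ^+ 2 = t + f%:~R.
Hypothesis AA : A *m A = qev u *: A - (qev v)%:M.
Hypothesis BB : B *m B = qev u *: B - (qev v)%:M.
Hypothesis BA : B *m A = qev u *: A + qev u *: B + (qev w)%:M - A *m B.

Lemma qevD x y : qev (qadd x y) = qev x + qev y.
Proof. by rewrite /qev !rmorphD /=; ring. Qed.
Lemma qevN x : qev (qopp x) = - qev x.
Proof. by rewrite /qev !rmorphN /=; ring. Qed.
Lemma qevM x y : qev (qmul x y) = qev x * qev y.
Proof.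
rewrite /qev !rmorphD /= !rmorphM /=.
transitivity (x.1%:~R * y.1%:~R + (x.1%:~R * y.2%:~R + x.2%:~R * y.1%:~R) * t
  + x.2%:~R * y.2%:~R * t ^+ 2); [rewrite tt; ring | ring].
Qed.

Lemma qeevD a b : qeev (qeadd a b) = qeev a + qeev b.
Proof.
case: a b => [[[a0 a1] a2] a3] [[[b0 b1] b2] b3] /=; rewrite !qevD raddfD /= !scalerDl.
by rewrite [RHS]addrACA [X in _ = X + _]addrACA [X in _ = X + _ + _]addrACA.
Qed.

Lemma qeevZ s b : qeev (qescale s b) = qev s *: qeev b.
Proof.
case: b => [[[b0 b1] b2] b3] /=.
by rewrite !qevM !scalerDr !scalerA scale_scalar_mx.
Qed.

Let L := (qevD, qevN, qevM).

Lemma qeevA b : qeev (qemulA b) = A *m qeev b.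
Proof.
case: b => [[[b0 b1] b2] b3] /=; rewrite !mulmxDr -!scalemxAr scalar_mxC mul_scalar_mx.
rewrite [A *m (A *m B)]mulmxA AA mulmxBl mul_scalar_mx -scalemxAl !L.
set C := A *m B.
have [a [b [c [e ->]]]] := mx2P A; have [a' [b' [c' [e' ->]]]] := mx2P B.
have [a2 [b2' [c2 [e2 ->]]]] := mx2P C.
by rewrite !mx2E; congr mx2; ring.
Qed.

Lemma qeevB b : qeev (qemulB b) = B *m qeev b.
Proof.
have BAB : B *m (A *m B) = (- (qev u * qev v))%:M + qev v *: A + (qev u * qev u + qev w) *: B.
  rewrite mulmxA BA !mulmxDl mulNmx -!scalemxAl -mulmxA BB mulmxBr -scalemxAr scalar_mxC.
  rewrite !mul_scalar_mx; set C := A *m B.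
  have [a [b' [c [e ->]]]] := mx2P A; have [a' [b'' [c' [e' ->]]]] := mx2P B.
  have [a2 [b2' [c2 [e2 ->]]]] := mx2P C.
  by rewrite !mx2E; congr mx2; ring.
case: b => [[[b0 b1] b2] b3] /=; rewrite !mulmxDr -!scalemxAr scalar_mxC mul_scalar_mx.
rewrite BAB BA BB !L; set C := A *m B.
have [a [b [c [e ->]]]] := mx2P A; have [a' [b' [c' [e' ->]]]] := mx2P B.
have [a2 [b2' [c2 [e2 ->]]]] := mx2P C.
by rewrite !mx2E; congr mx2; ring.
Qed.

Lemma qeevM a b : qeev (qemul a b) = qeev a *m qeev b.
Proof.
case: a => [[[a0 a1] a2] a3] /=; rewrite !qeevD !qeevZ !(qeevA, qeevB).
by rewrite !mulmxDl mul_scalar_mx -!scalemxAl !mulmxA addrA.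
Qed.

Hypotheses (trA : \tr A = qev u) (trB : \tr B = qev u).
Hypothesis trAB : \tr (A *m B) = qev u * qev u + qev w.

Lemma qeev_tr a : \tr (qeev a) = qev (qetr a).
Proof.
case: a => [[[a0 a1] a2] a3] /=.
by rewrite !mxtraceD !mxtraceZ mxtrace_scalar trA trB trAB !L; ring.
Qed.

End Eval.
End Symbolic.

(** * Permutation models of a conjugation table *)

Section PermTable.
Variables (n m : nat).
Variables (tb pl : seq (seq nat)).

(** Entry (i, j) of [tb] is the index of the conjugate of element j by element i, and row i
    of [pl] lists the values of the i-th permutation. *)
Definition tbl (i j : nat) := nth 0 (nth [::] tb i) j.
Definition plv (i x : nat) := nth 0 (nth [::] pl i) x.

Definition tblo (i j : 'I_m.+1) : 'I_m.+1 := inord (tbl i j).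
Definition plo (i : 'I_m.+1) (x : 'I_n.+1) : 'I_n.+1 := inord (plv i x).

Definition perm_table_ok :=
  [&& all (fun i => all (fun j => tbl i j < m.+1) (iota 0 m.+1)) (iota 0 m.+1),
      all (fun i => all (fun x => plv i x < n.+1) (iota 0 n.+1)) (iota 0 m.+1),
      all (fun i => uniq [seq plv i x | x <- iota 0 n.+1]) (iota 0 m.+1),
      all (fun i => all (fun j => (i == j) ||
         has (fun x => plv i x != plv j x) (iota 0 n.+1)) (iota 0 m.+1)) (iota 0 m.+1)
    & all (fun i => all (fun j => all (fun x =>
         plv j (plv i x) == plv i (plv (tbl i j) x)) (iota 0 n.+1))
         (iota 0 m.+1)) (iota 0 m.+1)].

(** In the two tables used below, three successive conjugations lead from any element to
    any other. *)
Definition table_conn := all (fun i => all (fun j =>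
    has (fun k => has (fun l => has (fun h => tbl k (tbl l (tbl h i)) == j)
      (iota 0 m.+1)) (iota 0 m.+1)) (iota 0 m.+1))
  (iota 0 m.+1)) (iota 0 m.+1).

(** Every element past the first two is a conjugate of an earlier one by an earlier one:
    the first two generate the rack. *)
Definition table_gen := all (fun i => (i < 2) ||
    has (fun j => has (fun k => tbl j k == i) (iota 0 i)) (iota 0 i)) (iota 0 m.+1).

Definition pl0 := all (fun x => plv 0 x == x.+1 %% n.+1) (iota 0 n.+1).

Hypothesis ok : perm_table_ok.

Lemma all_iotaP k (P : pred nat) : reflect (forall i : 'I_k, P i) (all P (iota 0 k)).
Proof.
apply: (iffP allP) => [H i|H i]; first by apply: H; rewrite mem_iota add0n ltn_ord.
by rewrite mem_iota add0n => /andP[_ lt]; apply: (H (Ordinal lt)).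
Qed.

Lemma tbl_lt (i j : 'I_m.+1) : tbl i j < m.+1.
Proof. by case/and5P: ok => /all_iotaP/(_ i)/all_iotaP/(_ j). Qed.

Lemma tbloE (i j : 'I_m.+1) : tblo i j = tbl i j :> nat.
Proof. by rewrite inordK ?tbl_lt. Qed.

Lemma ploE (i : 'I_m.+1) (x : 'I_n.+1) : plo i x = plv i x :> nat.
Proof. by rewrite inordK //; case/and5P: ok => _ /all_iotaP/(_ i)/all_iotaP/(_ x). Qed.

Lemma plo_inj i : injective (plo i).
Proof.
move=> x y /(congr1 val); rewrite /= !ploE => e.
have /and5P[_ _ /all_iotaP/(_ i) un _ _] := ok.
have sz : size [seq plv i x | x <- iota 0 n.+1] = n.+1 by rewrite size_map size_iota.
apply/val_inj/eqP; rewrite /= -(nth_uniq 0 _ _ un) ?sz //.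
by rewrite !(nth_map 0) ?size_iota // !nth_iota // !add0n e.
Qed.

Definition ptab i : 'S_n.+1 := perm (@plo_inj i).

Lemma ptabE i x : ptab i x = plv i x :> nat.
Proof. by rewrite permE ploE. Qed.

Lemma ptab_inj : injective ptab.
Proof.
move=> i j e; have /and5P[_ _ _ /all_iotaP/(_ i)/all_iotaP/(_ j) + _] := ok.
case/orP => [/eqP/val_inj //|/hasP[x]]; rewrite mem_iota add0n => /andP[_ lx] /eqP[].
by rewrite -(ptabE i (Ordinal lx)) e ptabE.
Qed.

Lemma ptab_conj i j : conj_op (ptab i) (ptab j) = ptab (tblo i j).
Proof.
rewrite /conj_op; apply: (canLR (mulgK _)); apply/permP => x; apply/val_inj.
rewrite /= !permM !ptabE tbloE.
by have /and5P[_ _ _ _ /all_iotaP/(_ i)/all_iotaP/(_ j)/all_iotaP/(_ x)/eqP] := ok.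
Qed.

Hypotheses (conn : table_conn) (p0 : pl0).

Lemma ptab0 : ptab ord0 = long_cycle n.+1.
Proof.
apply/permP => x; apply/val_inj; rewrite /= ptabE permE /=.
by have /all_iotaP/(_ x)/eqP := p0.
Qed.

Lemma tblo_conn i j : exists k l h, tblo k (tblo l (tblo h i)) = j.
Proof.
have /all_iotaP/(_ i)/all_iotaP/(_ j)/hasP[k] := conn.
rewrite mem_iota => /andP[_ lk] /hasP[l]; rewrite mem_iota => /andP[_ ll].
case/hasP=> h; rewrite mem_iota => /andP[_ lh] /eqP e.
exists (Ordinal lk), (Ordinal ll), (Ordinal lh); apply/val_inj.
by rewrite /= tbloE /= tbloE /= tbloE /=; exact: e.
Qed.

Lemma long_cycleX k (x : 'I_n.+1) : (long_cycle n.+1 ^+ k)%g x = (x + k) %% n.+1 :> nat.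
Proof.
elim: k => [|k IHk]; first by rewrite expg0 perm1 addn0 modn_small.
by rewrite expgSr permM permE /= IHk addnS -[X in X %% _]addn1 modnDml addn1.
Qed.

Lemma order_long_cycle : n.+1 %| #[long_cycle n.+1]%g.
Proof.
have := long_cycleX #[long_cycle n.+1]%g ord0; rewrite expg_order perm1 add0n /=.
by move/esym/eqP.
Qed.

Variable G : {group 'S_n.+1}.
Hypotheses (sG : forall i, ptab i \in G) (cG : #|G| = m.+1 * n.+1).

(** The permutations lie in one class because any two are linked by conjugations. They fill
    it because the cycle has order n + 1, which bounds its class by #|G| / (n + 1). *)
Lemma ptab_class : [set ptab i | i in setT] = (long_cycle n.+1 ^: G)%g.
Proof.
apply/eqP; rewrite eqEcard; apply/andP; split.
  apply/subsetP => _ /imsetP[j _ ->].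
  have [k [l [h <-]]] := tblo_conn ord0 j; rewrite -!ptab_conj ptab0.
  apply/imsetP; exists (ptab k * ptab l * ptab h)^-1%g; first by rewrite groupV !groupM ?sG.
  by rewrite /conj_op conjgE invgK !invMg !mulgA.
rewrite card_imset ?cardsT ?card_ord; last exact: ptab_inj.
rewrite -(leq_pmul2r (isT : 0 < n.+1)) -cG.
have <- := Lagrange (subcent1_sub (long_cycle n.+1) G).
rewrite mulnC -index_cent1 leq_mul2r orbC.
have sC : (<[long_cycle n.+1]> \subset 'C_G[long_cycle n.+1])%g.
  by rewrite cycle_subG inE -ptab0 sG cent1id.
by rewrite (leq_trans _ (subset_leq_card sC)) // dvdn_leq ?order_long_cycle ?order_gt0.
Qed.

End PermTable.

(** * The octahedral and icosahedral racks of matrices *)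

(** Besides the model in a symmetric group: Y is generated by x and y, and it is the only
    nonempty subset of itself that is stable under conjugation by Y. These are the facts by
    which other racks are identified with Y. *)
Definition table_rack (gT : finGroupType) n (G : {set 'S_n}) (m : nat) (x y : gT)
    (Y : {set gT}) : Prop :=
  [/\ rack_isom Y (long_cycle n ^: G)%g, {in Y &, forall x y, conj_op x y \in Y}, #|Y| = m,
      forall X : {set gT}, {in X &, forall x y, conj_op x y \in X} ->
        x \in X -> y \in X -> Y \subset X
    & forall X : {set gT}, X != set0 -> X \subset Y ->
        {in Y & X, forall y x, conj_op y x \in X} -> X = Y].

Section MatrixTable.
Variables (n m : nat) (tb pl : seq (seq nat)).
Variables (f : int) (u v w : qscal) (els : seq qelt) (vals : seq qscal) (s : qscal).
Local Open Scope ring_scope.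

Let tbe := tbl tb.
Definition elv i : qelt := nth ((0, 0), (0, 0), (0, 0), (0, 0)) els i.

Definition qeadj (a : qelt) : qelt :=
  let: (a0, a1, a2, a3) := a in (qadd u (qopp a0), qopp a1, qopp a2, qopp a3).

(** The elements are told apart by traces: tr (Mi Mj) belongs to [vals] for i and j
    distinct, and tr (Mi Mi) is [s]. *)
Definition mat_table_ok :=
  [&& all (fun i => all (fun j => qemul f u v w (elv i) (elv j) ==
        qemul f u v w (elv (tbe i j)) (elv i)) (iota 0 m.+1)) (iota 0 m.+1),
      all (fun i => qemul f u v w (elv i) (qeadj (elv i)) == (v, (0,0), (0,0), (0,0)))
        (iota 0 m.+1),
      all (fun i => qetr f u w (elv i) == u) (iota 0 m.+1),
      all (fun i => all (fun j =>
        (i == j) || (qetr f u w (qemul f u v w (elv i) (elv j)) \in vals))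
         (iota 0 m.+1)) (iota 0 m.+1)
    & all (fun i => qetr f u w (qemul f u v w (elv i) (elv i)) == s) (iota 0 m.+1)].

Hypothesis pok : perm_table_ok n m tb pl.
Hypotheses (conn : table_conn m tb) (p0 : pl0 n pl) (gen : table_gen m tb).
Hypothesis mok : mat_table_ok.
Hypothesis el0 : elv 0 = ((0, 0), (1, 0), (0, 0), (0, 0)).
Hypothesis el1 : elv 1 = ((0, 0), (0, 0), (1, 0), (0, 0)).

Variables (F : finFieldType) (t : F) (A B : 'M[F]_2).
Let qv := qev t.
Hypothesis tt : t ^+ 2 = t + f%:~R.
Hypotheses (trA : \tr A = qv u) (trB : \tr B = qv u).
Hypotheses (dA : \det A = qv v) (dB : \det B = qv v).
Hypothesis trAB : \tr (A *m B) = qv u * qv u + qv w.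
Hypotheses (u0 : qv u != 0) (v0 : qv v != 0).
Hypothesis valsP : forall x, x \in vals -> qv x != qv s.

Let AA : A *m A = qv u *: A - (qv v)%:M.
Proof. by rewrite mx2_CH trA dA. Qed.
Let BB : B *m B = qv u *: B - (qv v)%:M.
Proof. by rewrite mx2_CH trB dB. Qed.
Let BA : B *m A = qv u *: A + qv u *: B + (qv w)%:M - A *m B.
Proof.
by rewrite mx2_mulC trA trB trAB; congr (_ + _%:M - _); [exact: addrC | ring].
Qed.

Let qev0 : qev t (0, 0) = 0. Proof. by rewrite /qev /= mul0r addr0. Qed.

Let M (i : 'I_m.+1) := qeev t A B (elv i).

Let trM i : \tr (M i) = qv u.
Proof.
rewrite /M (qeev_tr tt trA trB trAB).
by have /and5P[_ _ /all_iotaP/(_ i)/eqP-> _ _] := mok.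
Qed.

Let qeev_adj a : qeev t A B (qeadj a) = (qv u)%:M - qeev t A B a.
Proof.
case: a => [[[a0 a1] a2] a3] /=; rewrite qevD !qevN raddfD raddfN /= !scaleNr.
by rewrite !opprD !addrA.
Qed.

Let detM i : \det (M i) = qv v.
Proof.
have /and5P[_ /all_iotaP/(_ i)/eqP + _ _ _] := mok.
move/(congr1 (qeev t A B)); rewrite (qeevM tt AA BB BA) qeev_adj -/(M i).
rewrite mulmxBr scalar_mxC mul_scalar_mx mx2_CH trM opprB addrC subrK /=.
rewrite !qev0 !scale0r !addr0 => /matrixP/(_ 0 0).
by rewrite !mxE.
Qed.

Let uM i : M i \in unitmx. Proof. by rewrite unitmxE unitfE detM. Qed.

Let a i := pgl (M i).

Let a_inj : injective a.
Proof.
move=> i j /eqP/pgl_eq-/(_ (uM i) (uM j))[k k0 e].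
have k1 : k = 1.
  apply: (mulIf u0); rewrite mul1r -[in RHS](trM i) e mxtraceZ trM //.
rewrite k1 scale1r in e; apply/val_inj/eqP.
have /and5P[_ _ _ /all_iotaP/(_ i)/all_iotaP/(_ j)/orP[//|vij] /all_iotaP/(_ i)/eqP si] := mok.
have := valsP vij; rewrite -si /qv -!(qeev_tr tt trA trB trAB) !(qeevM tt AA BB BA).
by rewrite -/(M i) -/(M j) e eqxx.
Qed.

Let a_conj i j : conj_op (a i) (a j) = a (tblo tb i j).
Proof.
rewrite /conj_op; apply: (canLR (mulgK _)); rewrite -!pglM //; congr pgl.
rewrite /M -!(qeevM tt AA BB BA) (tbloE pok).
by have /and5P[/all_iotaP/(_ i)/all_iotaP/(_ j)/eqP-> _ _ _ _] := mok.
Qed.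

Lemma mat_table_sub : [set a i | i in setT] \subset pglT (qv v / qv u ^+ 2).
Proof.
apply/subsetP => _ /imsetP[i _ ->]; apply/imsetP; exists ((qv u)^-1 *: M i).
  apply/trdetP; rewrite mxtraceZ detZ trM detM mulVf // exprVn mulrC.
  by split.
by rewrite pgl_scale ?invr_eq0.
Qed.

Lemma mat_table_rack (G : {group 'S_n.+1}) : (forall i, ptab pok i \in G) ->
  #|G| = (m.+1 * n.+1)%N -> (1 < m)%N ->
  table_rack G m.+1 (pgl A) (pgl B) [set a i | i in setT].
Proof.
move=> sG cG m1; have pc := ptab_conj pok; split.
- rewrite -(ptab_class conn p0 sG cG).
  exact: (rack_isom_table a_inj (@ptab_inj _ _ _ _ pok) a_conj pc).
- by move=> _ _ /imsetP[i _ ->] /imsetP[j _ ->]; rewrite a_conj imset_f.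
- by rewrite card_imset // cardsT card_ord.
- move=> X Xc XA XB; apply/subsetP => _ /imsetP[[i li] _ ->].
  elim/ltn_ind: i li => i IH li.
  have a0 : qv ((0 : int), (0 : int)) = 0 by rewrite /qv /qev /= mul0r addr0.
  have a1 : qv ((1 : int), (0 : int)) = 1 by rewrite /qv /qev /= mul0r addr0.
  case: i li IH => [|[|i]] li IH.
  - rewrite /a /M /= el0 /qeev -/qv !a0 !a1 !scale0r scale1r !addr0.
    by rewrite raddf0 add0r.
  - rewrite /a /M /= el1 /qeev -/qv !a0 !a1 !scale0r scale1r !addr0.
    by rewrite raddf0 add0r.
  have := gen; move=> /all_iotaP/(_ (Ordinal li))/orP[//|/hasP[j]]; rewrite mem_iota add0n.
  move=> /andP[_ lj] /hasP[k]; rewrite mem_iota add0n => /andP[_ lk] /eqP e.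
  have lj' := ltn_trans lj li; have lk' := ltn_trans lk li.
  rewrite (_ : Ordinal li = tblo tb (Ordinal lj') (Ordinal lk')).
    by rewrite -a_conj; apply: Xc; apply: IH.
  by apply: ord_inj; rewrite (tbloE pok) /= e.
move=> X /set0Pn[x Xx] sXY XY; apply/eqP; rewrite eqEsubset sXY.
apply/subsetP => _ /imsetP[j _ ->].
have /imsetP[i _ xi] := subsetP sXY x Xx; rewrite xi in Xx.
have [k [l [h <-]]] := tblo_conn pok conn i j.
by rewrite -!a_conj; do 3!(apply: (XY); first exact: imset_f).
Qed.

End MatrixTable.

(** The twelve elements of (1 2 3 4 5)^Alt(5): conjugation table, permutations, and
    coordinates on 1, A, B, AB with coefficients in Z[t], t^2 = t + 1. *)
Definition tb5 : seq (seq nat) :=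
[:: [:: 0; 2; 3; 4; 5; 1; 7; 8; 9; 10; 6; 11]; [:: 5; 1; 0; 4; 6; 7; 11; 8; 2; 3; 10; 9];
 [:: 1; 8; 2; 0; 5; 7; 6; 11; 9; 3; 4; 10]; [:: 2; 8; 9; 3; 0; 1; 5; 7; 11; 10; 4; 6];
 [:: 3; 2; 9; 10; 4; 0; 5; 1; 8; 11; 6; 7]; [:: 4; 0; 3; 10; 6; 5; 7; 1; 2; 9; 11; 8];
 [:: 3; 0; 2; 9; 10; 4; 6; 5; 1; 8; 11; 7]; [:: 4; 5; 0; 3; 10; 6; 11; 7; 1; 2; 9; 8];
 [:: 5; 7; 1; 0; 4; 6; 10; 11; 8; 2; 3; 9]; [:: 1; 7; 8; 2; 0; 5; 4; 6; 11; 9; 3; 10];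
 [:: 2; 1; 8; 9; 3; 0; 4; 5; 7; 11; 10; 6]; [:: 0; 5; 1; 2; 3; 4; 10; 6; 7; 8; 9; 11]]%N.
Definition pl5 : seq (seq nat) :=
[:: [:: 1; 2; 3; 4; 0]; [:: 2; 0; 4; 1; 3]; [:: 4; 3; 0; 2; 1]; [:: 2; 4; 1; 0; 3];
 [:: 3; 0; 4; 2; 1]; [:: 4; 3; 1; 0; 2]; [:: 2; 4; 3; 1; 0]; [:: 3; 2; 0; 4; 1];
 [:: 1; 4; 3; 0; 2]; [:: 3; 2; 4; 1; 0]; [:: 1; 3; 0; 4; 2]; [:: 4; 0; 1; 2; 3]]%N.
Definition els5 : seq qelt := ([::
 ((0, 0), (1, 0), (0, 0), (0, 0)); ((0, 0), (0, 0), (1, 0), (0, 0));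
 ((1, 0), (-1, 0), (-1, 0), (2, -1)); ((1, 0), (0, 0), (-1, 1), (1, -1));
 ((0, 0), (1, -1), (0, 0), (-1, 1)); ((0, 1), (1, -1), (1, -1), (-2, 1));
 ((0, 0), (1, 0), (1, 0), (-2, 1)); ((0, 0), (0, 0), (1, -1), (-1, 1));
 ((1, 0), (-1, 1), (0, 0), (1, -1)); ((1, -1), (-1, 1), (-1, 1), (2, -1));
 ((1, 0), (0, 0), (-1, 0), (0, 0)); ((1, 0), (-1, 0), (0, 0), (0, 0))])%R.
(** The six elements of (1 2 3 4)^Sym(4) in the same format. The coefficients are integers
    because the matrices are doubled: A and B have trace 2 and determinant 2. *)
Definition tb4 : seq (seq nat) :=
 [:: [:: 0; 2; 3; 4; 1; 5]; [:: 4; 1; 0; 3; 5; 2]; [:: 1; 5; 2; 0; 4; 3];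
  [:: 2; 1; 5; 3; 0; 4]; [:: 3; 0; 2; 5; 4; 1]; [:: 0; 4; 1; 2; 3; 5]]%N.
Definition pl4 : seq (seq nat) :=
 [:: [:: 1; 2; 3; 0]; [:: 1; 3; 0; 2]; [:: 2; 3; 1; 0]; [:: 2; 0; 3; 1];
  [:: 3; 2; 0; 1]; [:: 3; 0; 1; 2]]%N.
Definition els4 : seq qelt := ([::
 ((0, 0), (1, 0), (0, 0), (0, 0)); ((0, 0), (0, 0), (1, 0), (0, 0));
 ((2, 0), (-1, 0), (-1, 0), (1, 0)); ((2, 0), (0, 0), (-1, 0), (0, 0));
 ((0, 0), (1, 0), (1, 0), (-1, 0)); ((2, 0), (-1, 0), (0, 0), (0, 0))])%R.

Lemma pok5 : perm_table_ok 4 11 tb5 pl5. Proof. by vm_compute. Qed.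
Lemma pok4 : perm_table_ok 3 5 tb4 pl4. Proof. by vm_compute. Qed.

Lemma conn5 : table_conn 11 tb5. Proof. by vm_compute. Qed.
Lemma conn4 : table_conn 5 tb4. Proof. by vm_compute. Qed.
Lemma gen5 : table_gen 11 tb5. Proof. by vm_compute. Qed.
Lemma gen4 : table_gen 5 tb4. Proof. by vm_compute. Qed.
Lemma pl05 : pl0 4 pl5. Proof. by vm_compute. Qed.
Lemma pl04 : pl0 3 pl4. Proof. by vm_compute. Qed.

Lemma mok5 : mat_table_ok 11 tb5 1 (1, 0)%R (1, 1)%R (0, 1)%R els5
  [:: (1, 1); (0, -1); (2, 2)]%R (-1, -2)%R.
Proof. by vm_compute. Qed.
Lemma mok4 : mat_table_ok 5 tb4 0 (2, 0)%R (2, 0)%R (-2, 0)%R els4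
  [:: (4, 0); (2, 0)]%R (0, 0)%R.
Proof. by vm_compute. Qed.

Section Instances.
Variable F : finFieldType.
Local Open Scope ring_scope.
Implicit Types (N : 'M[F]_2) (d : F).

(** For this value of tr (N1 N2) the words in N1 and N2 close up after twelve elements, in
    every characteristic; the discriminant condition keeps the twelve distinct. *)
Lemma trdet_table_Alt5 d (t : F) N1 N2 : d != 0 -> 1 - 4 * d != 0 ->
  t ^+ 2 = t + 1 -> d = t ^+ 2 ->
  N1 \in trdet d -> N2 \in trdet d -> \tr (N1 *m N2) = d ->
  exists Y : {set PGL2_type F}, Y \subset pglT d /\ table_rack ('Alt_('I_5))%g 12 (pgl N1) (pgl N2) Y.
Proof.
move=> d0 disc t2 dt TN1 TN2 trN.
have [tN1 dN1] := trdetP _ _ TN1; have [tN2 dN2] := trdetP _ _ TN2.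
have q1 : qev t ((1 : int), (0 : int)) = 1 by rewrite /qev /= mul0r addr0.
have qd : qev t ((1 : int), (1 : int)) = d by rewrite /qev /= mul1r dt t2 addrC.
have qw : 1 * 1 + qev t ((0 : int), (1 : int)) = d by rewrite /qev /= mul1r dt t2; ring.
have vP x : x \in [:: ((1 : int), (1 : int)); (0, -1); (2, 2)] -> qev t x != qev t (-1, -2).
  have e (z : F) : z ^+ 2 = z + 1 -> (z * (1 - z) = -1).
    by move=> h; rewrite mulrBr mulr1 -expr2 h; ring.
  rewrite !inE => /or3P[]/eqP-> ; rewrite /qev /= -subr_eq0.
  - apply/eqP => h; have : (1 : F) = 0; last by apply/eqP/oner_neq0.
    have h' : 3 * t + 2 = 0 by rewrite -h; ring.
    transitivity ((3 * t + 2) * (5 - 3 * t) - 9 * (1 + t - t ^+ 2)); first by ring.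
    by rewrite h' t2; ring.
  - apply/eqP => h; have : (1 : F) = 0; last by apply/eqP/oner_neq0.
    have h' : t + 1 = 0 by rewrite -h; ring.
    transitivity ((t + 1) * (2 - t) - (1 + t - t ^+ 2)); first by ring.
    by rewrite h' t2; ring.
  apply: contraNneq disc => h; rewrite dt t2 -oppr_eq0 -h; apply/eqP; ring.
have main := @mat_table_rack 4 11 tb5 pl5 1 (1, 0) (1, 1) (0, 1) els5 _ (-1, -2) pok5
  conn5 pl05 gen5 mok5 erefl erefl F t N1 N2 t2.
rewrite !q1 qd qw in main.
have sub := @mat_table_sub 11 tb5 1 (1, 0) (1, 1) (0, 1) els5 _ (-1, -2)
  mok5 F t N1 N2 t2.
rewrite !q1 qd qw expr1n divr1 in sub.
eexists; split; first by apply: sub => //; exact: oner_neq0.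
apply: main => //; first exact: oner_neq0.
- move=> i; rewrite Alt_even.
  have od (x y : {perm 'I_5}) : odd_perm (conj_op x y) = odd_perm y.
    by rewrite /conj_op !odd_permM odd_permV addbAC addbb addFb.
  have [k [l [h <-]]] := @tblo_conn 4 11 tb5 pl5 pok5 conn5 ord0 i.
  rewrite -!ptab_conj !od (ptab0 pok5 pl05).
  have : (long_cycle 5 ^+ 5)%g = 1%g.
    by apply/permP => x; apply/val_inj; rewrite /= long_cycleX perm1 modnDr modn_small.
  move/(congr1 (@odd_perm _)); rewrite odd_perm1 !expgS expg0 !odd_permM odd_perm1.
  by case: (odd_perm _).
by apply/eqP; rewrite -(eqn_pmul2l (isT : 0 < 2)%N) card_Alt ?card_ord.
Qed.

Lemma trdet_table_Sym4 d N1 N2 : d != 0 -> 2 * d = 1 ->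
  N1 \in trdet d -> N2 \in trdet d -> \tr (N1 *m N2) = d ->
  exists Y : {set PGL2_type F}, Y \subset pglT d /\ table_rack ('Sym_('I_4))%g 6 (pgl N1) (pgl N2) Y.
Proof.
move=> d0 dd TN1 TN2 trN.
have [tN1 dN1] := trdetP _ _ TN1; have [tN2 dN2] := trdetP _ _ TN2.
have two0 : (2 : F) != 0.
  by apply/eqP => h; move/eqP: dd; rewrite h mul0r eq_sym oner_eq0.
have q (z : int) : qev (1 : F) (z, (0 : int)) = z%:~R by rewrite /qev /= mul0r addr0.
have vP x : x \in [:: ((4 : int), (0 : int)); (2, 0)] -> qev (1 : F) x != 0%:~R.
  rewrite !inE => /orP[]/eqP->; rewrite !q //.
  by rewrite (_ : 4%:~R = 2 * 2 :> F) ?mulf_neq0 //; ring.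
have main := @mat_table_rack 3 5 tb4 pl4 0 (2, 0) (2, 0) (-2, 0) els4 _ (0, 0) pok4
  conn4 pl04 gen4 mok4 erefl erefl F 1 (2 *: N1) (2 *: N2).
have sub := @mat_table_sub 5 tb4 0 (2, 0) (2, 0) (-2, 0) els4 _ (0, 0)
  mok4 F 1 (2 *: N1) (2 *: N2).
rewrite !q in main sub.
have h1 : (1 : F) ^+ 2 = 1 + 0%:~R by rewrite expr1n addr0.
have t1 N : \tr N = 1 -> \tr (2 *: N) = 2 by move=> tN; rewrite mxtraceZ tN mulr1.
have det2 N : \det N = d -> \det (2 *: N) = 2.
  by move=> dN; rewrite detZ dN expr2 -mulrA dd mulr1.
have tr12 : \tr ((2 *: N1) *m (2 *: N2)) = 2 * 2 + (-2)%:~R.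
  rewrite -scalemxAl -scalemxAr !mxtraceZ trN dd mulr1.
  by rewrite (_ : (-2)%:~R = - 2 :> F) ?rmorphN //; ring.
have dE : 2 / 2 ^+ 2 = d :> F.
  by apply: (mulfI two0); rewrite dd mulrA -expr2 divff ?expf_neq0.
eexists; split.
  rewrite -[d]dE; apply: sub; auto; exact: two0.
rewrite -(pgl_scale two0 (trdet_unit d0 TN1)) -(pgl_scale two0 (trdet_unit d0 TN2)).
by apply: main; auto; rewrite ?card_Sym ?card_ord //; move=> i; rewrite inE.
Qed.

(** With the first matrix in companion form, the conditions on the second one amount to an
    equation for the norm form, up to a translation of the variables. *)
Lemma trdet_pair d : d != 0 -> 1 - 4 * d != 0 ->
  exists N1 N2, [/\ N1 \in trdet d, N2 \in trdet d & \tr (N1 *m N2) = d].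
Proof.
move=> d0 disc; pose k := (1 - 4 * d)^-1.
have kE : k * (1 - 4 * d) = 1 by rewrite mulVf.
clearbody k.
pose a0 := k * (1 - 3 * d); pose c0 := k * (2 * d - 1).
pose q a c := a ^+ 2 + a * c + d * c ^+ 2 - a + (d - 1) * c + d.
have qE r s x y : q (r + x) (s + y) = q r s + (x ^+ 2 + x * y + d * y ^+ 2)
     + x * (2 * r + s - 1) + y * (r + 2 * d * s + d - 1).
  by rewrite /q; ring.
have [x [y xy]] := norm_form_surj (- q a0 c0) disc.
pose a := a0 + x; pose c := c0 + y; pose b := d - 1 + a + d * c.
have qac : q a c = 0.
  have -> : q a c = q a0 c0 + (x ^+ 2 + x * y + d * y ^+ 2)
       + x * (2 * a0 + c0 - 1) + y * (a0 + 2 * d * c0 + d - 1).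
    exact: qE.
  have -> : 2 * a0 + c0 - 1 = 0.
    have h : 2 * a0 + c0 = k * (1 - 4 * d) by rewrite /a0 /c0; ring.
    by rewrite h kE subrr.
  have -> : a0 + 2 * d * c0 + d - 1 = 0.
    transitivity ((d - 1) * (1 - k * (1 - 4 * d))); first by rewrite /a0 /c0; ring.
    by rewrite kE subrr mulr0.
  by rewrite xy; ring.
exists (mx2 0 (- d) 1 1), (mx2 a b c (1 - a)); split.
- by apply/trdetP; rewrite !mx2E; split; ring.
- apply/trdetP; rewrite !mx2E; split; first by ring.
  by rewrite -[RHS]subr0 -qac /q /b; ring.
by rewrite !mx2E /b; ring.
Qed.

End Instances.

(** * Counting orbits of a group whose elements fix at most two points *)

Section Arith.

(** Two orbits, one of them with a unipotent radical of order q > 2: the orbit is a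
    projective line over a field with q elements, except for one group of order 60 when q = 3. *)
Lemma arith_modular (w q c w' n' m : nat) :
  2 < q -> 0 < m -> w = q * m + 1 -> c %| q.-1 -> 0 < c ->
  w * (q - 2) + 2 = w' -> w' * n' = w * (q * c) ->
  (w = q.+1 /\ q.-1 %| 2 * c) \/ [/\ q = 3, w = 10, c = 2 & n' = 5].
Proof.
move=> q3 m0 -> cq c0 <-.
have -> : (q * m + 1) * (q - 2) + 2 = q * (1 + m * (q - 2)) by nia.
set g := 1 + m * (q - 2) => e.
have e' : g * n' = (q * m + 1) * c by nia.
have c_le : c <= q.-1 by rewrite dvdn_leq //; lia.
have cop : coprime g m by rewrite /coprime gcdnC (_ : g = (q - 2) * m + 1) ?gcdnMDl ?gcdn1 // /g; lia.
have d2c : g %| 2 * c.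
  have : g %| g * c + m * (2 * c).
    have -> : g * c + m * (2 * c) = g * n' by rewrite e' /g; nia.
    exact: dvdn_mulr.
  by rewrite (dvdn_addr _ (dvdn_mulr c (dvdnn g))) (Gauss_dvdr _ cop).
have [m1|m1] := eqVneq m 1.
  left; split; first by nia.
  by rewrite (_ : q.-1 = g) // /g; lia.
right; have [m2|m2] := eqVneq m 2.
  have cop2 : coprime g 2 by rewrite /g m2 coprimen2; lia.
  have : g %| c by rewrite -(Gauss_dvdr _ cop2).
  by move/dvdn_leq => /(_ c0); rewrite /g m2; lia.
have := dvdn_leq _ d2c; rewrite muln_gt0 c0 => /(_ isT) gle.
have q3' : q = 3.
  have : 3 * (q - 2) <= m * (q - 2) by rewrite leq_mul2r; apply/orP; right; lia.
  by move: gle; rewrite /g; move: (m * (q - 2)) => mq; lia.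
rewrite q3' in q3 c_le cq e' d2c gle *; rewrite /g q3' in e' d2c gle.
have c2 : c = 2.
  have : c = 1 \/ c = 2 by lia.
  by case=> // c1; rewrite c1 in gle; lia.
have m3 : m = 3 by rewrite c2 in gle; lia.
by rewrite m3 c2 in e' *; split; lia.
Qed.

(** The solutions of 1/n1 + 1/n2 + 1/n3 > 1 with n1 > 3: dihedral, octahedral,
    icosahedral. *)
Lemma arith_three (h w1 w2 w3 n1 n2 n3 : nat) : 3 < n1 -> 1 < n2 -> 1 < n3 -> 0 < h ->
  w1 * n1 = h -> w2 * n2 = h -> w3 * n3 = h -> h + 2 = w1 + w2 + w3 ->
  w1 = 2 \/ [/\ (h = 24 /\ n1 = 4) \/ (h = 60 /\ n1 = 5), n2 <= 3 & n3 <= 3].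
Proof.
wlog n23 : n2 n3 w2 w3 / n2 <= n3.
  move=> W n1_4 n2_2 n3_2 h0 e1 e2 e3 e.
  case: (leqP n2 n3) => le; first by apply: (W n2 n3 w2 w3).
  have [|?|[? ? ?]] := W n3 n2 w3 w2 (ltnW le) n1_4 n3_2 n2_2 h0 e1 e3 e2; first by lia.
    by left.
  by right; split.
move=> n1_4 n2_2 n3_2 h0 e1 e2 e3 e.
have w1h : 4 * w1 <= h by nia.
have n2E : n2 = 2.
  case: (ltnP 2 n2) => [lt|]; last by lia.
  have : 3 * w2 <= h by nia. have : 3 * w3 <= h by nia. lia.
rewrite n2E in e2 *.
have n3_4 : n3 <= 3.
  case: (ltnP 3 n3) => // lt; have : 4 * w3 <= h by nia. lia.
have [n32|n32] := eqVneq n3 2; first by left; rewrite n32 in e3; lia.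
have n3E : n3 = 3 by lia.
rewrite n3E in e3 *; right; split => //.
have n1_6 : n1 < 6.
  case: (ltnP n1 6) => // le; have : 6 * w1 <= h by nia. lia.
have [n14|n14] := eqVneq n1 4; first by left; split => //; rewrite n14 in e1; lia.
have n15 : n1 = 5 by lia.
by right; split => //; rewrite n15 in e1; lia.
Qed.

Lemma arith_two w q w' : 0 < q -> q != 1 -> w' + w * q + 2 = 2 * w' + 2 * w ->
  w * (q - 2) + 2 = w'.
Proof. by case: q => [|[|q]] // _ _; rewrite subn2 /= !mulnS; move: (w * q); lia. Qed.

Lemma leq_mul_neq1 w q : 0 < q -> q != 1 -> 2 * w <= w * q.
Proof. by move=> q0 q1; rewrite mulnC leq_mul2l; apply/orP; right; lia. Qed.

(** Three orbits leave no room for a nontrivial unipotent radical. *)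
Lemma arith_q h a b d q1 q2 q3 : 2 * a <= h -> 2 * b <= h -> 2 * d <= h ->
  0 < q1 -> 0 < q2 -> 0 < q3 ->
  a * q1 + b * q2 + d * q3 + h + 2 = 2 * a + 2 * b + 2 * d -> q1 = 1.
Proof.
move=> ah bh dh q10 q20 q30 e; apply/eqP; apply: contraT => q11; exfalso.
have := leq_mul_neq1 a q10 q11; have := leq_pmulr b q20; have := leq_pmulr d q30.
by move: (a * q1) (b * q2) (d * q3) e; lia.
Qed.

End Arith.

Section Orbits.
Variables (gT : finGroupType) (T : finType) (to : {action gT &-> T}).
Local Open Scope group_scope.

Lemma dvdn_acts_sum (G : {group gT}) (S : {set T}) k :
  [acts G, on S | to] -> (forall z, z \in S -> #|orbit to G z| = k) -> (k %| #|S|)%N.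
Proof.
move=> GS Sk; rewrite -(acts_sum_card_orbit GS); apply: dvdn_sum => _ /imsetP[z Sz ->].
by rewrite Sk.
Qed.

End Orbits.

Section Count.
Variables (gT : finGroupType) (T : finType) (to : {action gT &-> T}) (H : {group gT}).
Variable (uni : pred gT).
Local Open Scope group_scope.

Notation stab z := ('C_H[z | to]).

(** In the application [uni] means unipotent up to a scalar, and this is the unipotent
    radical of the stabiliser of z. *)
Definition unirad z : {set gT} := [set g in stab z | uni g].

Hypothesis uni1 : uni 1.
Hypothesis uniJ : forall g x, uni (x ^ g) = uni x.
Hypothesis fix_card : forall g, g \in H -> g != 1 -> #|'Fix_to[g]| = if uni g then 1%N else 2.
Hypothesis Qgroup : forall z, group_set (unirad z).
Hypothesis Qab : forall z, abelian (unirad z).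

Let Qg z := Group (Qgroup z).
Let h := #|H|.
Let w z := #|orbit to H z|.
Let n z := #|stab z|.
Let q z := #|unirad z|.

Lemma stabP g z : reflect (g \in H /\ to z g = z) (g \in stab z).
Proof.
by rewrite inE; apply: (iffP andP) => -[Hg]; [move/astab1P | move=> e; split=> //; apply/astab1P].
Qed.

Lemma uniradP g z : reflect [/\ g \in H, to z g = z & uni g] (g \in unirad z).
Proof.
rewrite [_ \in unirad z]inE; apply: (iffP andP) => [[/stabP[? ?] ?]|[? ? ?]] //.
by split=> //; apply/stabP.
Qed.

Lemma act_eq g x z : to z g = z -> (to x g == z) = (x == z).
Proof. by move=> gz; apply/eqP/eqP => [|->//]; rewrite -{1}gz => /act_inj. Qed.

Lemma Fix1P g z : (z \in 'Fix_to[g]) = (to z g == z).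
Proof. by apply/afix1P/eqP. Qed.

Lemma fix_le2 g z1 z2 z3 : g \in H -> g != 1 -> to z1 g = z1 -> to z2 g = z2 ->
  to z3 g = z3 -> [|| z1 == z2, z1 == z3 | z2 == z3].
Proof.
move=> Hg g1 f1 f2 f3; apply: contraT; rewrite !negb_or => /and3P[d12 d13 d23].
have : (#|[set z1; z2; z3]| <= #|'Fix_to[g]|)%N.
  by apply/subset_leq_card/subsetP => z; rewrite Fix1P !inE -orbA => /or3P[]/eqP->; apply/eqP.
rewrite fix_card // -setUA cardsU1 !inE negb_or d12 d13 cards2 d23.
by case: ifP.
Qed.

Lemma uni_fix1 g z1 z2 : g \in H -> g != 1 -> uni g -> to z1 g = z1 -> to z2 g = z2 -> z1 = z2.
Proof.
move=> Hg g1 ug f1 f2; have /eqP/cards1P[z zE] : #|'Fix_to[g]| = 1%N by rewrite fix_card // ug.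
have := Fix1P g z1; have := Fix1P g z2; rewrite f1 f2 !eqxx zE !inE.
by move=> /eqP-> /eqP->.
Qed.

Lemma uni_fix2 g z : g \in H -> ~~ uni g -> to z g = z -> exists2 z', z' != z & to z' g = z'.
Proof.
move=> Hg ug f; have g1 : g != 1 by apply: contraNneq ug => ->.
have : #|'Fix_to[g] :\ z| = 1%N.
  have := cardsD1 z 'Fix_to[g]; rewrite fix_card // (negPf ug) Fix1P f eqxx.
  by rewrite add1n => -[].
move/eqP/cards1P => [z' E]; exists z'.
  by have := set11 z'; rewrite -E in_setD1 => /andP[].
by have := set11 z'; rewrite -E in_setD1 => /andP[_ /afix1P].
Qed.

Lemma unirad_sub z : unirad z \subset stab z.
Proof. by apply/subsetP => g; rewrite inE => /andP[]. Qed.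

Lemma card_orbit_mul z : (w z * n z)%N = h.
Proof. by rewrite /w card_orbit mulnC /n Lagrange // subsetIl. Qed.

Lemma orbit_stab_card z z' : z' \in orbit to H z -> w z' = w z /\ n z' = n z.
Proof.
move=> /orbit_eqP e; have ew : w z' = w z by rewrite /w e.
split=> //; have := card_orbit_mul z'; rewrite -(card_orbit_mul z) ew.
by move/eqP; rewrite eqn_pmul2l => [/eqP //|]; apply/card_gt0P; exists z; apply: orbit_refl.
Qed.

Lemma orbit_unirad_card z z' : z' \in orbit to H z -> q z' = q z.
Proof.
case/imsetP => g Hg ->; rewrite /q -(cardJg (unirad z) g); congr #|pred_of_set _|.
apply/setP => u; rewrite mem_conjg [LHS]inE [RHS]inE uniJ; congr (_ && _).
rewrite -mem_conjg; congr (u \in pred_of_set _).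
by rewrite conjIg conjGid // astab1_act.
Qed.

(** The unipotent part of a point stabiliser moves every other point freely. *)
Lemma orbit_unirad_mod z : exists m, w z = (q z * m + 1)%N.
Proof.
pose S := orbit to H z :\ z.
have zS : z \in orbit to H z by apply: orbit_refl.
suff /dvdnP[m mE] : (q z %| #|S|)%N.
  by exists m; rewrite mulnC -mE /w (cardsD1 z) zS addnC.
apply: (@dvdn_acts_sum _ _ to (Qg z)).
  apply/actsP => g /uniradP[Hg gz ug] x.
  rewrite !in_setD1 (act_eq _ gz); congr (_ && _).
  exact: orbit_actr.
move=> x; rewrite in_setD1 => /andP[xz _]; rewrite card_orbit.
suff -> : 'C_(Qg z)[x | to] = 1 by rewrite indexg1.
apply/trivgP/subsetP => g /setIP[/uniradP[Hg gz ug] /astab1P gx]; rewrite inE.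
apply: contraT => g1; case/eqP: xz.
exact: (uni_fix1 Hg g1 ug).
Qed.

(** An element of the stabiliser that is not unipotent has exactly one other fixed point; if
    it commutes with u, then u fixes that point as well, which is impossible. *)
Lemma cent_unirad z u : u \in unirad z -> u != 1 -> 'C_(stab z)[u] = unirad z.
Proof.
move=> uz u1; have : u \in stab z := subsetP (unirad_sub z) u uz.
case/stabP => Hu fu; have uu : uni u by move: uz; rewrite inE => /andP[].
apply/eqP; rewrite eqEsubset; apply/andP; split; last first.
  apply/subsetP => v vz; rewrite inE (subsetP (unirad_sub z)) //=.
  by apply/cent1P; apply: (centsP (Qab z)).
apply/subsetP => g /setIP[gz /cent1P cgu]; rewrite inE gz /=.
apply: contraT => ug; have [Hg fg] := stabP _ _ gz.
have [z' z'z fg'] := uni_fix2 Hg ug fg.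
have g1 : g != 1 by apply: contraNneq ug => ->.
have fu' : to (to z' u) g = to z' u by rewrite -actM -cgu actM fg'.
have := fix_le2 Hg g1 fg fg' fu'; rewrite eq_sym (negPf z'z) /=.
rewrite eq_sym (act_eq _ fu) (negPf z'z) /= eq_sym => /eqP fu''.
by have := uni_fix1 Hu u1 uu fu fu'' => /eqP; rewrite eq_sym (negPf z'z).
Qed.

(** By [cent_unirad], the stabiliser modulo its unipotent radical acts freely on the
    nontrivial unipotent elements. *)
Lemma stab_index z : exists2 c, n z = (q z * c)%N & (c %| (q z).-1)%N.
Proof.
exists #|stab z : unirad z|; first by rewrite /n /q (Lagrange (G := [group of stab z]) (H := Qg z)) ?unirad_sub.
have -> : (q z).-1 = #|unirad z :\ 1|.
  by rewrite /q (cardsD1 1 (unirad z)) (group1 (Qg z)).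
apply: (@dvdn_acts_sum _ _ 'J [group of stab z]).
  apply/actsP => g gz u; rewrite !inE /= conjg_eq1; congr (_ && _).
  rewrite uniJ; congr (_ && _); have := groupJr u gz; rewrite !inE; exact: id.
move=> u; rewrite inE in_set1 => /andP[u1 uz]; rewrite card_orbit astab1J.
exact: (congr1 (fun A : {set gT} => #|stab z : A|) (cent_unirad uz u1)).
Qed.

Let S := [set z | stab z != 1].

Lemma acts_S : [acts H, on S | to].
Proof.
apply/actsP => g Hg z; rewrite !inE !trivg_card1.
by have [_] := orbit_stab_card (mem_orbit to z Hg); rewrite /n => ->.
Qed.

Lemma fix_S g z : g \in H -> g != 1 -> to z g = z -> z \in S.
Proof.
move=> Hg g1 fz; rewrite inE; apply: contraNneq g1 => e.
by have /stabP : g \in H /\ to z g = z by []; rewrite e inE.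
Qed.

(** Burnside's count of orbits, with the unipotent elements counted through the point that
    each of them fixes. *)
Lemma count_S : (#|orbit to H @: S| * h + \sum_(z in S) q z + 2 = 2 * #|S| + 2 * h)%N.
Proof.
have h0 : (0 < h)%N by apply: cardG_gt0.
rewrite -(Frobenius_Cauchy acts_S) (big_setD1 1 (group1 H)) /=.
have -> : 'Fix_(S | to)[1] = S by apply/setIidPl/subsetP => z _; rewrite Fix1P act1.
have FS g : g \in H^# -> #|'Fix_(S | to)[g]| = #|'Fix_to[g]|.
  rewrite !inE => /andP[g1 Hg]; congr #|pred_of_set _|; apply/setIidPr/subsetP => z.
  by rewrite Fix1P => /eqP; apply: fix_S.
have qE : (\sum_(z in S) q z = #|S| + \sum_(g in H^# | uni g) 1)%N.
  rewrite -[X in (X + _)%N]sum1_card.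
  have -> : (\sum_(g in H^# | uni g) 1 = \sum_(g in H^# | uni g) #|'Fix_to[g]|)%N.
    by apply: eq_bigr => g /andP[/[!inE] /andP[g1 Hg] ug]; rewrite fix_card ?ug.
  have -> : (\sum_(g in H^# | uni g) #|'Fix_to[g]| =
     \sum_(g in H^# | uni g) \sum_(z in S) (to z g == z))%N.
    apply: eq_bigr => g /andP[/[dup] Hg /FS <- _]; rewrite -sum1_card big_mkcond /=.
    rewrite [RHS]big_mkcond /=; apply: eq_bigr => z _; rewrite inE Fix1P.
    by case: (z \in S) => //=; case: eqP.
  rewrite exchange_big -big_split /=; apply: eq_bigr => z _.
  rewrite /q (cardsD1 1 (unirad z)) (group1 (Qg z)); congr (_ + _)%N.
  rewrite -sum1_card big_mkcond [RHS]big_mkcond /=; apply: eq_bigr => g _.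
  have -> : (g \in unirad z :\ 1) = [&& g != 1, g \in H, to z g == z & uni g].
    rewrite in_setD1; congr (_ && _).
    by apply/uniradP/and3P => -[? /eqP ? ?]; split=> //; apply/eqP.
  by rewrite in_setD1; case: (g == 1); case: (g \in H); case: eqP; case: (uni g).
rewrite qE; have : (\sum_(g in H^#) #|'Fix_(S | to)[g]| + \sum_(g in H^# | uni g) 1 = 2 * (h - 1))%N.
  rewrite [X in (_ + X)%N]big_mkcondr /= -big_split /=.
  have -> : (h - 1)%N = #|H^#| by rewrite /h (cardsD1 1 H) group1 addKn.
  rewrite mulnC -sum_nat_const; apply: eq_bigr => g Hg; rewrite FS //.
  by move: Hg; rewrite !inE => /andP[g1 Hg]; rewrite fix_card //; case: ifP.
set a := (\sum_(g in H^#) _)%N; set b := (\sum_(g in H^# | _) _)%N.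
move: #|S| h0; rewrite -/h; lia.
Qed.

Let E (A : {set T}) := (h + \sum_(z in A) q z)%N.

Lemma count_orbits : (\sum_(A in orbit to H @: S) E A + 2 =
  \sum_(A in orbit to H @: S) 2 * #|A| + 2 * h)%N.
Proof.
have pS := orbit_partition acts_S.
rewrite big_split /= sum_nat_const -(set_partition_big _ pS) count_S; congr (_ + _)%N.
by rewrite -big_distrr /= (acts_sum_card_orbit acts_S).
Qed.

Lemma orbit_E z : E (orbit to H z) = (h + w z * q z)%N.
Proof.
rewrite /E -sum_nat_const; congr (_ + _)%N; apply: eq_bigr => z' z'z.
exact: orbit_unirad_card.
Qed.

Lemma stab_gt1 z : z \in S -> (1 < n z)%N.
Proof. by rewrite inE trivg_card1 /n; have := cardG_gt0 [group of stab z]; case: #|_| => [|[|]]. Qed.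

Lemma unirad_gt0 z : (0 < q z)%N.
Proof. exact: (cardG_gt0 (Qg z)). Qed.

Lemma order_stab_index g z : g \in stab z -> (forall i, g ^+ i != 1 -> ~~ uni (g ^+ i)) ->
  (#[g] * q z <= n z)%N.
Proof.
move=> gz ug; have tI : <[g]> :&: Qg z = 1.
  apply/trivgP/subsetP => x /setIP[/cycleP[i ->]]; rewrite !inE => /andP[_ ui].
  by apply: contraTT ui; apply: ug.
rewrite orderE /q -(TI_cardMg (G := [group of <[g]>]) (H := Qg z) tI).
apply: subset_leq_card; apply: mul_subG; last exact: unirad_sub.
by rewrite cycle_subG.
Qed.

Lemma uniX_fix y i x : y \in H -> ~~ uni y -> to x y = x -> y ^+ i != 1 -> ~~ uni (y ^+ i).
Proof.
move=> Hy uy fx yi; apply/negP => ui.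
have [x' x'x fx'] := uni_fix2 Hy uy fx.
have fX z : to z y = z -> to z (y ^+ i) = z.
  by move=> fz; elim: (i) => [|k IH]; rewrite ?act1 // expgSr actM IH.
by case/eqP: x'x; apply: (uni_fix1 (groupX i Hy) yi ui); apply: fX.
Qed.

(* [lia] on the hypotheses that are relations between numbers, forgetting what the numbers count *)
Ltac forget_counts := repeat match goal with
  | Hy : is_true (leq _ _) |- _ => revert Hy
  | Hy : @eq nat _ _ |- _ => revert Hy
  | Hy : is_true (negb (@eq_op _ _ _)) |- _ => revert Hy
  end; clearbody h w n q; clear; intros.
Ltac clia := forget_counts; lia.
Ltac cnia := forget_counts; nia.

(** An element of order at least 4 makes the orbit of x small, so that [count_orbits] leaves
    at most three orbits of points with a nontrivial stabiliser. The outcomes are a global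
    fixed point, a dihedral group, the octahedral and icosahedral groups, and an orbit that
    looks like a projective line over a field with q elements. *)
Lemma count_outcome y x : y \in H -> ~~ uni y -> to x y = x -> (4 <= #[y])%N ->
  [\/ exists z, stab z = H,
      q x = 1%N /\ h = (2 * n x)%N,
      [/\ q x = 1%N, (h = 24 /\ n x = 4) \/ (h = 60 /\ n x = 5)%N
        & forall z, (4 * q z <= n z)%N -> z \in orbit to H x]
    | exists z, [/\ (2 < q z)%N, w z = (q z).+1
        & ((q z).-1 * q z %| 2 * n z)%N]].
Proof.
move=> Hy uy fx oy; have h0 : (0 < h)%N by apply: cardG_gt0.
have y1 : y != 1 by apply: contraNneq uy => ->.
have yx : y \in stab x by apply/stabP.
have n4 : (4 * q x <= n x)%N.
  by apply: leq_trans (order_stab_index yx _); rewrite ?leq_mul2r ?oy ?orbT // => i; apply: uniX_fix fx.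
have Sx : x \in S by apply: fix_S fx.
have wn z : (w z * n z = h)%N by apply: card_orbit_mul.
have w0 z : (0 < w z)%N by apply/card_gt0P; exists z; apply: orbit_refl.
have q0 := unirad_gt0.
have stabH z : w z = 1%N -> stab z = H.
  move=> wz; apply/eqP; rewrite eqEcard subsetIl -/h -(wn z) wz mul1n; exact: leqnn.
have := count_orbits; set P := orbit to H @: S.
have Px : orbit to H x \in P by apply: imset_f.
rewrite !(big_setD1 _ Px) /= orbit_E -/(w x).
have PP A : A \in P :\ orbit to H x ->
    exists z, [/\ A = orbit to H z, (1 < n z)%N & z \notin orbit to H x].
  rewrite !inE => /andP[Ax /imsetP[z Sz AE]]; exists z; split=> //; first exact: stab_gt1.
  by apply: contra Ax => /orbit_eqP <-; apply/eqP.
(* A stabiliser of order at least 2 bounds the orbit by half of H. *)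
have EP A : A \in P :\ orbit to H x -> (4 * #|A| + h <= 2 * E A)%N.
  case/PP => z [-> nz _]; rewrite orbit_E -/(w z); have := wn z; have := q0 z.
  move: (n z) (w z) (q z) nz => a b c; cnia.
have wnx := wn x; have q0x := q0 x; have w0x := w0 x.
(* The other orbits number none, one, two, or more. *)
case c0 : #|P :\ orbit to H x| => [|[|[|k]]] e.
- exfalso; move/eqP: c0; rewrite cards_eq0 => /eqP c0; move: e; rewrite c0 !big_set0.
  move: (n x) (w x) (q x) n4 wnx q0x w0x => a b c; cnia.
- have /eqP/cards1P[A PA] := c0; have [|z [Az nz zx]] := PP A; first by rewrite PA set11.
  move: e; rewrite PA !big_set1 Az orbit_E -/(w z) => e.
  have wnz := wn z; have q0z := q0 z; have w0z := w0 z.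
  have e' : (w x * q x + w z * q z + 2 = 2 * w x + 2 * w z)%N.
    by move: e; move: (w x * q x)%N (w z * q z)%N => a b; clia.
  have [qx1|qx1] := eqVneq (q x) 1%N.
    have [qz1|qz1] := eqVneq (q z) 1%N.
      constructor 1; exists x; apply: stabH; rewrite qx1 qz1 in e'; clia.
    have [c nzE cq] := stab_index z; have [m wzE] := orbit_unirad_mod z.
    have [m0|m0] := posnP m.
      by constructor 1; exists z; apply: stabH; rewrite wzE m0 muln0.
    have e2 : (w z * (q z - 2) + 2 = w x)%N.
      by apply: arith_two => //; rewrite -e' qx1 muln1.
    have [q2|q2] := eqVneq (q z) 2.
      constructor 2; split => //; rewrite -wnx; congr (_ * _)%N.
      by rewrite -e2 q2 subnn muln0.
    have q3 : (2 < q z)%N by move: q0z qz1 q2; clia.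
    have c0' : (0 < c)%N by move: nz; rewrite nzE; case: (c); rewrite ?muln0.
    have := @arith_modular (w z) (q z) c (w x) (n x) m q3 m0 wzE cq c0' e2.
    rewrite wnx -nzE wnz => /(_ erefl)[[wq d2c]|[qE wE cE nE]].
      constructor 4; exists z; split => //.
      by rewrite nzE mulnCA mulnC dvdn_pmul2l.
    constructor 3; split => //.
      by right; split => //; rewrite -wnz wE nzE qE cE.
    move=> z' nz'; have Sz' : z' \in S.
      rewrite inE trivg_card1 -/(n z') neq_ltn orbC (leq_trans _ nz') //.
      by have := q0 z'; clia.
    have : orbit to H z' \in P by apply: imset_f.
    rewrite -(setD1K Px) PA Az !inE => /orP[|] /eqP/orbit_eqP // z'z.
    have [_ nE'] := orbit_stab_card z'z; have qE' := orbit_unirad_card z'z.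
    by move: nz'; rewrite nE' qE' nzE cE qE.
  have [qz1|qz1] := eqVneq (q z) 1%N; last first.
    exfalso; have := leq_mul_neq1 (w x) q0x qx1; have := leq_mul_neq1 (w z) q0z qz1.
    by move: e'; move: (w x * q x)%N (w z * q z)%N => a b; clia.
  have [c nxE cq] := stab_index x; have [m wxE] := orbit_unirad_mod x.
  have [m0|m0] := posnP m.
    by constructor 1; exists x; apply: stabH; rewrite wxE m0 muln0.
  have e2 : (w x * (q x - 2) + 2 = w z)%N.
    by apply: arith_two => //; rewrite addnC [in RHS]addnC; move: e'; rewrite qz1 muln1; clia.
  have c4 : (4 <= c)%N by move: n4; rewrite nxE mulnC leq_pmul2l.
  have q5 : (4 <= (q x).-1)%N.
    by apply: leq_trans c4 _; apply: dvdn_leq => //; move: q0x qx1; clia.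
  have q3 : (2 < q x)%N by move: q5; clia.
  have := @arith_modular (w x) (q x) c (w z) (n z) m q3 m0 wxE cq (ltnW (ltnW (ltnW c4))) e2.
  rewrite wnz -nxE wnx => /(_ erefl)[[wq d2c]|[qE]]; last by move: q5; rewrite qE.
  by constructor 4; exists x; split => //; rewrite nxE mulnCA mulnC dvdn_pmul2l.
- have /eqP/cards2P[A [B [AB PAB]]] := c0.
  have [|z [Az nz zx]] := PP A; first by rewrite PAB set21.
  have [|z' [Bz' nz' zx']] := PP B; first by rewrite PAB set22.
  move: e; rewrite PAB !(big_setU1, big_set1) ?inE //= Az Bz' !orbit_E.
  rewrite -/(w z) -/(w z') => e.
  have wnz := wn z; have q0z := q0 z; have w0z := w0 z.
  have wnz' := wn z'; have q0z' := q0 z'; have w0z' := w0 z'.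
  have e' : (w x * q x + w z * q z + w z' * q z' + h + 2 = 2 * w x + 2 * w z + 2 * w z')%N.
    by move: e; move: (w x * q x)%N (w z * q z)%N (w z' * q z')%N => a b d; clia.
  have wx : (4 * w x <= h)%N.
    by rewrite -wnx; move: (w x) (n x) (q x) n4 q0x => a b d; cnia.
  have wz : (2 * w z <= h)%N by rewrite -wnz mulnC leq_mul2l nz orbT.
  have wz' : (2 * w z' <= h)%N by rewrite -wnz' mulnC leq_mul2l nz' orbT.
  have wx2 : (2 * w x <= h)%N by clia.
  have qx1 : q x = 1%N by apply: arith_q wx2 wz wz' q0x q0z q0z' e'.
  have qz1 : q z = 1%N by apply: arith_q wz wx2 wz' q0z q0x q0z' _; clia.
  have qz'1 : q z' = 1%N by apply: arith_q wz' wx2 wz q0z' q0x q0z _; clia.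
  have n4x : (3 < n x)%N by rewrite qx1 in n4.
  have [|w2|[hn nz3 nz3']] := @arith_three h (w x) (w z) (w z') (n x) (n z) (n z') n4x nz nz' h0 wnx wnz wnz'.
  + by move: e'; rewrite qx1 qz1 qz'1 !muln1; clia.
  + by constructor 2; split=> //; rewrite -wnx w2.
  constructor 3; split=> // t nt; have St : t \in S.
    rewrite inE trivg_card1 -/(n t) neq_ltn orbC (leq_trans _ nt) //.
    by have := q0 t; clia.
  have : orbit to H t \in P by apply: imset_f.
  rewrite -(setD1K Px) PAB Az Bz' !inE => /or3P[|/eqP/orbit_eqP tz|/eqP/orbit_eqP tz].
  + by move=> /eqP/orbit_eqP.
  + have [_ nE'] := orbit_stab_card tz; have := q0 t; move: nt nz3; rewrite -nE'; clia.
  + have [_ nE'] := orbit_stab_card tz; have := q0 t; move: nt nz3'; rewrite -nE'; clia.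
exfalso.
have : (\sum_(A in P :\ orbit to H x) (4 * #|A| + h) <= \sum_(A in P :\ orbit to H x) 2 * E A)%N.
  exact: leq_sum.
have wx : (4 * w x <= h)%N.
  by rewrite -wnx; move: (w x) (n x) (q x) n4 q0x => a b d; cnia.
rewrite -big_distrr big_split /= sum_nat_const c0 -[in X in (X + _ <= _)%N]big_distrr /=.
move: e; rewrite -[X in (_ = _ + X + _)%N]big_distrr /=.
have wq : (w x <= w x * q x)%N by rewrite leq_pmulr.
set b := (\sum_(A in P :\ orbit to H x) #|A|)%N; set a := (\sum_(A in _) E A)%N.
clearbody a b; move: (w x * q x)%N wq.
have : (3 * h <= k.+3 * h)%N by rewrite leq_mul2r orbT.
move: (k.+3 * h)%N => kh; clia.
Qed.

End Count.

(** * Homographies of the projective line *)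

Section Mobius.
Variable E : finFieldType.
Local Open Scope ring_scope.
Implicit Types (M N P : 'M[E]_2) (z : option E).

(** The projective line is [option E], where [None] is the point at infinity. *)
Definition vec z : E * E := if z is Some t then (t, 1) else (1, 0).
Definition pt (v : E * E) : option E := if v.2 == 0 then None else Some (v.1 / v.2).
Definition scl (k : E) (v : E * E) : E * E := (k * v.1, k * v.2).
Definition ap M (v : E * E) : E * E :=
  (M 0 0 * v.1 + M 0 1 * v.2, M 1 0 * v.1 + M 1 1 * v.2).
Definition mob M z := pt (ap M (vec z)).

Lemma ap_mx2 a b c e v : ap (mx2 a b c e) v = (a * v.1 + b * v.2, c * v.1 + e * v.2).
Proof. by rewrite /ap !mxE. Qed.

Lemma ptK z : pt (vec z) = z.
Proof. by case: z => [t|]; rewrite /pt /= ?eqxx // oner_eq0 divr1. Qed.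

Lemma pt_scl k v : k != 0 -> pt (scl k v) = pt v.
Proof.
move=> k0; rewrite /pt /= mulf_eq0 (negPf k0) /=; case: eqP => // v0.
by rewrite -mulf_div divff ?mul1r.
Qed.

Lemma vec_neq0 z : vec z != (0, 0).
Proof. by case: z => [t|]; rewrite xpair_eqE oner_eq0 ?andbF. Qed.

Lemma vecK v : v != (0, 0) -> exists2 k, k != 0 & v = scl k (vec (pt v)).
Proof.
case: v => x y; rewrite xpair_eqE /pt /=; case: (eqVneq y 0) => [->|y0] /=.
  by rewrite andbT => x0; exists x => //; rewrite /scl /= mulr1 mulr0.
by exists y => //; rewrite /scl /= mulr1 mulrC divfK.
Qed.

Lemma ap_scl M k v : ap M (scl k v) = scl k (ap M v).
Proof. by rewrite /ap /scl /=; congr (_, _); ring. Qed.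

Lemma ap_mul M N v : ap (M *m N) v = ap M (ap N v).
Proof.
have [a [b [c [e ->]]]] := mx2P M; have [a' [b' [c' [e' ->]]]] := mx2P N.
by rewrite mulmx2 !ap_mx2 /=; congr (_, _); ring.
Qed.

Lemma ap1 v : ap 1%:M v = v.
Proof. by rewrite scalar_mx2 ap_mx2; case: v => x y /=; congr (_, _); ring. Qed.

Lemma ap_scale k M v : ap (k *: M) v = scl k (ap M v).
Proof. by rewrite /ap /scl !mxE /=; congr (_, _); ring. Qed.

Lemma ap_neq0 M v : M \in unitmx -> v != (0, 0) -> ap M v != (0, 0).
Proof.
move=> uM; apply: contra_neq => e0; rewrite -(ap1 v) -(mulVmx uM) ap_mul e0.
by rewrite /ap /=; congr (_, _); ring.
Qed.

Lemma mobM M N z : M \in unitmx -> N \in unitmx -> mob (M *m N) z = mob M (mob N z).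
Proof.
move=> uM uN; rewrite /mob ap_mul.
have [k k0 e] := vecK (ap_neq0 uN (vec_neq0 z)).
by rewrite {1}e ap_scl pt_scl.
Qed.

Lemma mob1 z : mob 1%:M z = z. Proof. by rewrite /mob ap1 ptK. Qed.

Lemma mob_scale k M z : k != 0 -> mob (k *: M) z = mob M z.
Proof. by move=> k0; rewrite /mob ap_scale pt_scl. Qed.

Lemma mob_eig M z : M \in unitmx -> mob M z = z ->
  exists2 l, l != 0 & ap M (vec z) = scl l (vec z).
Proof.
move=> uM fz; have [k k0 e] := vecK (ap_neq0 uM (vec_neq0 z)).
by exists k; rewrite // e -[pt _]/(mob M z) fz.
Qed.

(** The fixed points of a matrix are the projective zeros of a binary quadratic form. *)
Definition fixform a b c e z : Prop :=
  if z is Some t then c * t ^+ 2 + (e - a) * t = b else c = 0.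

Lemma mob_fixP a b c e z : mx2 a b c e \in unitmx ->
  mob (mx2 a b c e) z = z <-> fixform a b c e z.
Proof.
rewrite unitmxE unitfE det_mx2 => dM; rewrite /mob ap_mx2 /pt; case: z => [t|] /=.
  rewrite !mulr1; case: (eqVneq (c * t + e) 0) => [h|h]; split=> //.
  - move=> f; case/eqP: dM; have -> : b = - a * t.
      rewrite -f; transitivity (t * (c * t + e) - a * t); [ring | rewrite h; ring].
    have -> : e = - (c * t) by apply/eqP; rewrite -addr_eq0 addrC h.
    by ring.
  - case=> f; have := congr1 (fun x => x * (c * t + e)) f; rewrite divfK // => f'.
    by transitivity (t * (c * t + e) - a * t); [ring | rewrite -f'; ring].
  - move=> f; congr Some; apply: (mulIf h); rewrite divfK //; rewrite -f; ring.
rewrite mulr0 mulr1 addr0 mulr0 addr0; case: eqP => // h; split=> // h'.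
Qed.

Lemma fixform3 a b c e z1 z2 z3 : fixform a b c e z1 -> fixform a b c e z2 ->
  fixform a b c e z3 -> z1 != z2 -> z1 != z3 -> z2 != z3 -> [/\ b = 0, c = 0 & a = e].
Proof.
have two t1 t2 : t1 != t2 -> c = 0 -> c * t1 ^+ 2 + (e - a) * t1 = b ->
    c * t2 ^+ 2 + (e - a) * t2 = b -> [/\ b = 0, c = 0 & a = e].
  move=> t12 c0 f1 f2; have ea : e - a = 0.
    apply/eqP; have : (e - a) * (t1 - t2) == 0.
      by apply/eqP; transitivity (b - b); [rewrite -{1}f1 -f2 c0; ring | rewrite subrr].
    by rewrite mulf_eq0 [t1 - t2 == 0]subr_eq0 (negPf t12) orbF.
  by split=> //; [rewrite -f1 c0 ea; ring | apply/esym/eqP; rewrite -subr_eq0 ea].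
case: z1 z2 z3 => [t1|] [t2|] [t3|] //=.
- move=> f1 f2 f3 t12 t13 t23.
  have {}t12 : t1 != t2 by []. have {}t13 : t1 != t3 by []. have {}t23 : t2 != t3 by [].
  have h s t : s != t -> c * s ^+ 2 + (e - a) * s = b -> c * t ^+ 2 + (e - a) * t = b ->
      c * (s + t) + (e - a) = 0.
    move=> st fs ft; apply/eqP; have : (c * (s + t) + (e - a)) * (s - t) == 0.
      by apply/eqP; transitivity (b - b); [rewrite -{1}fs -ft; ring | rewrite subrr].
    by rewrite mulf_eq0 [s - t == 0]subr_eq0 (negPf st) orbF.
  have h12 := h _ _ t12 f1 f2; have h13 := h _ _ t13 f1 f3.
  have c0 : c = 0.
    apply/eqP; have : c * (t2 - t3) == 0.
      apply/eqP; transitivity ((c * (t1 + t2) + (e - a)) - (c * (t1 + t3) + (e - a))); first by ring.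
      by rewrite h12 h13 subrr.
    by rewrite mulf_eq0 [t2 - t3 == 0]subr_eq0 (negPf t23) orbF.
  exact: two t12 c0 f1 f2.
- by move=> f1 f2 c0 t12 _ _; apply: two t12 c0 f1 f2.
- by move=> f1 c0 f2 _ t12 _; apply: two t12 c0 f1 f2.
- by move=> c0 f1 f2 _ _ t12; apply: two t12 c0 f1 f2.
Qed.

Lemma fixform_disc a b c e z1 z2 : fixform a b c e z1 -> fixform a b c e z2 ->
  (a + e) ^+ 2 = 4 * (a * e - b * c) -> z1 != z2 -> [/\ b = 0, c = 0 & a = e].
Proof.
move=> f1 f2 disc z12; have {}disc : (e - a) ^+ 2 + 4 * (b * c) = 0.
  by transitivity ((a + e) ^+ 2 - 4 * (a * e - b * c)); [ring | rewrite disc subrr].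
have eq_ea : c = 0 -> e - a = 0.
  move=> c0; apply/eqP; rewrite -sqrf_eq0; apply/eqP.
  by rewrite -disc c0; ring.
have fin t : c * t ^+ 2 + (e - a) * t = b -> c = 0 -> [/\ b = 0, c = 0 & a = e].
  move=> f c0; have ea := eq_ea c0; split=> //; first by rewrite -f ea c0; ring.
  by apply/esym/eqP; rewrite -subr_eq0 ea.
case: z1 z2 f1 f2 z12 => [s|] [t|] //= f1 f2 st; [|exact: fin f1 f2|exact: fin f2 f1].
have {}st : s != t by [].
apply: (fin s f1).
have h : c * (s + t) + (e - a) = 0.
  apply/eqP; have : (c * (s + t) + (e - a)) * (s - t) == 0.
    by apply/eqP; transitivity (b - b); [rewrite -{1}f1 -f2; ring | rewrite subrr].
  by rewrite mulf_eq0 [s - t == 0]subr_eq0 (negPf st) orbF.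
have : (c * (s - t)) ^+ 2 == 0.
  have ea : e - a = - (c * (s + t)) by apply/eqP; rewrite -addr_eq0 addrC h.
  apply/eqP; rewrite -disc -f1 ea; ring.
by rewrite sqrf_eq0 mulf_eq0 [s - t == 0]subr_eq0 (negPf st) orbF => /eqP.
Qed.

Lemma fixform_other a b c e z : fixform a b c e z ->
  (a + e) ^+ 2 != 4 * (a * e - b * c) -> exists2 z', z' != z & fixform a b c e z'.
Proof.
move=> f disc; have {}disc : (e - a) ^+ 2 + 4 * (b * c) != 0.
  apply: contra_neq disc => h; apply/eqP; rewrite -subr_eq0 -h; apply/eqP; ring.
case: (eqVneq c 0) f => [c0|c0]; case: z => [t|] //= f.
- by exists None.
- have ea : e - a != 0.
    by apply: contraNneq disc => ea; rewrite ea c0; apply/eqP; ring.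
  by exists (Some (b / (e - a))) => //=; rewrite c0 mul0r add0r mulrC divfK.
- exists (Some (- ((e - a) / c) - t)); last first.
    rewrite /= -f; by field.
  apply: contraNneq disc => -[h].
  have ea : e - a = - (2 * c * t).
    have -> : 2 * c * t = c * t + c * t by ring.
    by rewrite -{1}h; field.
  by rewrite -f ea; apply/eqP; ring.
by rewrite f eqxx in c0.
Qed.

Lemma fixform_exists a b c e l : l ^+ 2 - (a + e) * l + (a * e - b * c) = 0 ->
  exists z, fixform a b c e z.
Proof.
move=> hl; case: (eqVneq c 0) => [c0|c0]; first by exists None.
exists (Some ((l - e) / c)) => /=.
apply/eqP; rewrite -subr_eq0 -(mulrI_eq0 _ (mulfI c0)); apply/eqP.
by rewrite -hl; field.
Qed.

(** The nilpotent matrix with image the line z. *)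
Definition nilmx z : 'M[E]_2 := if z is Some t then mx2 t (- t ^+ 2) 1 (- t) else mx2 0 1 0 0.

(** A matrix with a double eigenvalue that fixes z is a scalar plus a nilpotent matrix with
    image z. Such matrices commute, which makes the unipotent radicals abelian groups. *)
Lemma uni_formP a b c e z : fixform a b c e z -> (a + e) ^+ 2 = 4 * (a * e - b * c) ->
  exists s k, mx2 a b c e = s%:M + k *: nilmx z.
Proof.
move=> f disc; have {}disc : (e - a) ^+ 2 + 4 * (b * c) = 0.
  by transitivity ((a + e) ^+ 2 - 4 * (a * e - b * c)); [ring | rewrite disc subrr].
case: z f => [t|] /= f.
  have ea : e - a + 2 * c * t = 0.
    by apply/eqP; rewrite -sqrf_eq0; apply/eqP; rewrite -disc -f; ring.
  exists (e + c * t), c; rewrite !mx2E.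
  have aE : a = e + 2 * c * t.
    by apply/esym/eqP; rewrite -subr_eq0 -ea; apply/eqP; ring.
  by rewrite -f aE; congr mx2; ring.
exists a, b; have ea : e - a = 0.
  by apply/eqP; rewrite -sqrf_eq0 -disc f mulr0 mulr0 addr0.
have -> : e = a by apply/eqP; rewrite -subr_eq0 ea.
by rewrite !mx2E f; congr mx2; ring.
Qed.

Lemma nilmx_mul z s k s' k' : (s%:M + k *: nilmx z) *m (s'%:M + k' *: nilmx z) =
  (s * s')%:M + (s * k' + s' * k) *: nilmx z.
Proof. by case: z => [t|] /=; rewrite !mx2E; congr mx2; ring. Qed.

Lemma nilmx_trdet z s k :
  \tr (s%:M + k *: nilmx z) ^+ 2 = 4 * \det (s%:M + k *: nilmx z).
Proof. by case: z => [t|] /=; rewrite !mx2E; ring. Qed.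

Lemma trdet_fixed K z : ap K (vec z) = vec z -> \det K = 1 -> \tr K = 2.
Proof.
have [a [b [c [e ->]]]] := mx2P K; rewrite !mx2E ap_mx2.
case: z => [t|] /= [h1 h2] dK.
  have : (a - 1) * (e - 1) - b * c = 0.
    have bE : b = (1 - a) * t by rewrite -[b](addKr (a * t)) -[in LHS](mulr1 b) h1; ring.
    have eE : e = 1 - c * t by rewrite -h2; ring.
    by rewrite bE eE; ring.
  move=> h; transitivity (1 + (a * e - b * c) - ((a - 1) * (e - 1) - b * c)); first by ring.
  by rewrite h dK; ring.
have a1 : a = 1 by rewrite -h1; ring.
have c0 : c = 0 by rewrite -h2; ring.
by rewrite a1 c0 in dK *; rewrite -dK; ring.
Qed.

End Mobius.

(** * The action of PGL(2,q) on the line over an extension field *)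

Section Action.
Local Open Scope ring_scope.
Variables (F E : finFieldType) (iota : {rmorphism F -> E}).
Hypothesis quad : forall t d : F, exists a : E, a ^+ 2 - iota t * a + iota d = 0.
Implicit Types (M N P : 'M[F]_2) (x y g : PGL2_type F) (z : option E).

Let im M := map_mx iota M.

Lemma unit_im M : (im M \in unitmx) = (M \in unitmx).
Proof. exact: map_unitmx. Qed.

Definition lact x z := mob (im (pglmx x)) z.

Lemma lact_pgl M z : M \in unitmx -> lact (pgl M) z = mob (im M) z.
Proof.
move=> uM; have /eqP/pgl_eq := pglmxK (pgl M).
move=> /(_ (unit_pglmx _) uM)[k k0 e]; rewrite /lact e /im map_mxZ mob_scale //.
by rewrite fmorph_eq0.
Qed.

Lemma lactM x y z : lact (x * y)%g z = lact x (lact y z).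
Proof.
rewrite -[x]pglmxK -[y]pglmxK -pglM ?unit_pglmx // !lact_pgl ?unitmx_mul ?unit_pglmx //.
by rewrite /im map_mxM mobM // unit_im unit_pglmx.
Qed.

Lemma lact1 z : lact 1%g z = z.
Proof. by rewrite -pgl1 lact_pgl ?unitmx1 // /im map_mx1 mob1. Qed.

(** Actions are on the right, hence the inverse. *)
Definition ract z x := lact x^-1%g z.

Lemma ract_morph z : act_morph ract z.
Proof. by move=> x y; rewrite /ract invMg lactM. Qed.

Lemma ract1 z : ract z 1%g = z.
Proof. by rewrite /ract invg1 lact1. Qed.

Definition proj_act : {action PGL2_type F &-> option E} :=
  TotalAction ract1 ract_morph.

Lemma proj_actE z x : proj_act z x = lact x^-1%g z. Proof. by []. Qed.

Lemma lactK x : cancel (lact x) (lact x^-1%g).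
Proof. by move=> z; rewrite -lactM mulVg lact1. Qed.

Lemma lact_inj x : injective (lact x). Proof. exact: can_inj (lactK x). Qed.

Lemma proj_act_fix z x : proj_act z x = z <-> lact x z = z.
Proof.
rewrite proj_actE; split=> e; first by rewrite -{1}e -lactM mulgV lact1.
by rewrite -{1}e lactK.
Qed.

(** Unipotent up to a scalar: a double eigenvalue. *)
Definition uni x : bool := \tr (pglmx x) ^+ 2 == 4 * \det (pglmx x).

Lemma uni_pgl M : M \in unitmx -> uni (pgl M) = (\tr M ^+ 2 == 4 * \det M).
Proof.
move=> uM; have /eqP/pgl_eq := pglmxK (pgl M).
move=> /(_ (unit_pglmx _) uM)[k k0 e]; rewrite /uni e mxtraceZ detZ exprMn.
apply/eqP/eqP => [h|->]; last by ring.
by apply: (mulfI (expf_neq0 2 k0)); rewrite h; ring.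
Qed.

Lemma uni1 : uni 1%g.
Proof. by rewrite -pgl1 uni_pgl ?unitmx1 // !mx2E; apply/eqP; ring. Qed.

Lemma uniJ g x : uni (x ^ g)%g = uni x.
Proof.
have uM := unit_pglmx x; have uN := unit_pglmx g.
rewrite -{1}[x]pglmxK -{1}[g]pglmxK conjgE -pglV // -!pglM ?unitmx_mul ?unitmx_inv ?uM ?uN //.
rewrite uni_pgl ?unitmx_mul ?unitmx_inv ?uM ?uN //.
rewrite mxtrace_mulC mulmxK // !det_mulmx det_inv [X in 4 * X]mulrCA mulVf ?mulr1 //.
by rewrite -unitfE -unitmxE.
Qed.

Lemma lact_fixP a b c e z : mx2 a b c e \in unitmx ->
  lact (pgl (mx2 a b c e)) z = z <-> fixform (iota a) (iota b) (iota c) (iota e) z.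
Proof.
move=> uM; rewrite lact_pgl // /im map_mx2; apply: mob_fixP.
by rewrite -map_mx2 unit_im.
Qed.

Lemma pgl_neq1 x : x != 1%g -> exists a b c e,
  [/\ mx2 a b c e \in unitmx, x = pgl (mx2 a b c e)
    & ~ [/\ iota b = 0, iota c = 0 & iota a = iota e]].
Proof.
move=> x1; have [a [b [c [e xE]]]] := mx2P (pglmx x).
have uM := unit_pglmx x; rewrite xE in uM; exists a, b, c, e; split=> //.
  by rewrite -xE pglmxK.
case=> /eqP + /eqP; rewrite !fmorph_eq0 => /eqP b0 /eqP c0 /fmorph_inj ae.
case/eqP: x1; rewrite -[x]pglmxK xE; apply/eqP/pgl_eq1 => //.
by exists e; rewrite b0 c0 ae scalar_mx2.
Qed.

(** Since quadratic polynomials over F have roots in E, every element has a fixed point;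
    the discriminant tells whether there is a second one. *)
Lemma fix_card g : g != 1%g -> #|('Fix_proj_act[g])%g| = if uni g then 1%N else 2%N.
Proof.
case/pgl_neq1 => a [b [c [e [uM ->{g} nsc]]]].
set g := pgl _; have fixP z : (z \in ('Fix_proj_act[g])%g) <->
    fixform (iota a) (iota b) (iota c) (iota e) z.
  by split=> [/afix1P/proj_act_fix/lact_fixP|/lact_fixP-/(_ uM)/proj_act_fix/afix1P]; apply.
have uniE : uni g = ((iota a + iota e) ^+ 2 == 4 * (iota a * iota e - iota b * iota c)).
  rewrite uni_pgl // !mx2E -(inj_eq (fmorph_inj iota)).
  by rewrite rmorphXn rmorphM rmorph_nat rmorphB rmorphD !rmorphM.
have [z0 fz0] : exists z, fixform (iota a) (iota b) (iota c) (iota e) z.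
  have [l hl] := quad (a + e) (a * e - b * c); apply: (@fixform_exists _ _ _ _ _ l).
  by move: hl; rewrite rmorphB rmorphD !rmorphM.
have z0F : z0 \in ('Fix_proj_act[g])%g by apply/fixP.
rewrite uniE; case: ifP => [/eqP disc|/negbT disc].
  apply/eqP/cards1P; exists z0; apply/setP => z; rewrite in_set1.
  apply/idP/eqP => [/fixP fz|-> //]; apply/eqP; apply: contraT => zz0.
  by case: nsc; apply: fixform_disc fz fz0 disc zz0.
have [z1 z10 fz1] := fixform_other fz0 disc.
have z1F : z1 \in ('Fix_proj_act[g])%g by apply/fixP.
suff -> : ('Fix_proj_act[g])%g = [set z0; z1] by rewrite cards2 eq_sym z10.
apply/setP => z; apply/idP/idP => [/fixP fz|/set2P[->|->] //].
rewrite in_set2; apply: contraT; rewrite negb_or => /andP[zz0 zz1].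
by case: nsc; apply: fixform3 fz fz0 fz1 zz0 zz1 _; rewrite eq_sym.
Qed.

Section Unirad.
Variable H : {group PGL2_type F}.

Lemma mem_stab g z : (g \in 'C_H[z | proj_act])%g <-> g \in H /\ lact g z = z.
Proof.
split=> [/setIP[Hg /astab1P/proj_act_fix]|[Hg /proj_act_fix gz]] //.
by apply/setIP; split=> //; apply/astab1P.
Qed.

Lemma mem_unirad g z : (g \in unirad proj_act H uni z) <-> [/\ g \in H, lact g z = z & uni g].
Proof.
rewrite [_ \in unirad _ _ _ _]inE; split=> [/andP[/mem_stab[]]|[Hg gz ug]] //.
by apply/andP; split=> //; apply/mem_stab.
Qed.

Lemma unirad_form g z : lact g z = z -> uni g ->
  exists s k, im (pglmx g) = s%:M + k *: nilmx z.
Proof.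
have uM := unit_pglmx g; have [a [b [c [e gE]]]] := mx2P (pglmx g).
rewrite /uni gE -{1}[g]pglmxK gE in uM * => /lact_fixP-/(_ uM) f.
rewrite !mx2E /im map_mx2 => /eqP/(congr1 iota) disc; apply: uni_formP f _.
by move: disc; rewrite rmorphXn rmorphM rmorph_nat rmorphB rmorphD !rmorphM.
Qed.

Lemma uni_im M : M \in unitmx -> (\tr (im M) ^+ 2 == 4 * \det (im M)) -> uni (pgl M).
Proof.
move=> uM; rewrite uni_pgl // /im det_map_mx trace_map_mx -rmorphXn.
by rewrite -(rmorph_nat iota) -rmorphM (inj_eq (fmorph_inj iota)).
Qed.

Lemma unirad_group z : group_set (unirad proj_act H uni z).
Proof.
apply/group_setP; split=> [|g h].
  by apply/mem_unirad; rewrite group1 lact1 uni1.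
case/mem_unirad => Hg gz ug /mem_unirad[Hh hz uh]; apply/mem_unirad.
rewrite groupM // lactM hz; split=> //.
have [s [k gE]] := unirad_form gz ug; have [s' [k' hE]] := unirad_form hz uh.
rewrite -[g]pglmxK -[h]pglmxK -pglM ?unit_pglmx //.
apply: uni_im; first by rewrite unitmx_mul !unit_pglmx.
by rewrite /im map_mxM -/(im _) -/(im _) gE hE nilmx_mul nilmx_trdet.
Qed.

Lemma unirad_abelian z : abelian (unirad proj_act H uni z).
Proof.
apply/centsP => g /mem_unirad[Hg gz ug] h /mem_unirad[Hh hz uh].
have [s [k gE]] := unirad_form gz ug; have [s' [k' hE]] := unirad_form hz uh.
rewrite /commute -[g]pglmxK -[h]pglmxK -!pglM ?unit_pglmx //; congr pgl.
apply: (@map_mx_inj _ _ iota); rewrite !map_mxM -!/(im _) gE hE !nilmx_mul.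
by congr (_%:M + _ *: _); [apply: mulrC | apply: addrC].
Qed.

(** The commutator of two matrices with eigenline z has eigenvalue 1 on z, and
    determinant 1. *)
Lemma stab_comm_uni g h z : lact g z = z -> lact h z = z -> uni [~ g, h]%g.
Proof.
move=> gz hz; set M := pglmx g; set N := pglmx h.
have uM : M \in unitmx by apply: unit_pglmx.
have uN : N \in unitmx by apply: unit_pglmx.
pose K := invmx M *m invmx N *m M *m N.
have -> : [~ g, h]%g = pgl K.
  have -> : g = pgl M by rewrite pglmxK.
  have -> : h = pgl N by rewrite pglmxK.
  rewrite commgEl conjgE !mulgA -!pglV //.
  by rewrite /K !pglM // ?unitmx_mul ?unitmx_inv ?uM ?uN.
have uK : K \in unitmx by rewrite !unitmx_mul !unitmx_inv uM uN.
have dK : \det K = 1.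
  rewrite !det_mulmx !det_inv; field.
  by rewrite -!unitfE -!unitmxE uM uN.
have [l l0 lE] := mob_eig (etrans (unit_im M) uM) gz.
have [m m0 mE] := mob_eig (etrans (unit_im N) uN) hz.
have inv P v k : P \in unitmx -> k != 0 -> ap (im P) v = scl k v ->
    ap (im (invmx P)) v = scl k^-1 v.
  move=> uP k0 e; have := congr1 (ap (im (invmx P))) e.
  rewrite -ap_mul /im -map_mxM mulVmx // map_mx1 ap1 ap_scl => e'.
  rewrite [in RHS]e'; case: (ap _ v) => a b; rewrite /scl /= !mulrA mulVf // !mul1r.
    by [].
apply: uni_im => //.
suff -> : \tr (im K) = 2 by rewrite det_map_mx dK rmorph1; apply/eqP; ring.
apply: (@trdet_fixed _ _ z); last by rewrite det_map_mx dK rmorph1.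
rewrite /im !map_mxM !ap_mul -!/(im _) mE !ap_scl lE !ap_scl.
rewrite (inv _ _ _ uN m0 mE) !ap_scl (inv _ _ _ uM l0 lE) /scl /=.
by case: (vec z) => u v /=; congr (_, _); field; rewrite l0 m0.
Qed.

(** The point is the double root of a quadratic form over F, and finite fields are perfect. *)
Lemma uni_rational g z : g != 1%g -> uni g -> lact g z = z -> exists z0 : option F, z = omap iota z0.
Proof.
case/pgl_neq1 => a [b [c [e [uM ->{g} nsc]]]].
rewrite uni_pgl // => ug /lact_fixP-/(_ uM); case: z => [t|]; last by exists None.
rewrite /= => f.
have disc0 : (e - a) ^+ 2 + 4 * (b * c) = 0.
  move/eqP: ug; rewrite !mx2E => ug.
  by transitivity ((a + e) ^+ 2 - 4 * (a * e - b * c)); [ring | rewrite ug subrr].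
have disc := congr1 iota disc0.
rewrite rmorphD rmorphXn rmorphM rmorph_nat rmorphB rmorphM rmorph0 in disc.
have ea : 2 * iota c * t = iota a - iota e.
  have : (iota e - iota a + 2 * iota c * t) ^+ 2 == 0.
    by apply/eqP; rewrite -disc -f; ring.
  rewrite sqrf_eq0 => /eqP h.
  transitivity ((iota e - iota a + 2 * iota c * t) - (iota e - iota a)); first by ring.
  by rewrite h sub0r opprB.
have c0 : c != 0.
  apply/eqP => c0; case: nsc; move: f ea; rewrite c0 rmorph0 mulr0 !mul0r add0r.
  move=> fb /esym/eqP; rewrite subr_eq0 => /eqP ae.
  by rewrite -fb ae subrr mul0r.
have ic0 : iota c != 0 by rewrite fmorph_eq0.
have [two0|two0] := eqVneq (2 : F) 0; last first.
  have itwo0 : (2 : E) != 0 by rewrite -(rmorph_nat iota) fmorph_eq0.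
  exists (Some ((a - e) / (2 * c))) => /=; congr Some.
  rewrite rmorphM fmorphV rmorphB rmorphM rmorph_nat -ea; field.
  by rewrite ic0 itwo0.
have itwo0 : (2 : E) = 0 by rewrite -(rmorph_nat iota) two0 rmorph0.
have ae : iota e = iota a.
  by apply/eqP; rewrite eq_sym -subr_eq0 -ea itwo0 !mul0r.
have eN (u : E) : - u = u.
  by apply/eqP; rewrite eq_sym -subr_eq0 opprK -mulr2n -mulr_natl itwo0 mul0r.
have [r rE] := char2_sqrt (b / c) two0.
exists (Some r) => /=; congr Some; apply/eqP.
have : t ^+ 2 == iota r ^+ 2.
  by rewrite -rmorphXn rE rmorphM fmorphV -f ae subrr mul0r addr0 mulrAC divff ?mul1r.
by rewrite eqf_sqr eN orbb.
Qed.

End Unirad.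

Variable H : {group PGL2_type F}.

Notation stab z := ('C_H[z | proj_act])%g.
Notation urad z := (unirad proj_act H uni z).

(** Commutators in a point stabiliser are unipotent. *)
Lemma stab_abelian z : #|urad z| = 1%N -> abelian (stab z).
Proof.
move=> q1; have uz : urad z = 1%g.
  apply/eqP; rewrite eq_sym eqEcard sub1set q1 cards1 andbT.
  by apply/mem_unirad; rewrite group1 lact1 uni1.
apply/centsP => g gz h hz; apply/commgP.
have [Hg fg] := (mem_stab H g z).1 gz; have [Hh fh] := (mem_stab H h z).1 hz.
suff : [~ g, h]%g \in urad z by rewrite uz inE.
apply/mem_unirad; split; [exact: groupR | | exact: stab_comm_uni fg fh].
have : [~ g, h]%g \in stab z by apply: groupR.
by case/mem_stab.
Qed.

End Action.

(** * Mutual traces *)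

Section Lift.
Variable F : finFieldType.
Local Open Scope ring_scope.
Implicit Types (M N P : 'M[F]_2) (a b g : PGL2_type F).

Definition lift1 a : 'M[F]_2 := (\tr (pglmx a))^-1 *: pglmx a.
(** By [mx2_mulC] all relations between two elements of the class are controlled by this
    number. *)
Definition trp a b : F := \tr (lift1 a *m lift1 b).

Variable d : F.
Hypotheses (d0 : d != 0) (disc : 1 - 4 * d != 0).

Lemma lift1_pgl N : N \in trdet d -> lift1 (pgl N) = N.
Proof.
move=> TN; have [tN _] := trdetP _ _ TN.
have /eqP/pgl_eq := pglmxK (pgl N).
move=> /(_ (unit_pglmx _) (trdet_unit d0 TN))[k k0 e].
by rewrite /lift1 e mxtraceZ tN mulr1 scalerA mulVf // scale1r.
Qed.

Lemma lift1_trdet a : a \in pglT d -> lift1 a \in trdet d /\ pgl (lift1 a) = a.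
Proof. by case/imsetP => N TN ->; rewrite lift1_pgl. Qed.

Lemma trpC a b : trp a b = trp b a.
Proof. exact: mxtrace_mulC. Qed.

Lemma trp_conj g a b : a \in pglT d -> b \in pglT d ->
  trp (conj_op g a) (conj_op g b) = trp a b.
Proof.
move=> /lift1_trdet[Ta ea] /lift1_trdet[Tb eb].
have uP := unit_pglmx g; rewrite -[g]pglmxK -{1}ea -{1}eb -!pgl_conj ?(trdet_unit d0 Ta) ?(trdet_unit d0 Tb) //.
rewrite /trp !lift1_pgl ?trdet_conj // mxtrace_mulC !mulmxA.
by rewrite mulmxKV // mxtrace_mulC !mulmxA mulVmx // mul1mx mxtrace_mulC.
Qed.

Lemma trp_inv a b : a \in pglT d -> b \in pglT d -> trp a b^-1%g = 1 - trp a b.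
Proof.
move=> /lift1_trdet[Ta ea] /lift1_trdet[Tb eb].
rewrite -{1}eb (pgl_trdetV d0 Tb) /trp lift1_pgl ?trdet_adj //.
by rewrite mulmxBr mulmx1 raddfB /=; have [-> _] := trdetP _ _ Ta.
Qed.

Lemma trdet_trace_conj N1 N2 : N1 \in trdet d -> N2 \in trdet d ->
  d * \tr (N2 *m (N1 *m N2 *m invmx N1)) =
  2 * d ^+ 2 - d - \tr (N1 *m N2) ^+ 2 + \tr (N1 *m N2).
Proof.
move=> T1 T2; have [t1 d1] := trdetP _ _ T1; have [t2 d2] := trdetP _ _ T2.
rewrite (trdet_invmx d0 T1) -!scalemxAr mxtraceZ mulrA divff // mul1r.
set t := \tr (N1 *m N2); rewrite !mulmxBr !mulmx1 raddfB /=.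
have -> : \tr (N2 *m (N1 *m N2)) = t - d.
  rewrite mulmxA mxtrace_mulC mulmxA (trdet_sqr T2) mulmxBl mul_scalar_mx raddfB /=.
  by rewrite mxtraceZ t1 mulr1 mxtrace_mulC.
have -> : \tr (N2 *m (N1 *m N2 *m N1)) = t ^+ 2 - 2 * d ^+ 2.
  rewrite !mulmxA -mulmxA mx2_CH raddfB /= mxtraceZ mxtrace_scalar det_mulmx d1 d2.
  by rewrite [\tr (N2 *m N1)]mxtrace_mulC -/t; ring.
ring.
Qed.

(** If the traces degenerate the commutator is singular, and its kernel is a common
    eigenline. *)
Lemma trdet_common_eig N1 N2 : N1 \in trdet d -> N2 \in trdet d ->
  N1 *m N2 != N2 *m N1 ->
  (\tr (N1 *m N2) == 1 - 2 * d) || (\tr (N1 *m N2) == 2 * d) ->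
  exists z, mob N1 z = z /\ mob N2 z = z.
Proof.
move=> T1 T2 nc tE; pose C := N1 *m N2 - N2 *m N1.
have C0 : C != 0 by rewrite subr_eq0.
have detC : \det C = 0.
  have -> : \det C = (1 - 2 * d - \tr (N1 *m N2)) * (\tr (N1 *m N2) - 2 * d).
    have [t1 d1] := trdetP _ _ T1; have [t2 d2] := trdetP _ _ T2; rewrite /C.
    move: t1 d1 t2 d2; have [a [b [c [e ->]]]] := mx2P N1.
    have [a' [b' [c' [e' ->]]]] := mx2P N2; rewrite !mx2E => t1 d1 t2 d2.
    have eE : e = 1 - a by rewrite -t1; ring.
    have eE' : e' = 1 - a' by rewrite -t2; ring.
    rewrite eE in d1 *; rewrite eE' in d2 *.
    pose u := a * (1 - a) - b * c; pose u' := a' * (1 - a') - b' * c'.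
    have uE : u = d by []. have uE' : u' = d by [].
    transitivity ((1 - (u + u') - (a * a' + b * c' + (c * b' + (1 - a) * (1 - a')))) *
      ((a * a' + b * c' + (c * b' + (1 - a) * (1 - a'))) - (u + u')) - (u - u') ^+ 2).
      by rewrite /u /u'; ring.
    by rewrite uE uE'; ring.
  by case/orP: tE => /eqP->; rewrite subrr ?mulr0 ?mul0r.
have comm N : N \in trdet d -> N *m C + C *m N = C -> forall v, ap C v = (0, 0) -> ap C (ap N v) = (0, 0).
  move=> _ e v Cv; have := congr1 (fun M => ap M v) e; rewrite Cv -ap_mul.
  have apD (M M' : 'M_2) : ap (M + M') v = ((ap M v).1 + (ap M' v).1, (ap M v).2 + (ap M' v).2).
    by rewrite /ap !mxE /=; congr (_, _); ring.
  rewrite apD [ap (N *m C) v]ap_mul Cv; case: (ap (C *m N) v) => x y.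
  by rewrite /ap /= !mulr0 !addr0 !add0r.
have c1 : N1 *m C + C *m N1 = C.
  rewrite /C mulmxBr mulmxBl !mulmxA addrA subrK -[X in _ - X]mulmxA (trdet_sqr T1).
  by rewrite mulmxBl mulmxBr scalar_mxC opprB addrA subrK.
have c2 : N2 *m C + C *m N2 = C.
  rewrite /C mulmxBr mulmxBl !mulmxA addrC addrA subrK -[X in X - _]mulmxA (trdet_sqr T2).
  by rewrite mulmxBl mulmxBr scalar_mxC opprB addrA subrK.
have [v v0 [Cv kerC]] : exists2 v : F * F, v != (0, 0) & ap C v = (0, 0) /\
    forall w, ap C w = (0, 0) -> exists k, w = scl k v.
  move: C0 detC; have [a [b [c [e ->]]]] := mx2P C; rewrite det_mx2 => C0 dC.
  have solve u1 u2 : (u1, u2) != (0, 0) -> forall x y, u1 * x + u2 * y = 0 ->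
      exists k, (x, y) = scl k (u2, - u1).
    rewrite xpair_eqE; case: (eqVneq u2 0) => [->|u20].
      rewrite andbT => u10 x y; rewrite mul0r addr0 => /eqP; rewrite mulf_eq0 (negPf u10) /=.
      move=> /eqP->; exists (- y / u1); rewrite /scl /= mulr0; congr (_, _).
      by field.
    move=> _ x y h; exists (x / u2); rewrite /scl /= divfK //; congr (_, _).
    apply: (mulfI u20); have -> : u2 * y = - (u1 * x) by apply/eqP; rewrite -addr_eq0 addrC h.
    by field.
  have [ab0|ab0] := eqVneq (a, b) (0, 0).
    case: ab0 C0 dC => -> -> C0 dC; have ce0 : (c, e) != (0, 0).
      by apply: contraNneq C0 => -[-> ->]; apply/eqP; rewrite -scalar_mx2 raddf0.
    exists (e, - c); first by apply: contraNneq ce0 => -[-> /eqP]; rewrite oppr_eq0 => /eqP->.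
    split=> [|[x y]]; first by rewrite ap_mx2 /=; congr (_, _); ring.
    by rewrite ap_mx2 /= => -[_]; apply: solve.
  exists (b, - a); first by apply: contraNneq ab0 => -[-> /eqP]; rewrite oppr_eq0 => /eqP->.
  split=> [|[x y]]; last by rewrite ap_mx2 /= => -[+ _]; apply: solve.
  rewrite ap_mx2 /=; congr (_, _); first by ring.
  by rewrite -[RHS]oppr0 -dC; ring.
have fixz N : N \in trdet d -> N *m C + C *m N = C -> mob N (pt v) = pt v.
  move=> TN cN; have [k e] := kerC _ (comm N TN cN v Cv).
  have k0 : k != 0.
    apply: contraNneq (ap_neq0 (trdet_unit d0 TN) v0) => k0.
    by rewrite e k0 /scl !mul0r.
  have [l l0 vE] := vecK v0.
  have : scl l (ap N (vec (pt v))) = scl (k * l) (vec (pt v)).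
    by rewrite -ap_scl -vE e {1}vE /scl /= !mulrA.
  move=> /(congr1 (@pt F)); by rewrite !pt_scl ?mulf_neq0 // ptK.
by exists (pt v); split; apply: fixz.
Qed.
End Lift.

(** * The octahedral and icosahedral subracks *)

Section Conjop.
Variable gT : finGroupType.
Implicit Types (g h x y : gT).
Local Open Scope group_scope.

Lemma conj_opE g x : conj_op g x = x ^ g^-1.
Proof. by rewrite /conj_op conjgE invgK mulgA. Qed.
Lemma conj_opM g h x : conj_op (g * h) x = conj_op g (conj_op h x).
Proof. by rewrite !conj_opE invMg conjgM. Qed.
Lemma conj_opV g x : conj_op g x^-1 = (conj_op g x)^-1.
Proof. by rewrite !conj_opE conjVg. Qed.
Lemma conj_opK g : cancel (conj_op g) (conj_op g^-1).
Proof. by move=> x; rewrite !conj_opE invgK conjgKV. Qed.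
Lemma conj_opVK g : cancel (conj_op g^-1) (conj_op g).
Proof. by move=> x; rewrite !conj_opE invgK conjgK. Qed.
Lemma conj_op_inj g : injective (conj_op g).
Proof. exact: can_inj (conj_opK g). Qed.
Lemma conj_op_comm g x : conj_op g x = x <-> commute g x.
Proof.
rewrite /conj_op; split=> [e|->]; last by rewrite mulgK.
by rewrite /commute -{2}e mulgKV.
Qed.
End Conjop.

(** The equation is (d - 1)^2 = d. *)
Lemma golden (F : finFieldType) (d : F) : (d ^+ 2 - 3 * d + 1 = 0)%R ->
  exists2 t, (t ^+ 2 = t + 1)%R & (d = t ^+ 2)%R.
Proof.
move=> e; have t2 : ((d - 1) ^+ 2 = d)%R.
  by apply/eqP; rewrite -subr_eq0 -e; apply/eqP; ring.
by exists (d - 1)%R; rewrite t2 ?subrK.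
Qed.

Section Rational.
Local Open Scope ring_scope.

Lemma lact_rat (F E : finFieldType) (iota : {rmorphism F -> E}) (M : 'M[F]_2) (z : option F) : M \in unitmx ->
  lact iota (pgl M) (omap iota z) = omap iota (mob M z).
Proof.
move=> uM; rewrite lact_pgl // /mob.
have -> : vec (omap iota z) = (iota (vec z).1, iota (vec z).2).
  by case: z => [t|] /=; rewrite ?rmorph1 ?rmorph0.
have [a [b [c [e ->]]]] := mx2P M; rewrite map_mx2 !ap_mx2 /= -!rmorphM -!rmorphD.
by rewrite /pt /= fmorph_eq0; case: eqP => //= _; rewrite fmorph_div.
Qed.

Lemma lact_idfun (F : finFieldType) (M : 'M[F]_2) (z : option F) : M \in unitmx ->
  lact (idfun : {rmorphism F -> F}) (pgl M) z = mob M z.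
Proof.
move=> uM; have idm (s : option F) : omap (idfun : {rmorphism F -> F}) s = s by case: s.
by have := lact_rat idfun z uM; rewrite !idm.
Qed.

End Rational.

Section Small.
Local Open Scope ring_scope.
Variables (F E : finFieldType) (iota : {rmorphism F -> E}).
Hypothesis quad : forall t d : F, exists a : E, a ^+ 2 - iota t * a + iota d = 0.

Variables (d : F) (o : nat).
Hypotheses (d0 : d != 0) (disc : 1 - 4 * d != 0).
Hypothesis ord : forall y, y \in pglT d -> #[y]%g = o.
Hypothesis o4 : (4 <= o)%N.

Local Notation lact := (lact iota).
Local Notation pact := (proj_act iota).

Lemma pglT_uni y : y \in pglT d -> ~~ uni y.
Proof.
case/imsetP => N TN ->; rewrite uni_pgl ?(trdet_unit d0 TN) //.
by have [-> ->] := trdetP _ _ TN; rewrite expr1n -subr_eq0.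
Qed.

Lemma pglT_exp_neq1 y i : y \in pglT d -> (0 < i < 4)%N -> (y ^+ i)%g != 1%g.
Proof.
move=> Ty /andP[i0 i4]; rewrite -order_dvdn (ord Ty); apply/negP => /dvdn_leq.
by move=> /(_ i0); lia.
Qed.

Lemma pglT_neqV y : y \in pglT d -> y != y^-1%g.
Proof.
move=> Ty; have := pglT_exp_neq1 Ty (isT : (0 < 2 < 4)%N); apply: contraNneq => e.
by rewrite expgS expg1 {2}e mulgV.
Qed.

Section OneRack.
Variables (X : {set PGL2_type F}).
Hypotheses (Xc : {in X &, forall x y, conj_op x y \in X}) (sX : X \subset pglT d).

Let H : {group PGL2_type F} := [group of <<X>>%g].
Notation stab z := ('C_H[z | pact])%g.
Notation urad z := (unirad pact H (@uni F) z).

Let XV : {set PGL2_type F} := X :|: [set x^-1%g | x in X].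

Lemma XV_pglT a : a \in XV -> a \in pglT d.
Proof.
by case/setUP => [|/imsetP[b Xb ->]]; [apply: (subsetP sX) | apply/(pglTV d0)/(subsetP sX)].
Qed.

Lemma XV_inv a : a \in XV -> a^-1%g \in XV.
Proof.
case/setUP => [Xa|/imsetP[b Xb ->]]; apply/setUP; last by left; rewrite invgK.
by right; apply: imset_f.
Qed.

Lemma XV_H a : a \in XV -> a \in H.
Proof. by case/setUP => [|/imsetP[b Xb ->]]; rewrite ?groupV; apply: mem_gen. Qed.

Lemma XV_conj h a : h \in H -> a \in XV -> conj_op h a \in XV.
Proof.
move=> Hh /setUP[Xa|/imsetP[b Xb ->]]; apply/setUP.
  by left; apply: (subrack_norm Xc).
by right; rewrite conj_opV; apply/imset_f/(subrack_norm Xc).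
Qed.

Lemma stab_index4 a z : a \in XV -> lact a z = z -> (4 * #|urad z| <= #|stab z|)%N.
Proof.
move=> XVa az; have Ta := XV_pglT XVa; have Ha := XV_H XVa.
have sa : a \in stab z by apply/mem_stab.
apply: leq_trans (order_stab_index (uni := @uni F) (@unirad_group _ _ iota H) sa _).
  by rewrite (ord Ta) leq_mul2r o4 orbT.
move=> i; apply: (uniX_fix (@uni1 F) (fun g _ => @fix_card _ _ _ quad g) Ha (pglT_uni Ta)).
exact: ((proj_act_fix iota z a).2 az).
Qed.

(** The stabiliser is abelian, and commuting elements of the class are equal or inverse. *)
Lemma share_fix a b z : #|urad z| = 1%N -> a \in XV -> b \in XV ->
  lact a z = z -> lact b z = z -> b = a \/ b = a^-1%g.
Proof.
move=> q1 XVa XVb az bz; apply: (pglT_comm d0 disc); [exact: XV_pglT | exact: XV_pglT |].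
apply: (centsP (stab_abelian q1)); apply/mem_stab; split=> //; exact: XV_H.
Qed.

Lemma two_fixed a : a \in XV -> #|('Fix_pact[a])%g| = 2%N.
Proof.
move=> XVa; have Ta := XV_pglT XVa; have ua := pglT_uni Ta.
by rewrite (fix_card quad) ?(negPf ua) //; apply: contraNneq ua => ->; apply: uni1.
Qed.

Variables (y y2 : PGL2_type F) (x : option E) (nx : nat).
Hypotheses (Xy : y \in X) (Xy2 : y2 \in X) (ncomm : ~ commute y y2) (fx : lact y x = x).
Hypothesis qx : #|urad x| = 1%N.
Hypothesis hn : (#|H| = 24 /\ nx = 4 \/ #|H| = 60 /\ nx = 5)%N.
Hypothesis nxE : #|stab x| = nx.
Hypothesis only : forall z, (4 * #|urad z| <= #|stab z|)%N -> z \in (orbit pact H x)%g.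

Let w := orbit pact H x.

Lemma card_w : (#|w| * nx = #|H|)%N.
Proof. by rewrite -nxE; apply: card_orbit_stab. Qed.

Lemma small_order : o = nx.
Proof.
have Ty : y \in pglT d := subsetP sX y Xy.
have : (o %| nx)%N.
  rewrite -(ord Ty) -nxE; apply: order_dvdG; apply/mem_stab; split=> //; exact: mem_gen.
by case: hn => -[_ ->]; move: (o) o4 => [|[|[|[|[|[|k]]]]]] // _ /dvdn_leq; lia.
Qed.

Lemma fix_in_w a z : a \in XV -> lact a z = z -> z \in w.
Proof. by move=> XVa az; apply/only/(stab_index4 XVa). Qed.

Lemma urad_w z : z \in w -> #|urad z| = 1%N.
Proof. by move/(orbit_unirad_card (@uniJ F)) => ->. Qed.

(** A pair {a, a^-1} has two fixed points, both in the orbit, and a point of the orbit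
    determines the pair. *)
Lemma card_XV : (#|XV| <= #|w|)%N.
Proof.
rewrite -(leq_pmul2l (isT : 0 < 2)%N) mulnC -sum_nat_const.
have -> : (\sum_(a in XV) 2 = \sum_(a in XV) \sum_(z in w) (lact a z == z))%N.
  apply: eq_bigr => a XVa; rewrite -(two_fixed XVa) -sum1_card big_mkcond [RHS]big_mkcond /=.
  apply: eq_bigr => z _; have -> : (z \in 'Fix_pact[a])%g = (lact a z == z).
    by apply/afix1P/eqP => [/(proj_act_fix iota z a).1|/(proj_act_fix iota z a).2].
  by case: eqP => [/(fix_in_w XVa) ->|_] //; case: ifP.
rewrite exchange_big mulnC -sum_nat_const /=; apply: leq_sum => z wz.
have [/existsP[a /andP[XVa /eqP az]]|none] := boolP [exists a in XV, lact a z == z].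
  apply: leq_trans (_ : #|[set a; a^-1%g]| <= _)%N; last by rewrite cards2; case: eqP.
  rewrite -sum1_card big_mkcond [X in (_ <= X)%N]big_mkcond /=; apply: leq_sum => b _.
  case: ifP => // XVb; case: eqP => // bz.
  by have [->|->] := share_fix (urad_w wz) XVa XVb az bz; rewrite !inE eqxx ?orbT.
rewrite big1 // => a XVa; apply/eqP; rewrite eqb0; apply: contra none => az.
by apply/existsP; exists a; rewrite XVa az.
Qed.

Let XVy : y \in XV. Proof. by apply/setUP; left. Qed.
Let XVy2 : y2 \in XV. Proof. by apply/setUP; left. Qed.

Lemma noncomm_fix a b z : a \in XV -> b \in XV -> ~ commute a b ->
  lact a z = z -> lact b z <> z.
Proof.
move=> XVa XVb nc az bz; apply: nc; have wz := fix_in_w XVa az.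
by case: (share_fix (urad_w wz) XVa XVb az bz) => ->; [|apply/commuteV].
Qed.

(** If k in <y> is not 1, an element commuting with k permutes the two fixed points of y.
    Fixing one of them, it would commute with y; if it exchanges them, its square fixes
    both, while the square has the same fixed points as the element. *)
Lemma cycle_free a k : a \in XV -> ~ commute y a -> k \in <[y]>%g -> commute k a -> k = 1%g.
Proof.
move=> XVa nc ky cka; apply/eqP; apply: contraT => k1.
have kH : k \in H by apply: (subsetP _ k ky); rewrite cycle_subG XV_H.
have Ty := XV_pglT XVy; have Ta := XV_pglT XVa.
have fk z : lact y z = z -> lact k z = z.
  move=> yz; case/cycleP: ky => i ->.
  by elim: i => [|i IH]; rewrite ?expg0 ?lact1 // expgS lactM IH.
have [x' x'x /proj_act_fix fx'] := uni_fix2 (@uni1 F) (fun g _ => @fix_card _ _ _ quad g)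
  (XV_H XVy) (pglT_uni Ty) ((proj_act_fix _ _ _).2 fx).
have le2 := fix_le2 (fun g _ => @fix_card _ _ _ quad g) (H := H).
have swap z : lact k z = z -> lact k (lact a z) = lact a z.
  by move=> kz; rewrite -lactM cka lactM kz.
have ax : lact a x <> x by apply: noncomm_fix nc fx.
have ax' : lact a x' <> x' by apply: noncomm_fix nc fx'.
have toF z : lact k z = z -> pact z k = z := (proj_act_fix iota z k).2.
have axE : lact a x = x'.
  have := le2 _ x x' (lact a x) kH k1 (toF _ (fk _ fx)) (toF _ (fk _ fx')) (toF _ (swap _ (fk _ fx))).
  rewrite eq_sym (negPf x'x) /= => /orP[/eqP e|/eqP->//]; by case: ax.
have ax'E : lact a x' = x.
  have := le2 _ x x' (lact a x') kH k1 (toF _ (fk _ fx)) (toF _ (fk _ fx')) (toF _ (swap _ (fk _ fx'))).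
  rewrite eq_sym (negPf x'x) /= => /orP[/eqP->//|/eqP e]; by case: ax'.
have a2 : (a ^+ 2)%g != 1%g := pglT_exp_neq1 Ta (isT : (0 < 2 < 4)%N).
have fa2 : lact (a ^+ 2)%g x = x by rewrite expgS expg1 lactM axE ax'E.
have : (1 < #|('Fix_pact[a])%g|)%N by rewrite two_fixed.
case/card_gt1P => z1 [z2 [/afix1P/proj_act_fix f1 /afix1P/proj_act_fix f2 z12]].
have f2a z : lact a z = z -> lact (a ^+ 2)%g z = z by move=> e; rewrite expgS expg1 lactM !e.
have := le2 _ z1 z2 x (groupX 2 (XV_H XVa)) a2 ((proj_act_fix _ _ _).2 (f2a _ f1))
  ((proj_act_fix _ _ _).2 (f2a _ f2)) ((proj_act_fix _ _ _).2 fa2).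
rewrite (negPf z12) /= => /orP[/eqP e|/eqP e]; case: ax; by rewrite -e.
Qed.

Lemma card_cycle_orbit a : a \in XV -> ~ commute y a -> #|(a ^: <[y]>)%g| = o.
Proof.
move=> XVa nc; rewrite -index_cent1.
suff -> : ('C_(<[y]>)[a])%g = 1%g by rewrite indexg1 -orderE (ord (XV_pglT XVy)).
apply/trivgP/subsetP => k /setIP[ky /cent1P cak]; rewrite inE; apply/eqP.
by apply: (cycle_free XVa nc ky); first [exact: cak | exact: (commute_sym cak)].
Qed.

Lemma cycle_orbit_sub a : a \in XV -> (a ^: <[y]>)%g \subset XV.
Proof.
move=> XVa; apply/subsetP => _ /imsetP[k ky ->].
rewrite -[k]invgK -conj_opE; apply: XV_conj => //; rewrite groupV.
by apply: (subsetP _ k ky); rewrite cycle_subG XV_H.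
Qed.

Lemma cycle_orbit_nc a b : ~ commute y a -> b \in (a ^: <[y]>)%g -> ~ commute y b.
Proof.
move=> nc /imsetP[k /cycleP[i ->] ->] c; apply: nc.
have e : (y ^ (y ^+ i))%g = y by rewrite conjgE -expgS expgSr mulKg.
by apply: (conjg_inj (y ^+ i)%g); rewrite !conjMg e c.
Qed.

(** The conjugates of y2 and y2^-1 by the powers of y, together with y and y^-1, reach the
    bound of [card_XV]. *)
Lemma XV_cover a : a \in XV -> ~ commute y a ->
  a \in (y2 ^: <[y]>)%g \/ a^-1%g \in (y2 ^: <[y]>)%g.
Proof.
move=> XVa nca; set B := (y2 ^: <[y]>)%g.
pose D := XV :\: [set y; y^-1%g].
have DE b : b \in XV -> ~ commute y b -> b \in D.
  move=> XVb nc; rewrite inE XVb andbT !inE; apply/norP.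
  by split; apply/eqP => e; apply: nc; rewrite e //; apply/commuteV.
have cD : (#|D| <= #|w| - 2)%N.
  rewrite cardsD (setIidPr _) ?cards2 ?(pglT_neqV (XV_pglT XVy)) ?leq_sub2r ?card_XV //.
  by apply/subsetP => b /set2P[->|->]; rewrite ?XV_inv.
have cB : #|B| = nx by rewrite /B card_cycle_orbit // small_order.
have BD : B \subset D.
  apply/subsetP => b Bb; apply: DE; last exact: cycle_orbit_nc Bb.
  by apply: (subsetP (cycle_orbit_sub XVy2)).
have Da := DE a XVa nca; have cw := card_w.
case: hn => -[hE nE].
  left; have : (#|D| <= #|B|)%N.
    rewrite cB nE; move: cD cw; rewrite hE nE; move: #|w| #|D| => u v; clear; lia.
  by move=> le; have /eqP-> : B == D by rewrite eqEcard BD.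
have ncV : ~ commute y y2^-1%g by move=> /commuteV; rewrite invgK.
pose B' := (y2^-1 ^: <[y]>)%g.
have cB' : #|B'| = nx by rewrite /B' card_cycle_orbit ?XV_inv // small_order.
have BD' : B' \subset D.
  apply/subsetP => b Bb; apply: DE; last exact: cycle_orbit_nc Bb.
  by apply: (subsetP (cycle_orbit_sub (XV_inv XVy2))).
have BB' : [disjoint B & B'].
  apply/pred0P => b /=; apply/negP => /andP[/class_eqP e1 /class_eqP e2].
  have : y2^-1%g \in B by rewrite /B (etrans (esym e1) e2); apply: class_refl.
  case/imsetP => k ky e.
  have k2 : (k * k)%g = 1%g.
    apply: (cycle_free XVy2 ncomm); first exact: groupM.
    have eK : (y2 ^ (k * k))%g = y2 by rewrite conjgM -e conjVg -e invgK.
    by apply: commute_sym; rewrite /commute conjgC eK.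
  have ok : (#[k]%g %| 5)%N.
    have := order_dvdG ky; rewrite -orderE (ord (XV_pglT XVy)) small_order nE //.
  have ok2 : (#[k]%g %| 2)%N by rewrite order_dvdn expgS expg1 k2.
  have k1 : k = 1%g.
    apply/eqP; rewrite -order_eq1 -dvdn1.
    by have : (#[k]%g %| gcdn 5 2)%N by rewrite dvdn_gcd ok ok2.
  by have := pglT_neqV (XV_pglT XVy2); rewrite e k1 conjg1 eqxx.
have DBB : D = B :|: B'.
  apply/esym/eqP; rewrite eqEcard subUset BD BD' cardsU.
  rewrite (_ : B :&: B' = set0) ?cards0 ?subn0; last by apply/eqP; rewrite setI_eq0.
  rewrite cB cB' nE; move: cD cw; rewrite hE nE; move: #|w| #|D| => u v; clear; lia.
move: Da; rewrite DBB => /setUP[|/imsetP[k ky ->]]; [by left|right].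
by rewrite conjVg invgK; apply: imset_f.
Qed.

(** Conjugation by y preserves the mutual trace with y, and inversion changes t into 1 - t. *)
Lemma trp_noncomm a : a \in XV -> ~ commute y a ->
  trp y a = trp y y2 \/ trp y a = 1 - trp y y2.
Proof.
move=> XVa nc; have Ty := XV_pglT XVy; have Ty2 := XV_pglT XVy2; have Ta := XV_pglT XVa.
have trB b : b \in (y2 ^: <[y]>)%g -> trp y b = trp y y2.
  case/imsetP => _ /cycleP[i ->] ->.
  have e : (y ^ (y ^+ i))%g = y by rewrite conjgE -expgS expgSr mulKg.
  by rewrite -(trp_conj d0 (y ^+ i)^-1%g Ty Ty2) !conj_opE invgK e.
case: (XV_cover XVa nc) => [/trB|/trB e]; [by left|right].
by rewrite -e (trp_inv d0) // opprB addrC subrK.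
Qed.

(** With t = trp y y2, all noncommuting elements have mutual trace t or 1 - t. Applied to y2
    and its conjugate by y, whose mutual trace is also given by [trdet_trace_conj], this is a
    quadratic equation for t. Its roots are d, 1 - d and the degenerate values 2d and 1 - 2d,
    for which y and y2 would share a fixed point. *)
Lemma small_pair : exists a b, [/\ a \in XV, b \in XV & trp a b = d].
Proof.
have Ty := XV_pglT XVy; have Ty2 := XV_pglT XVy2.
have [z fz] : exists z, lact y2 z = z.
  have : (0 < #|('Fix_pact[y2])%g|)%N by rewrite two_fixed.
  by case/card_gt0P => z /afix1P/proj_act_fix fz; exists z.
have wz : z \in w := fix_in_w XVy2 fz.
have [h Hh hx] : exists2 h, h \in H & lact h x = z.
  by case/orbitP: (wz) => g Hg e; exists g^-1%g; rewrite ?groupV.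
have XVhy : conj_op h y \in XV by apply: XV_conj.
have fhy : lact (conj_op h y) z = z by rewrite /conj_op !lactM -hx lactK fx.
have hyE : conj_op h y = y2 \/ conj_op h y = y2^-1%g := share_fix (urad_w wz) XVy2 XVhy fz fhy.
pose y3 := conj_op y y2; have XV3 : y3 \in XV by apply: XV_conj => //; apply: XV_H.
have T3 := XV_pglT XV3.
have nc3 : ~ commute y2 y3.
  move=> c; case: (pglT_comm d0 disc Ty2 T3 c) => [/conj_op_comm//|e].
  have : commute (y * y)%g y2.
    by apply/conj_op_comm; rewrite conj_opM -/y3 e conj_opV -/y3 e invgK.
  move/(cycle_free XVy2 ncomm) => /(_ (groupM (cycle_id y) (cycle_id y))) e2.
  by have := pglT_exp_neq1 Ty (isT : (0 < 2 < 4)%N); rewrite expgS expg1 e2 eqxx.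
pose a := conj_op h^-1 y3; have XVa : a \in XV by apply: XV_conj; rewrite ?groupV.
have haE : conj_op h a = y3 by rewrite conj_opVK.
have Ta := XV_pglT XVa.
have nca : ~ commute y a.
  move=> c; have {}c : commute (conj_op h y) y3.
    by rewrite -haE !conj_opE /commute -!conjMg c.
  case: hyE c => ->; first exact: nc3.
  by move/commute_sym/commuteV; rewrite invgK => /commute_sym.
set t := trp y y2; have t3 : trp y2 y3 = t \/ trp y2 y3 = 1 - t.
  have e : trp (conj_op h y) y3 = trp y a by rewrite -haE; apply: (trp_conj d0).
  case: hyE e => ->; first by move=> ->; apply: trp_noncomm.
  rewrite trpC (trp_inv d0) // trpC => e.
  have -> : trp y2 y3 = 1 - trp y a by rewrite -e opprB addrC subrK.
  case: (trp_noncomm XVa nca) => ->; [by right|left].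
  by rewrite opprB addrC subrK.
have [T1 e1] := lift1_trdet d0 Ty; have [T2 e2] := lift1_trdet d0 Ty2.
have f3 : d * trp y2 y3 = 2 * d ^+ 2 - d - t ^+ 2 + t.
  have -> : t = \tr (lift1 y *m lift1 y2) by [].
  have -> : trp y2 y3 = \tr (lift1 y2 *m (lift1 y *m lift1 y2 *m invmx (lift1 y))).
    have TC := trdet_conj (trdet_unit d0 T1) T2.
    by rewrite /trp -[in RHS](lift1_pgl d0 TC) pgl_conj ?(trdet_unit d0 T1, trdet_unit d0 T2) // e1 e2.
  exact: trdet_trace_conj.
have nondeg : (t == 1 - 2 * d) || (t == 2 * d) -> False.
  move=> tE; have nc12 : lift1 y *m lift1 y2 != lift1 y2 *m lift1 y.
    apply/eqP => c; apply: ncomm.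
    by rewrite /commute -e1 -e2 -!pglM ?(trdet_unit d0 T1) ?(trdet_unit d0 T2) ?c.
  have [z0 [f1 f2]] := trdet_common_eig d0 T1 T2 nc12 tE.
  apply: (@noncomm_fix y y2 (omap iota z0)) => //.
    by rewrite -e1 lact_rat ?f1 ?(trdet_unit d0).
  by rewrite -e2 lact_rat ?f2 ?(trdet_unit d0).
have [td|td] : t = d \/ t = 1 - d.
  case: t3 => e; rewrite e in f3.
    have : (t - d) * (t - (1 - 2 * d)) == 0.
      apply/eqP; transitivity (d * t - (2 * d ^+ 2 - d - t ^+ 2 + t)); first by ring.
      by rewrite f3 subrr.
    rewrite mulf_eq0 !subr_eq0 => /orP[/eqP->|tE]; first by left.
    by case: nondeg; rewrite tE.
  have : (t - (1 - d)) * (t - 2 * d) == 0.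
    apply/eqP; transitivity (d * (1 - t) - (2 * d ^+ 2 - d - t ^+ 2 + t)); first by ring.
    by rewrite f3 subrr.
  rewrite mulf_eq0 !subr_eq0 => /orP[/eqP->|tE]; first by right.
  by case: nondeg; rewrite tE orbT.
- by exists y, y2.
- exists y, y2^-1%g; rewrite XVy XV_inv //; split=> //.
  by rewrite (trp_inv d0) // -/t td opprB addrC subrK.
Qed.

(** The rack generated by two matrices of mutual trace d exhausts X and its inverses, by
    [card_XV]; as it has no proper stable subset, it is X. *)
Lemma small_case :
  (o = 4%N /\ rack_isom X (long_cycle 4 ^: 'Sym_('I_4))%g) \/
  (o = 5%N /\ rack_isom X (long_cycle 5 ^: 'Alt_('I_5))%g).
Proof.
have [a [b [XVa XVb tab]]] := small_pair.
have Ty := XV_pglT XVy; have [T1 e1] := lift1_trdet d0 Ty.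
have [Ta ea] := lift1_trdet d0 (XV_pglT XVa).
have [Tb eb] := lift1_trdet d0 (XV_pglT XVb).
have XVc : {in XV &, forall u v, conj_op u v \in XV}.
  by move=> u v XVu XVv; apply: XV_conj => //; apply: XV_H.
have fin n (G : {set 'S_n}) m (Y : {set PGL2_type F}) : #|w| = m ->
    table_rack G m (pgl (lift1 a)) (pgl (lift1 b)) Y -> rack_isom X (long_cycle n ^: G)%g.
  rewrite ea eb => wm [iso _ cY sub conn].
  have XYV : Y = XV.
    by apply/eqP; rewrite eqEcard (sub XV) // cY -wm card_XV.
  suff -> : X = Y by [].
  rewrite XYV in conn *; apply: conn; first by apply/set0Pn; exists y.
    by apply/subsetP => u Xu; apply/setUP; left.
  by move=> u v XVu Xv; apply: (subrack_norm Xc) => //; apply: (XV_H XVu).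
have cw := card_w; have oE := small_order.
case: hn => -[hE nE]; rewrite hE nE in cw; rewrite nE in oE; [left|right]; split=> //.
  have dd : 2 * d = 1.
    have : (pgl (lift1 y) ^+ 4)%g == 1%g by rewrite e1 -oE -(ord Ty) expg_order.
    by rewrite (pgl_trdet_exp4 d0 disc T1) subr_eq0 => /eqP.
  have [Y [_ tY]] := trdet_table_Sym4 d0 dd Ta Tb tab.
  by apply: fin tY; move: cw; clear; lia.
have dd : d ^+ 2 - 3 * d + 1 = 0.
  have : (pgl (lift1 y) ^+ 5)%g == 1%g by rewrite e1 -oE -(ord Ty) expg_order.
  by rewrite (pgl_trdet_exp5 d0 disc T1) => /eqP.
have [t t2 dt] := golden dd.
have [Y [_ tY]] := trdet_table_Alt5 d0 disc t2 dt Ta Tb tab.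
by apply: fin tY; move: cw; clear; lia.
Qed.

End OneRack.
End Small.

(** * Finite vector spaces inside a field *)

Section Basis.
Local Open Scope ring_scope.
Variables (K : finFieldType) (V : finZmodType) (sc : K -> V -> V).
Hypothesis scD : forall c a b, sc c (a + b) = sc c a + sc c b.
Hypothesis scDl : forall c c' a, sc (c + c') a = sc c a + sc c' a.
Hypothesis scA : forall c c' a, sc c (sc c' a) = sc (c * c') a.
Hypothesis sc1 : forall a, sc 1 a = a.
Variable (A : {set V}).
Hypotheses (A0 : 0 \in A) (Aclosed : forall c a b, a \in A -> b \in A -> sc c a + b \in A).

Definition semilin n (phi : 'rV[K]_n -> V) := forall c u v, phi (c *: u + v) = sc c (phi u) + phi v.

Lemma sc0 c : sc c 0 = 0.
Proof. by apply: (addrI (sc c 0)); rewrite -scD !addr0. Qed.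

Lemma sc0l a : sc 0 a = 0.
Proof. by apply: (addrI (sc 0 a)); rewrite -scDl !addr0. Qed.

Lemma semilin0 n (phi : 'rV[K]_n -> V) : semilin phi -> phi 0 = 0.
Proof.
move=> lin; apply: (addrI (phi 0)); have := lin 1 0 0.
by rewrite scaler0 !addr0 sc1.
Qed.

Lemma semilinD n (phi : 'rV[K]_n -> V) u v : semilin phi -> phi (u + v) = phi u + phi v.
Proof. by move=> lin; rewrite -{1}[u]scale1r lin sc1. Qed.

Lemma semilin_inj n (phi : 'rV[K]_n -> V) : semilin phi ->
  (forall u, phi u = 0 -> u = 0) -> injective phi.
Proof.
move=> lin ker u v e; apply/eqP; rewrite -subr_eq0; apply/eqP/ker.
apply: (addIr (phi v)); rewrite -semilinD // subrK add0r //.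
Qed.

(** Greedy choice of a basis. The scalar action [sc] is only an operation on an additive
    group, so that this serves both for abstract modules and for subsets of a field. *)
Lemma basis_set : exists n (phi : 'rV[K]_n -> V),
  [/\ semilin phi, injective phi & phi @: setT = A].
Proof.
have step k : (exists n (phi : 'rV[K]_n -> V), [/\ semilin phi, injective phi & phi @: setT = A])
    \/ exists phi : 'rV[K]_k -> V, [/\ semilin phi, injective phi & phi @: setT \subset A].
  elim: k => [|k [|[phi [lin inj im]]]]; [right | by left |].
    exists (fun _ => 0); split=> [c u v|u v _|].
    - by rewrite sc0 addr0.
    - by rewrite (thinmx0 u) (thinmx0 v).
    by apply/subsetP => _ /imsetP[u _ ->].
  have [e|/eqP ne] := (phi @: setT =P A); first by left; exists k, phi.
  have /properP[_ [a Aa nim]] : phi @: setT \proper A by rewrite properEneq ne.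
  right; exists (fun w : 'rV_(1 + k) => sc (w 0 0) a + phi (rsubmx w)).
  have lin' : semilin (fun w : 'rV_(1 + k) => sc (w 0 0) a + phi (rsubmx w)).
    move=> c u v; rewrite linearP lin !mxE scDl scD scA addrACA; congr (_ + _ + _).
  split=> //; last first.
    apply/subsetP => _ /imsetP[w _ ->]; apply: Aclosed => //.
    by apply: (subsetP im); apply: imset_f.
  apply: (@semilin_inj (1 + k)) => // w /= e.
  have w0 : w 0 0 = 0.
    apply/eqP; apply: contraT => w0; case/negP: nim; apply/imsetP.
    exists (- (w 0 0)^-1 *: rsubmx w) => //.
    rewrite -[_ *: _]addr0 lin (semilin0 lin) addr0.
    have -> : phi (rsubmx w) = sc (- w 0 0) a.
      apply: (addrI (sc (w 0 0) a)); rewrite e -scDl subrr sc0l //.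
    by rewrite scA mulrNN mulVf // sc1.
  have r0 : rsubmx w = 0.
    by apply: inj; rewrite (semilin0 lin) -[RHS]e w0 sc0l add0r.
  apply/matrixP => i j; rewrite ord1 -[w]hsubmxK r0 [RHS]mxE.
  case: (split_ordP j) => j' ->; last by rewrite row_mxEr mxE.
  by rewrite row_mxEl mxE ord1 -[RHS]w0; congr (w _ _); apply/val_inj.
have [//|[phi [_ inj _]]] := step #|V|.
have : (#|{: 'rV[K]_#|V|}| <= #|V|)%N by rewrite -(card_codom inj) max_card.
rewrite card_mx mul1n => le; have := ltn_expl #|V| (finNzRing_gt1 K).
by rewrite ltnNge le.
Qed.

End Basis.

Section Embed.
Local Open Scope ring_scope.
Variables (F : finFieldType) (K : subfield F).

(** Both spaces are some K^n, and the size decides which dimension is larger. *)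
Lemma lmod_embed (A : finLmodType K) : (#|A| <= #|F|)%N ->
  exists phi : A -> F, [/\ injective phi, forall a b, phi (a + b) = phi a + phi b
     & forall c a, phi (c *: a) = sfval c * phi a].
Proof.
move=> le.
have [n [f [flin finj fim]]] := @basis_set K A (fun c a => c *: a) (@scalerDr _ _)
  (fun c c' a => scalerDl a c c') (@scalerA _ _) (@scale1r _ _) setT (in_setT _) (fun c a b _ _ => in_setT _).
have [m [g [glin ginj gim]]] := @basis_set K F (fun c a => sfval c * a)
  (fun c => mulrDr (sfval c)) (fun c c' a => mulrDl (sfval c) (sfval c') a)
  (fun c c' a => mulrA (sfval c) (sfval c') a) (@mul1r _) setT (in_setT _) (fun c a b _ _ => in_setT _).
have cA : #|A| = (#|K| ^ n)%N by rewrite -cardsT -fim card_imset // cardsT card_mx mul1n.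
have cF : #|F| = (#|K| ^ m)%N by rewrite -cardsT -gim card_imset // cardsT card_mx mul1n.
have nm : (n <= m)%N by rewrite -(leq_exp2l n m (finNzRing_gt1 K)) -cA -cF.
have fE a : exists u, f u == a.
  have : a \in f @: setT by rewrite fim inE.
  by case/imsetP => u _ ->; exists u.
pose finv a := xchoose (fE a); have finvK a : f (finv a) = a := eqP (xchooseP (fE a)).
have finvf u : finv (f u) = u by apply: finj; rewrite finvK.
pose h (u : 'rV[K]_n) : 'rV[K]_m := u *m pid_mx n.
have hinj : injective h.
  move=> u v e.
  have pp : (pid_mx n : 'M[K]_(n, m)) *m (pid_mx n : 'M[K]_(m, n)) = 1%:M.
    rewrite (@mul_pid_mx K n m n n n) minnn (minn_idPr nm); exact: pid_mx_1.
  by rewrite -[u]mulmx1 -[v]mulmx1 -pp !mulmxA -/(h u) -/(h v) e.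
have gD u v : g (u + v) = g u + g v.
  exact: (@semilinD K F (fun c a => sfval c * a) (@mul1r _) m g u v glin).
have g0 : g 0 = 0 := @semilin0 K F (fun c a => sfval c * a) (@mul1r _) m g glin.
have fD u v : f (u + v) = f u + f v.
  exact: (@semilinD K A (fun c a => c *: a) (@scale1r _ _) n f u v flin).
have f0 : f 0 = 0 := @semilin0 K A (fun c a => c *: a) (@scale1r _ _) n f flin.
exists (fun a => g (h (finv a))); split.
- by move=> a b /ginj/hinj e; rewrite -[a]finvK e finvK.
- move=> a b; have -> : finv (a + b) = finv a + finv b by apply: finj; rewrite fD !finvK.
  by rewrite /h mulmxDl gD.
move=> c a; have -> : finv (c *: a) = c *: finv a.
  by apply: finj; rewrite finvK -[c *: finv a]addr0 flin f0 addr0 finvK.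
by rewrite /h -scalemxAl -[c *: _]addr0 glin g0 addr0.
Qed.

Lemma subspace_lmod (A : {set F}) : 0 \in A ->
  (forall (c : K) a b, a \in A -> b \in A -> sfval c * a + b \in A) ->
  exists n (phi : 'rV[K]_n -> F), [/\ injective phi, phi @: setT = A,
     forall a b, phi (a + b) = phi a + phi b & forall c a, phi (c *: a) = sfval c * phi a].
Proof.
move=> A0 Ac; have [n [g [glin ginj gim]]] := @basis_set K F (fun c a => sfval c * a)
  (fun c => mulrDr (sfval c)) (fun c c' a => mulrDl (sfval c) (sfval c') a)
  (fun c c' a => mulrA (sfval c) (sfval c') a) (@mul1r _) A A0 Ac.
exists n, g; split=> // [a b|c a].
  exact: (@semilinD K F (fun c a => sfval c * a) (@mul1r _) n g a b glin).
rewrite -[c *: a]addr0 glin.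
by rewrite (@semilin0 K F (fun c a => sfval c * a) (@mul1r _) n g glin) addr0.
Qed.

End Embed.

(** * Affine racks in a split class *)

Section Affine.
Local Open Scope ring_scope.
Variable F : finFieldType.

(** The homography t |-> w t + b. *)
Definition aff (w b : F) : PGL2_type F := pgl (mx2 w b 0 1).

Lemma aff_unit (w b : F) : w != 0 -> mx2 w b 0 1 \in unitmx.
Proof. by move=> w0; rewrite unitmxE unitfE det_mx2 mulr1 mulr0 subr0. Qed.

Lemma affM (w b w' b' : F) : w != 0 -> w' != 0 -> (aff w b * aff w' b')%g = aff (w * w') (b + w * b').
Proof.
move=> w0 w0'; rewrite -pglM ?aff_unit // mulmx2; congr pgl; congr mx2; ring.
Qed.

Lemma aff_inj (w b w' b' : F) : w != 0 -> w' != 0 -> aff w b = aff w' b' -> w = w' /\ b = b'.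
Proof.
move=> w0 w0' /eqP/pgl_eq => /(_ (aff_unit b w0) (aff_unit b' w0'))[k k0].
rewrite scalemx2 => /mx2_inj[-> -> _]; rewrite mulr1 => <-; by rewrite !mul1r.
Qed.

Lemma aff1 : aff 1 0 = 1%g.
Proof. by rewrite /aff -scalar_mx2 pgl1. Qed.

Lemma affV w b : w != 0 -> (aff w b)^-1%g = aff w^-1 (- (w^-1 * b)).
Proof.
move=> w0; apply: (mulgI (aff w b)); rewrite mulgV affM ?invr_eq0 // divff //.
by rewrite mulrN mulrA divff // mul1r subrr aff1.
Qed.

Lemma aff_conj w b w' b' : w != 0 -> w' != 0 ->
  conj_op (aff w b) (aff w' b') = aff w' ((1 - w') * b + w * b').
Proof.
move=> w0 w0'; rewrite /conj_op affV // !affM ?invr_eq0 ?mulf_neq0 //.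
by congr aff; [rewrite mulrAC divff ?mul1r | field].
Qed.

Lemma pgl_diagE (z : {unit F}) : pgl_diag z = aff (FinRing.uval z) 0.
Proof.
rewrite /aff (_ : mx2 _ _ _ _ = GLval (FinRing.unit _ (diag_z1_unit z) : {'GL_2[F]})).
  by rewrite pgl_coset.
by apply/matrixP => i j; rewrite !mxE; case: (ord2P i) => ->; case: (ord2P j) => ->.
Qed.

Lemma uval_neq0 (z : {unit F}) : FinRing.uval z != 0.
Proof. by rewrite -unitfE; apply: (valP z). Qed.

Lemma affX w n : w != 0 -> (aff w 0 ^+ n)%g = aff (w ^+ n) 0.
Proof.
move=> w0; elim: n => [|n IH]; first by rewrite expg0 expr0 aff1.
by rewrite expgS IH affM ?expf_neq0 // exprS mulr0 addr0.
Qed.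

Lemma uvalX (z : {unit F}) n : FinRing.uval (z ^+ n)%g = FinRing.uval z ^+ n.
Proof. by elim: n => [|n IH]; rewrite ?expg0 ?expr0 // expgS exprS /= IH. Qed.

Lemma order_pgl_diag (z : {unit F}) : #[pgl_diag z]%g = #[z]%g.
Proof.
apply/eqP; rewrite eqn_dvd !order_dvdn pgl_diagE.
have E n : (aff (FinRing.uval z) 0 ^+ n == 1)%g = (z ^+ n == 1)%g.
  rewrite affX ?uval_neq0 // -aff1; apply/eqP/eqP => [e|e].
    apply/val_inj; rewrite -[LHS]/(FinRing.uval _) uvalX.
    by have [] := aff_inj (expf_neq0 n (uval_neq0 z)) (oner_neq0 _) e.
  by rewrite -uvalX e.
by rewrite E expg_order eqxx -E expg_order eqxx.
Qed.

Section Model.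
Variables (z : {unit F}) (A : finLmodType (base_field <[z]>%G)).
Variable (phi : A -> F).
Hypotheses (phi_inj : injective phi) (phiD : forall a b, phi (a + b) = phi a + phi b).
Hypothesis phiZ : forall (c : base_field <[z]>%G) a, phi (c *: a) = sfval c * phi a.

(** An embedding of A in the field turns the semidirect product into a group of affine
    maps. *)
Definition affmap (x : sdprodq A) : PGL2_type F :=
  aff (FinRing.uval (sgval (sdsnd x))) (phi (sdfst x)).

Lemma affmapM x y : affmap (x * y)%g = (affmap x * affmap y)%g.
Proof.
case: x y => [a c] [b e]; rewrite /affmap /= affM ?uval_neq0 //.
by rewrite phiD phiZ.
Qed.

Lemma affmap_inj : injective affmap.
Proof.
move=> [a c] [b e] /aff_inj[]; rewrite ?uval_neq0 //= => /val_inj/val_inj e1 /phi_inj e2.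
by rewrite e1 e2.
Qed.

Lemma affmapV x : affmap x^-1%g = (affmap x)^-1%g.
Proof.
have e1 : affmap 1%g = 1%g by apply: (mulgI (affmap 1%g)); rewrite -affmapM !mulg1.
by apply: (mulgI (affmap x)); rewrite -affmapM !mulgV.
Qed.

Lemma affmap_isom (S : {set {unit F}}) :
  rack_isom (sdprodq_set A S) (affmap @: sdprodq_set A S).
Proof.
apply/rack_isomP; exists affmap; split=> // [x y _ _|x y _ _]; first exact: affmap_inj.
by rewrite /conj_op !affmapM affmapV.
Qed.

Lemma sdprodq_set_conj (S : {set {unit F}}) (x y : sdprodq A) :
  y \in sdprodq_set A S -> conj_op x y \in sdprodq_set A S.
Proof.
have cC : abelian <[z]>%g by apply: cycle_abelian.
have c : commute (sgval (sdsnd x)) (sgval (sdsnd y)).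
  by apply: (centsP cC); apply: subgP.
rewrite !inE; suff -> : sgval (sdsnd (conj_op x y)) = sgval (sdsnd y) by [].
transitivity (sgval (sdsnd x) * sgval (sdsnd y) * (sgval (sdsnd x))^-1)%g; first by [].
by rewrite c mulgK.
Qed.

Lemma affmap_set (S : {set {unit F}}) : S \subset <[z]>%g ->
  affmap @: sdprodq_set A S = [set aff (FinRing.uval c) (phi a) | c in S, a in setT].
Proof.
move=> sS; apply/setP => x; apply/imsetP/imset2P => [[[a c] + ->]|[c a cS _ ->]].
  by rewrite inE /= => cS; exists (sgval c) a.
have cz : c \in <[z]>%g := subsetP sS c cS.
by exists (SDpair a (subg <[z]>%G c)); rewrite ?inE /affmap /= subgK.
Qed.

Lemma has_affmap (O : {set PGL2_type F}) (S : {set {unit F}}) : S \subset <[z]>%g -> S != set0 ->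
  (forall c a, c \in S -> aff (FinRing.uval c) a \in O) ->
  has_subrack O (sdprodq_set A S).
Proof.
move=> sS /set0Pn[c cS] SO; exists (affmap @: sdprodq_set A S).
  apply/is_subrackP; split.
  - apply/set0Pn; rewrite affmap_set //; exists (aff (FinRing.uval c) (phi 0)).
    by apply/imset2P; exists c 0.
  - move=> _ _ /imsetP[x Sx ->] /imsetP[y Sy ->]; rewrite /conj_op -affmapV -!affmapM.
    by apply: imset_f; apply: sdprodq_set_conj.
  by rewrite affmap_set //; apply/subsetP => _ /imset2P[c' a cS' _ ->]; apply: SO.
apply: rack_isom_sym (affmap_isom S) => x y _ Sy; exact: sdprodq_set_conj.
Qed.

End Model.

Variables (d : F) (o : nat).
Hypotheses (d0 : d != 0) (disc : 1 - 4 * d != 0).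
Hypothesis ord : forall y, y \in pglT d -> #[y]%g = o.
Hypothesis o4 : (4 <= o)%N.

(** The translation part changes neither the trace nor the determinant. *)
Lemma aff_pglT w a b : w != 0 -> w != 1 -> aff w a \in pglT d -> aff w b \in pglT d.
Proof.
move=> w0 w1 Ta; have h : 1 - w != 0 by rewrite subr_eq0 eq_sym.
have -> : aff w b = conj_op (aff 1 ((b - a) / (1 - w))) (aff w a).
  by rewrite aff_conj ?oner_eq0 // mulrCA divff // mulr1 mul1r subrK.
exact: pglT_conj.
Qed.

Lemma aff_pglT_neq1 w a : aff w a \in pglT d -> w != 0 -> w != 1.
Proof.
move=> /imsetP[N TN e] w0; apply: contraNneq disc => w1; rewrite w1 in e.
have := pglT_uni d0 disc (imset_f (@pgl F) TN).
by rewrite -e uni_pgl ?aff_unit ?oner_eq0 // !mx2E => /eqP[]; ring.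
Qed.

(** Conjugation by affine maps preserves the multiplier, and A embeds in the field. *)
Lemma split_has_subrack (z : {unit F}) : pgl_diag z \in pglT d ->
  forall A : finLmodType (base_field <[z]>%G), (1 < #|A| <= #|F|)%N ->
    has_subrack (pglT d) (sdprodq_set A [set z]) /\
    has_subrack (pglT d) (sdprodq_set A [set z; z^-1%g]).
Proof.
rewrite pgl_diagE => Tz A /andP[_ /lmod_embed[phi [phi_inj phiD phiZ]]].
have z0 := uval_neq0 z; have z1 := aff_pglT_neq1 Tz z0.
have TzV : aff (FinRing.uval z^-1%g) 0 \in pglT d.
  by have := pglTV d0 Tz; rewrite affV // mulr0 oppr0.
have zV0 := uval_neq0 z^-1%g; have zV1 := aff_pglT_neq1 TzV zV0.
split; apply: (has_affmap phi_inj phiD phiZ).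
- by rewrite sub1set cycle_id.
- by apply/set0Pn; exists z; rewrite inE.
- by move=> c a /set1P->; apply: aff_pglT Tz.
- by rewrite subUset !sub1set groupV cycle_id.
- by apply/set0Pn; exists z; rewrite !inE eqxx.
by move=> c a /set2P[]->; [apply: aff_pglT Tz | apply: aff_pglT TzV].
Qed.

(** Scaling diag(z, 1) to trace one gives d = z / (z + 1)^2, so z is a square when d is. *)
Lemma eigenvalue_ratioP (z : {unit F}) : d \in squares F -> pgl_diag z \in pglT d ->
  eigenvalue_ratio (pglT d) o z.
Proof.
move=> /imsetP[s + sE] Tz; rewrite inE => s0; split=> //; last by rewrite -order_pgl_diag ord.
move: Tz; rewrite pgl_diagE => /imsetP[N TN /eqP/pgl_eq].
move=> /(_ (aff_unit 0 (uval_neq0 z)) (trdet_unit d0 TN))[k k0 e].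
have [_ dN] := trdetP _ _ TN; have := congr1 determinant e.
rewrite detZ dN det_mx2 mulr1 mulr0 subr0 sE -exprMn => ->.
by apply/imsetP; exists (k * s); rewrite ?inE ?mulf_neq0.
Qed.

(** The eigenvalues are r and 1 - r, and z is their ratio. *)
Lemma root_pgl_diag r : r ^+ 2 - r + d = 0 -> exists z : {unit F}, pgl_diag z \in pglT d.
Proof.
move=> hr; have rd : r * (1 - r) = d.
  by transitivity (d - (r ^+ 2 - r + d)); [ring | rewrite hr subr0].
have [r0 r1] : r != 0 /\ 1 - r != 0 by apply/andP; rewrite -negb_or -mulf_eq0 rd.
have uz : r / (1 - r) \is a GRing.unit by rewrite unitfE mulf_neq0 ?invr_eq0.
exists (FinRing.unit F uz); rewrite pgl_diagE /=; apply/imsetP.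
exists (mx2 r 0 0 (1 - r)); first by apply/trdetP; rewrite !mx2E -rd; split; ring.
rewrite /aff -(@pgl_scale _ (1 - r)) ?aff_unit ?mulf_neq0 ?invr_eq0 // scalemx2.
by rewrite mulrCA divff // !mulr1 !mulr0.
Qed.

End Affine.

(** * Subracks that fix a rational point *)

Section Sub.
Local Open Scope ring_scope.
Variable F : finFieldType.

Lemma stable_inj_onto (A : {set F}) (f : F -> F) : injective f ->
  {in A, forall a, f a \in A} -> {in A, forall a, exists2 b, b \in A & a = f b}.
Proof.
move=> f_inj fA a Aa; have /eqP e : f @: A == A.
  rewrite eqEcard card_imset // leqnn andbT; apply/subsetP => _ /imsetP[b Ab ->].
  exact: fA.
by move: Aa; rewrite -{1}e => /imsetP[b Ab ->]; exists b.
Qed.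

(** Adding a permutes the finite set; going back twice from a reaches 0 and then - a. *)
Lemma addr_closed_opp (A : {set F}) : {in A &, forall a b, a + b \in A} ->
  {in A, forall a, - a \in A}.
Proof.
move=> Ad a Aa; have fA : {in A, forall b, b + a \in A} by move=> b Ab; apply: Ad.
have [b Ab ab] := stable_inj_onto (addIr a) fA Aa.
have b0 : b = 0 by apply: (addIr a); rewrite add0r.
have [c Ac c0] := stable_inj_onto (addIr a) fA Ab.
by rewrite (_ : - a = c) //; apply: (addIr a); rewrite addNr -c0 b0.
Qed.

(** For the inverse, multiplication by a nonzero multiplier permutes the finite set A. *)
Lemma multipliers_subfield (A : {set F}) : 0 \in A -> {in A &, forall a b, a + b \in A} ->
  subfieldb [set c | [forall a in A, c * a \in A]].
Proof.
move=> A0 Ad; have AN := addr_closed_opp Ad.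
have mP c : reflect {in A, forall a, c * a \in A} (c \in [set c | [forall a in A, c * a \in A]]).
  by rewrite inE; apply: forall_inP.
apply/and3P; split.
- by apply/mP => a Aa; rewrite mul1r.
- apply/forall_inP => x /mP Ax; apply/forall_inP => y /mP Ay; apply/mP => a Aa.
  by rewrite mulrBl; apply: Ad; [apply: Ax | apply/AN/Ay].
apply/forall_inP => x /mP Ax; apply/forall_inP => y /mP Ay; apply/mP => a Aa.
have [->|y0] := eqVneq y 0; first by rewrite invr0 mulr0 mul0r.
have [b Ab ->] := stable_inj_onto (mulfI y0) Ay Aa.
by rewrite mulrA divfK //; apply: Ax.
Qed.

End Sub.

Section AffineCase.
Local Open Scope ring_scope.
Variables (F : finFieldType) (d : F) (o : nat).
Hypotheses (d0 : d != 0) (disc : 1 - 4 * d != 0) (sq : d \in squares F).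
Hypothesis ord : forall y, y \in pglT d -> #[y]%g = o.
Hypothesis o4 : (4 <= o)%N.

Definition affine_rack (X : {set PGL2_type F}) : Prop :=
  exists z : {unit F}, eigenvalue_ratio (pglT d) o z /\
  exists A : finLmodType (base_field <[z]>%G), (1 < #|A| <= #|F|)%N /\
      (rack_isom X (sdprodq_set A [set z]) \/ rack_isom X (sdprodq_set A [set z; z^-1%g])).

(** Once one element is diag(z, 1), the translation parts of the elements over z form a
    subspace, and those over z^-1 are either none or the same subspace. *)
Lemma affine_norm (X : {set PGL2_type F}) (z : {unit F}) :
  {in X &, forall x y, conj_op x y \in X} -> X \subset pglT d ->
  (forall x, x \in X -> exists b, x = aff (FinRing.uval z) b \/ x = aff (FinRing.uval z)^-1 b) ->
  aff (FinRing.uval z) 0 \in X -> (exists x y, [/\ x \in X, y \in X & ~ commute x y]) ->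
  affine_rack X.
Proof.
set w := FinRing.uval z => Xc sX XE Xz nc.
have w0 : w != 0 := uval_neq0 z.
have Tz : aff w 0 \in pglT d := subsetP sX _ Xz.
have w1 : 1 - w != 0 by rewrite subr_eq0 eq_sym; apply: aff_pglT_neq1 Tz w0.
have wV0 : w^-1 != 0 by rewrite invr_eq0.
have wV1 : 1 - w^-1 != 0.
  by apply: contraNneq w1 => h; apply/eqP; transitivity (- w * (1 - w^-1)); [field | rewrite h mulr0].
have wwV : w != w^-1.
  by apply: contraNneq (pglT_neqV d0 disc ord o4 Tz) => e; rewrite affV // mulr0 oppr0 -e.
pose A := [set a | aff w a \in X]; pose A' := [set a | aff w^-1 a \in X].
have A0 : 0 \in A by rewrite inE.
have AA a b : a \in A -> b \in A -> (1 - w) * a + w * b \in A.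
  by rewrite !inE => Aa Ab; have := Xc _ _ Aa Ab; rewrite aff_conj.
have AA' a b : a \in A -> b \in A' -> (1 - w^-1) * a + w * b \in A'.
  by rewrite !inE => Aa Ab; have := Xc _ _ Aa Ab; rewrite aff_conj.
have A'A a b : a \in A' -> b \in A -> (1 - w) * a + w^-1 * b \in A.
  by rewrite !inE => Aa Ab; have := Xc _ _ Aa Ab; rewrite aff_conj.
have Aw : {in A, forall a, w * a \in A} by move=> a Aa; have := AA _ _ A0 Aa; rewrite mulr0 add0r.
have Aw1 : {in A, forall a, (1 - w) * a \in A} by move=> a Aa; have := AA _ _ Aa A0; rewrite mulr0 addr0.
have Ad : {in A &, forall a b, a + b \in A}.
  move=> a b Aa Ab; have [a' Aa' ->] := stable_inj_onto (mulfI w1) Aw1 Aa.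
  have [b' Ab' ->] := stable_inj_onto (mulfI w0) Aw Ab; exact: AA.
have AN := addr_closed_opp Ad.
have mS := multipliers_subfield A0 Ad.
have AM (c : F) : in_subfield (base_field <[z]>%G) c -> {in A, forall a, c * a \in A}.
  move=> /bigcapP/(_ [set c | [forall a in A, c * a \in A]]); rewrite mS /=.
  suff -> : units_val <[z]>%G \subset [set c | [forall a in A, c * a \in A]].
    by move=> /(_ isT); rewrite inE => /forall_inP.
  apply/subsetP => _ /imsetP[_ /cycleP[i ->] ->]; rewrite inE uvalX; apply/forall_inP => a Aa.
  by elim: i => [|i IH]; rewrite ?expr0 ?mul1r // exprS -mulrA; apply: Aw.
have [n [phi [phi_inj phiA phiD phiZ]]] := @subspace_lmod F (base_field <[z]>%G) A A0
  (fun c a b Aa Ab => Ad _ _ (AM _ (valP c) a Aa) Ab).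
have phiE a : (a \in A) = (a \in phi @: setT) by rewrite phiA.
have A'sub a : a \in A' -> A' = A.
  have sub b : b \in A' -> b \in A.
    move=> A'b; have := A'A _ _ A'b A0; rewrite mulr0 addr0 => Ab'.
    have [c Ac e] := stable_inj_onto (mulfI w1) Aw1 Ab'; by rewrite (mulfI w1 e).
  move=> A'a; apply/eqP; rewrite eqEsubset; apply/andP; split; apply/subsetP => b; first exact: sub.
  move=> Ab; have wV1A : {in A, forall a, (1 - w^-1) * a \in A}.
    move=> c Ac; have [c' Ac' ->] := stable_inj_onto (mulfI w0) Aw Ac.
    have -> : (1 - w^-1) * (w * c') = - ((1 - w) * c') by field.
    exact/AN/Aw1.
  have Abwa : b - w * a \in A by apply: Ad => //; apply/AN/Aw/sub.
  have [c Ac e] := stable_inj_onto (mulfI wV1) wV1A Abwa.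
  by rewrite -[b](subrK (w * a)) e; apply: AA'.
exists z; split; first by apply: eigenvalue_ratioP => //; rewrite pgl_diagE.
have iso (S : {set {unit F}}) : S \subset <[z]>%g ->
    X = [set aff (FinRing.uval c) (phi a) | c in S, a in setT] ->
    rack_isom X (sdprodq_set ('rV[base_field <[z]>%G]_n : finLmodType (base_field <[z]>%G)) S).
  move=> sS XS; rewrite XS -(affmap_set phi sS).
  apply: rack_isom_sym (affmap_isom phi_inj phiD phiZ S) => x y _; exact: sdprodq_set_conj.
exists ('rV[base_field <[z]>%G]_n : finLmodType _); split.
  have cA : #|{: 'rV[base_field <[z]>%G]_n}| = #|A| by rewrite -phiA card_imset ?cardsT.
  rewrite cA max_card andbT; apply: contraT; rewrite -leqNgt => A1.
  have [x [y [Xx Xy nxy]]] := nc.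
  have A_0 a : a \in A -> a = 0.
    by move=> Aa; apply/eqP; move/card_le1_eqP: A1 => /(_ _ _ Aa A0) ->.
  have dg u : u \in X -> u = aff w 0 \/ u = aff w^-1 0.
    move=> Xu; case: (XE u Xu) => b [|] uE; rewrite uE in Xu *.
      by left; rewrite (A_0 b) // inE.
    right; have A'b : b \in A' by rewrite inE.
    by rewrite (A_0 b) // -(A'sub b A'b).
  case: nxy; rewrite /commute.
  by case: (dg x Xx) => ->; case: (dg y Xy) => ->; rewrite !affM // mulrC !mulr0.
have [A'0|/set0Pn[a A'a]] := eqVneq A' set0; [left | right]; apply: iso.
- by rewrite sub1set cycle_id.
- apply/setP => x; apply/idP/imset2P => [Xx|[c a /set1P-> _ ->]].
    case: (XE x Xx) => b [|] xE; rewrite xE in Xx *.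
      have : b \in phi @: setT by rewrite -phiE inE.
      by case/imsetP => a _ ->; exists z a; rewrite ?inE.
    have : b \in A' by rewrite inE.
    by rewrite A'0 inE.
  have : phi a \in A by rewrite phiE imset_f.
  by rewrite inE.
- by rewrite subUset !sub1set groupV cycle_id.
have A'E := A'sub a A'a.
apply/setP => x; apply/idP/imset2P => [Xx|[c b cS _ ->]].
  case: (XE x Xx) => b [|] xE; rewrite xE in Xx *.
    have : b \in phi @: setT by rewrite -phiE inE.
    by case/imsetP => u _ ->; exists z u; rewrite ?inE ?eqxx.
  have : b \in phi @: setT by rewrite -phiE -A'E inE.
  by case/imsetP => u _ ->; exists z^-1%g u; rewrite ?inE ?eqxx ?orbT.
have Ab : phi b \in A by rewrite phiE imset_f.
by case/set2P: cS => ->; [move: Ab | move: Ab; rewrite -A'E]; rewrite inE.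
Qed.

Lemma affine_rack_conj (X : {set PGL2_type F}) g :
  affine_rack [set conj_op g x | x in X] -> affine_rack X.
Proof.
case=> z [ez [A [cA iso]]]; exists z; split=> //; exists A; split=> //.
by case: iso => iso; [left | right]; apply: rack_isom_trans (rack_isom_conj X g) iso.
Qed.

Lemma conj_set_closed (gT : finGroupType) (X : {set gT}) g :
  {in X &, forall x y, conj_op x y \in X} ->
  {in [set conj_op g x | x in X] &, forall x y, conj_op x y \in [set conj_op g x | x in X]}.
Proof.
move=> Xc _ _ /imsetP[x Xx ->] /imsetP[y Xy ->].
by apply/imsetP; exists (conj_op x y); [apply: Xc | rewrite [RHS]conj_distr].
Qed.

Lemma conj_set_noncomm (gT : finGroupType) (X : {set gT}) g :
  (exists x y, [/\ x \in X, y \in X & ~ commute x y]) ->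
  exists x y, [/\ x \in [set conj_op g x | x in X], y \in [set conj_op g x | x in X] & ~ commute x y].
Proof.
case=> x [y [Xx Xy nc]]; exists (conj_op g x), (conj_op g y).
split; [exact: imset_f | exact: imset_f | move=> c; apply: nc].
apply/conj_op_comm; apply: (@conj_op_inj _ g).
by rewrite [LHS]conj_distr; apply/conj_op_comm.
Qed.

Lemma conj_set_pglT (X : {set PGL2_type F}) g : X \subset pglT d ->
  [set conj_op g x | x in X] \subset pglT d.
Proof.
move=> sX; apply/subsetP => _ /imsetP[x Xx ->].
by apply: pglT_conj => //; apply: (subsetP sX).
Qed.

Let flact := lact (idfun : {rmorphism F -> F}).

(** A translation moves the other fixed point of one element to 0. The multipliers of the
    elements are z and z^-1 since they are the ratios of the two roots of x^2 - x + d. *)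
Lemma affine_inf (X : {set PGL2_type F}) :
  {in X &, forall x y, conj_op x y \in X} -> X \subset pglT d ->
  (forall x, x \in X -> flact x None = None) ->
  (exists x y, [/\ x \in X, y \in X & ~ commute x y]) -> affine_rack X.
Proof.
move=> Xc sX XI nc.
have form x : x \in X -> exists a b, [/\ a * (1 - a) = d, a != 0, 1 - a != 0 & x = aff (a / (1 - a)) b].
  move=> Xx; have /imsetP[N TN xN] := subsetP sX x Xx.
  have uN := trdet_unit d0 TN; have := XI x Xx; rewrite xN.
  move: TN uN; have [a [b [c [e ->]]]] := mx2P N => TN uN /lact_fixP-/(_ uN) /= c0.
  rewrite c0 in TN uN *; have [] := trdetP _ _ TN; rewrite !mx2E mulr0 subr0 => te de.
  have eE : e = 1 - a by rewrite -te addrC addKr.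
  rewrite eE in uN de *.
  have [a0 a1] : a != 0 /\ 1 - a != 0 by apply/andP; rewrite -negb_or -mulf_eq0 de.
  exists a, (b / (1 - a)); split=> //.
  rewrite /aff -[RHS](@pgl_scale _ (1 - a)) ?aff_unit ?mulf_neq0 ?invr_eq0 // scalemx2.
  by rewrite mulr0 mulr1 mulrCA divff // mulr1 mulrCA divff // mulr1.
have [x0 [_ [Xx0 _ _]]] := nc.
have [a [b [ad a0 a1 x0E]]] := form x0 Xx0.
set w := a / (1 - a) in x0E.
have w0 : w != 0 by rewrite mulf_neq0 ?invr_eq0.
have uw : w \is a GRing.unit by rewrite unitfE.
have Tx0 : aff w b \in pglT d by rewrite -x0E; apply: (subsetP sX).
have w1 : 1 - w != 0 by rewrite subr_eq0 eq_sym; apply: aff_pglT_neq1 Tx0 w0.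
pose g := aff 1 (- b / (1 - w)).
have gE u c : u != 0 -> conj_op g (aff u c) = aff u ((1 - u) * (- b / (1 - w)) + c).
  by move=> u0; rewrite aff_conj ?oner_eq0 // mul1r.
apply: (@affine_rack_conj _ g).
apply: (@affine_norm _ (FinRing.unit F uw)); rewrite /=.
- exact: conj_set_closed.
- exact: conj_set_pglT.
- move=> _ /imsetP[x Xx ->]; have [a' [b' [ad' a0' a1' ->]]] := form x Xx.
  have w0' : a' / (1 - a') != 0 by rewrite mulf_neq0 ?invr_eq0.
  rewrite gE //; eexists.
  have : (a' - a) * (a' - (1 - a)) == 0.
    by apply/eqP; transitivity (a * (1 - a) - a' * (1 - a')); [ring | rewrite ad ad' subrr].
  rewrite mulf_eq0 !subr_eq0 => /orP[|] /eqP a'E; [left | right].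
    by rewrite [X in aff (X / (1 - X))]a'E; reflexivity.
  rewrite a'E /w; congr aff.
  by field; rewrite a0 a1.
- apply/imsetP; exists x0 => //; rewrite x0E gE // mulrCA divff //.
  by rewrite mulr1 addNr.
exact: conj_set_noncomm.
Qed.

Lemma flact_inf z0 : exists g, flact g None = z0.
Proof.
case: z0 => [t|]; last by exists 1%g; rewrite /flact lact1.
have u : mx2 t 1 1 0 \in unitmx by rewrite unitmxE unitfE det_mx2 mulr0 mulr1 sub0r oppr_eq0 oner_eq0.
exists (pgl (mx2 t 1 1 0)); rewrite /flact lact_pgl // map_mx2 /mob ap_mx2 /pt /=.
by rewrite !mulr1 !mulr0 !addr0 oner_eq0 divr1.
Qed.

Lemma affine_case (X : {set PGL2_type F}) (z0 : option F) :
  {in X &, forall x y, conj_op x y \in X} -> X \subset pglT d ->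
  (forall x, x \in X -> flact x z0 = z0) ->
  (exists x y, [/\ x \in X, y \in X & ~ commute x y]) -> affine_rack X.
Proof.
move=> Xc sX Xz nc; have [g gz] := flact_inf z0.
apply: (@affine_rack_conj _ g^-1%g); apply: affine_inf.
- exact: conj_set_closed.
- exact: conj_set_pglT.
- move=> _ /imsetP[x Xx ->]; rewrite /flact /conj_op invgK !lactM -/flact gz Xz //.
  by rewrite -gz /flact lactK.
exact: conj_set_noncomm.
Qed.

End AffineCase.

(** * Classes over subfields *)

Section SubfieldRack.
Local Open Scope ring_scope.
Variables (F : finFieldType) (K : subfield F).

Definition sfm : {rmorphism K -> F} := (val : K -> F).
Lemma sfmE (c : K) : sfm c = sfval c. Proof. by []. Qed.

Definition embM (N : 'M[K]_2) : 'M[F]_2 := map_mx sfm N.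

Lemma embM_trdet (e : K) N : (embM N \in trdet (sfval e)) = (N \in trdet e).
Proof.
rewrite !inE /embM trace_map_mx det_map_mx -(rmorph1 sfm) -sfmE.
by rewrite !(inj_eq (fmorph_inj sfm)).
Qed.

Variable e : K.
Hypotheses (e0 : e != 0).

Definition subT : {set PGL2_type F} := [set pgl (embM N) | N in trdet e].

Lemma sfval_neq0 : sfval e != 0.
Proof. by rewrite -sfmE fmorph_eq0. Qed.

Lemma sfval_disc : (1 - 4 * sfval e != 0) = (1 - 4 * e != 0).
Proof. by rewrite -(fmorph_eq0 sfm) rmorphB rmorphM rmorph1 rmorph_nat. Qed.

Lemma subT_sub : subT \subset pglT (sfval e).
Proof.
by apply/subsetP => _ /imsetP[N TN ->]; apply/imset_f; rewrite embM_trdet.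
Qed.

Lemma embM_conj N M : N \in trdet e -> M \in trdet e ->
  conj_op (pgl (embM N)) (pgl (embM M)) = pgl (embM (N *m M *m invmx N)).
Proof.
move=> TN TM; rewrite -(pgl_trdet_conj sfval_neq0) ?embM_trdet //.
by rewrite /embM !map_mxM map_invmx.
Qed.

Lemma subT_conj : {in subT &, forall x y, conj_op x y \in subT}.
Proof.
move=> _ _ /imsetP[N TN ->] /imsetP[M TM ->]; rewrite embM_conj //.
by apply/imset_f/trdet_conj => //; apply: trdet_unit TN.
Qed.

(** The representative of trace one inverts the map on classes. *)
Lemma subT_isom : rack_isom subT (pglT e).
Proof.
have Tc : {in pglT e &, forall x y, conj_op x y \in pglT e} by move=> x y _; apply: pglT_conj.
apply: (rack_isom_sym Tc); apply/rack_isomP; exists (fun x => pgl (embM (lift1 x))); split.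
- move=> _ _ /imsetP[N TN ->] /imsetP[M TM ->]; rewrite !(lift1_pgl e0) // => h.
  congr pgl; apply: (@map_mx_inj _ _ sfm).
  by apply: (pgl_trdet_inj sfval_neq0) h; rewrite -/(embM _) embM_trdet.
- rewrite /subT -imset_comp; apply: eq_in_imset => N TN /=.
  by rewrite (lift1_pgl e0).
move=> _ _ /imsetP[N TN ->] /imsetP[M TM ->].
rewrite !(lift1_pgl e0) // embM_conj // -(pgl_trdet_conj e0) //.
by rewrite (lift1_pgl e0) // trdet_conj // (trdet_unit e0 TN).
Qed.

End SubfieldRack.

Section Transitive.
Local Open Scope ring_scope.
Variable F : finFieldType.
Let flact := lact (idfun : {rmorphism F -> F}).

Definition det2 (u v : F * F) : F := u.1 * v.2 - u.2 * v.1.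

Lemma det2_eq0 z z' : det2 (vec z) (vec z') = 0 -> z = z'.
Proof.
have one0 : (1 : F) = 0 -> False by apply/eqP/oner_neq0.
case: z z' => [t|] [t'|] //; rewrite /det2 /= => h.
- by congr Some; apply/eqP; rewrite -subr_eq0 -h; apply/eqP; ring.
- by case: one0; rewrite -oppr0 -h; ring.
by case: one0; rewrite -h; ring.
Qed.

(** The columns of the matrix are vectors on the lines z0 and z1, scaled so that their sum
    lies on the line z2. *)
Lemma flact_triple z0 z1 z2 : z0 != z1 -> z0 != z2 -> z1 != z2 ->
  exists g, [/\ flact g None = z0, flact g (Some 0) = z1 & flact g (Some 1) = z2].
Proof.
move=> d01 d02 d12; pose v i := vec i : F * F.
have D x y : x != y -> det2 (v x) (v y) != 0 by apply: contra_neq; apply: det2_eq0.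
have D01 := D _ _ d01; have D21 := D z2 z1; have D02 := D _ _ d02.
rewrite eq_sym in d12; have {}D21 := D21 d12.
pose a := det2 (v z2) (v z1) / det2 (v z0) (v z1); pose b := det2 (v z0) (v z2) / det2 (v z0) (v z1).
have a0 : a != 0 by rewrite mulf_neq0 ?invr_eq0.
have b0 : b != 0 by rewrite mulf_neq0 ?invr_eq0.
pose M := mx2 (a * (v z0).1) (b * (v z1).1) (a * (v z0).2) (b * (v z1).2).
have uM : M \in unitmx.
  rewrite unitmxE unitfE det_mx2.
  have -> : a * (v z0).1 * (b * (v z1).2) - b * (v z1).1 * (a * (v z0).2) = a * b * det2 (v z0) (v z1).
    by rewrite /det2; ring.
  by apply: mulf_neq0 => //; apply: mulf_neq0.
exists (pgl M); rewrite /flact !lact_pgl // !map_mx2 /mob !ap_mx2 /=.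
split.
- rewrite !mulr0 !addr0 !mulr1 -[(_, _)]/(scl a (vec z0)) pt_scl // ptK //.
- rewrite !mulr0 !add0r !mulr1 -[(_, _)]/(scl b (vec z1)) pt_scl // ptK //.
rewrite !mulr1.
have -> : (a * (v z0).1 + b * (v z1).1, a * (v z0).2 + b * (v z1).2) = vec z2.
  rewrite [RHS]surjective_pairing -/(v z2); congr (_, _); apply: (mulfI D01).
    transitivity (det2 (v z2) (v z1) * (v z0).1 + det2 (v z0) (v z2) * (v z1).1).
      by rewrite /a /b; field.
    by rewrite /det2; ring.
  transitivity (det2 (v z2) (v z1) * (v z0).2 + det2 (v z0) (v z2) * (v z1).2).
    by rewrite /a /b; field.
  by rewrite /det2; ring.
by rewrite ptK.
Qed.

End Transitive.

(** * Recovering a subfield from an orbit *)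

(** The generic element of SL(2) as a product of three elementary matrices. *)
Lemma sl2_ulu (R : fieldType) (a b c e : R) : (c != 0 -> a * e - b * c = 1 ->
  mx2 a b c e = mx2 1 ((a - 1) / c) 0 1 *m mx2 1 0 c 1 *m mx2 1 ((e - 1) / c) 0 1)%R.
Proof.
move=> c0 D; rewrite !mulmx2; congr mx2; try by field.
have -> : (b = (a * e - 1) / c)%R by rewrite -D; field.
by field.
Qed.

Section Big.
Local Open Scope ring_scope.
Variables (F E : finFieldType) (iota : {rmorphism F -> E}).
Variable H : {group PGL2_type F}.
Local Notation lact := (lact iota).
Local Notation pact := (proj_act iota).
Notation stab z := ('C_H[z | pact])%g.
Notation urad z := (unirad pact H (@uni F) z).
Notation w := (orbit pact H None)%g.

Variable q : nat.
Hypotheses (qE : #|urad None| = q) (q3 : (2 < q)%N) (wE : #|w| = q.+1).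
Hypothesis q_dvd : (q.-1 * q %| 2 * #|stab None|)%N.
Hypotheses (w0 : Some (iota 0) \in w) (w1 : Some (iota 1) \in w).

Lemma lact_w g z : g \in H -> z \in w -> lact g z \in w.
Proof.
move=> Hg wz; have := orbit_actr pact None z (groupVr Hg).
by rewrite proj_actE invgK wz.
Qed.

Lemma lact_fixV g z : lact g z = z -> lact g^-1%g z = z.
Proof. by move=> e; rewrite -{1}e lactK. Qed.

Lemma lact_aff a b z : a != 0 ->
  lact (aff a b) z = omap (fun t => iota a * t + iota b) z.
Proof.
move=> a0; rewrite /aff lact_pgl ?aff_unit // map_mx2 /mob ap_mx2 /pt; case: z => [t|] /=.
  by rewrite rmorph0 rmorph1 mul0r add0r mulr1 oner_eq0 divr1 mulr1.
by rewrite rmorph0 rmorph1 mul0r mulr0 addr0 eqxx.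
Qed.

(** The translations in H. The orbit of infinity has the size of a projective line over a
    field with q elements, and that field is to be recovered from the translations. *)
Definition trans : {set F} := [set a | aff 1 a \in H].

Lemma trans0 : 0 \in trans. Proof. by rewrite inE aff1 group1. Qed.

Lemma transD : {in trans &, forall a b, a + b \in trans}.
Proof.
by move=> a b; rewrite !inE => Ha /(groupM Ha); rewrite affM ?oner_eq0 // !mul1r.
Qed.

Lemma lact_trans a z : lact (aff 1%R a) (Some z) = Some (z + iota a).
Proof. by rewrite lact_aff ?oner_eq0 //= rmorph1 mul1r. Qed.

Lemma uni_inf g : lact g None = None -> uni g -> exists x, g = aff 1%R x.
Proof.
have uM := unit_pglmx g; rewrite -{1 2 3}[g]pglmxK => gz ug.
move: gz ug uM; have [a [b [c [e ->]]]] := mx2P (pglmx g) => gz ug uM.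
move/lact_fixP: gz => /(_ uM) /= /eqP; rewrite fmorph_eq0 => /eqP c0.
rewrite uni_pgl // !mx2E c0 mulr0 subr0 in ug.
have ae : a = e.
  apply/eqP; rewrite -subr_eq0 -sqrf_eq0; apply/eqP.
  by transitivity ((a + e) ^+ 2 - 4 * (a * e)); [ring | rewrite (eqP ug) subrr].
have e0 : e != 0.
  by move: uM; rewrite unitmxE unitfE det_mx2 ae c0 mulr0 subr0 mulf_eq0 orbb.
exists (b / e).
rewrite /aff -[RHS](@pgl_scale _ e) ?aff_unit ?oner_eq0 // scalemx2 ae c0 !mulr1 mulr0.
by rewrite mulrC divfK.
Qed.

Lemma urad_inf : urad None = [set aff 1%R a | a in trans].
Proof.
apply/setP => g; apply/idP/imsetP => [/mem_unirad[Hg gz ug]|[a + ->]]; last first.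
  rewrite inE => Ha; apply/mem_unirad; split=> //; first by rewrite lact_aff ?oner_eq0.
  by rewrite uni_pgl ?aff_unit ?oner_eq0 // !mx2E; apply/eqP; ring.
by have [x gE] := uni_inf gz ug; exists x; rewrite // inE -gE.
Qed.

Lemma card_trans : #|trans| = q.
Proof.
rewrite -qE urad_inf card_imset // => a b /aff_inj[]; by rewrite ?oner_eq0.
Qed.

Lemma w_trans : w = None |: [set Some (iota a) | a in trans].
Proof.
have inj : injective (fun a => Some (iota a)) by move=> a b [] /fmorph_inj.
apply/esym/eqP; rewrite eqEcard wE cardsU1 (card_imset _ inj) card_trans.
rewrite (_ : None \notin _) ?add1n ?leqnn ?andbT; last by apply/imsetP => -[].
apply/subsetP => z /setU1P[->|/imsetP[a + ->]]; first exact: orbit_refl.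
rewrite inE => Ha; have := lact_w Ha w0.
by rewrite lact_trans -rmorphD add0r.
Qed.

Lemma some_w a : (Some (iota a) \in w) = (a \in trans).
Proof.
rewrite w_trans in_setU1 /=; apply/imsetP/idP => [[b Tb e]|Ta]; last by exists a.
by case: e => /fmorph_inj->.
Qed.

Lemma w_some z : z \in w -> z <> None -> exists2 a, a \in trans & z = Some (iota a).
Proof. by rewrite w_trans => /setU1P[->|/imsetP[a Ta ->]] // _; exists a. Qed.

Lemma multK_subproof : subfieldb [set c | [forall a in trans, c * a \in trans]].
Proof. exact: multipliers_subfield trans0 transD. Qed.

Definition multK : subfield F := Subfield multK_subproof.

Lemma multKP c : reflect {in trans, forall a, c * a \in trans} (in_subfield multK c).
Proof. by rewrite /in_subfield /= inE; apply: forall_inP. Qed.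

Lemma multK_trans c : in_subfield multK c -> c \in trans.
Proof.
have T1 : 1 \in trans by rewrite -some_w.
by move/multKP/(_ 1 T1); rewrite mulr1.
Qed.

Definition dilat : {set F} := [set m | (m != 0) && (aff m 0 \in H)].

Lemma dilat_multK m : m \in dilat -> in_subfield multK m.
Proof.
rewrite inE => /andP[m0 Hm]; apply/multKP => a; rewrite -!some_w => wa.
by have := lact_w Hm wa; rewrite lact_aff //= rmorph0 addr0 -rmorphM.
Qed.

Lemma aff_of_fix g : lact g None = None -> lact g (Some (iota 0)) = Some (iota 0) ->
  exists2 m, m != 0 & g = aff m 0.
Proof.
have uM := unit_pglmx g; rewrite -{1 2 3}[g]pglmxK.
move: uM; have [a [b [c [e ->]]]] := mx2P (pglmx g) => uM.
move/lact_fixP => /(_ uM) /= /eqP; rewrite fmorph_eq0 => /eqP c0.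
move/lact_fixP => /(_ uM) /=; rewrite rmorph0 expr0n !mulr0 addr0 => /esym/eqP.
rewrite fmorph_eq0 => /eqP b0.
have ae0 : a * e != 0 by move: uM; rewrite unitmxE unitfE det_mx2 b0 mul0r subr0.
have [a0 e0] : a != 0 /\ e != 0 by apply/andP; rewrite -negb_or -mulf_eq0.
exists (a / e); first by rewrite mulf_neq0 ?invr_eq0.
rewrite /aff -[RHS](@pgl_scale _ e) ?aff_unit ?mulf_neq0 ?invr_eq0 // scalemx2 b0 c0.
by rewrite mulr1 !mulr0 mulrC divfK.
Qed.

Lemma stab_inf_le : (#|stab None| <= q * #|dilat|)%N.
Proof.
rewrite -card_trans -cardsX -(card_in_imset (f := fun p : F * F => (aff 1%R p.1 * aff p.2 0%R)%g)).
  apply/subset_leq_card/subsetP => g /mem_stab[Hg gN].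
  have g0 : lact g (Some (iota 0)) <> None by rewrite -[RHS]gN => /lact_inj.
  have [a Ta ga] := w_some (lact_w Hg w0) g0.
  have HU : aff 1%R a \in H by move: Ta; rewrite inE.
  have UN : lact (aff 1%R a)^-1%g None = None.
    by apply: lact_fixV; rewrite lact_aff ?oner_eq0.
  have [||m m0 mE] := @aff_of_fix ((aff 1%R a)^-1 * g)%g.
  - by rewrite lactM gN UN.
  - by rewrite lactM ga -[iota a]add0r -(rmorph0 iota) -lact_trans lactK.
  apply/imsetP; exists (a, m) => /=; last by rewrite -mE mulKVg.
  by rewrite in_setX Ta inE m0 -mE groupM ?groupV.
move=> [a m] [b n] /setXP[_ /= +] /setXP[_ /= +]; rewrite !inE => /andP[m0 _] /andP[n0 _].
rewrite !affM ?oner_eq0 // !mul1r !addr0 => /aff_inj[] // -> ->; exact: erefl.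
Qed.

(** At least (q - 1) / 2 elements of H are dilations, so the field K of multipliers has more
    than (q - 1) / 2 elements; a translation v outside K would give the translations K + K v,
    whose number is the square of the order of K and exceeds q. *)
Lemma trans_multK : trans = subfield_set multK.
Proof.
have sK : subfield_set multK \subset trans by apply/subsetP => c /multK_trans.
apply/eqP; rewrite eq_sym eqEsubset sK /=; apply/subsetP => v Tv; apply: contraT => vK.
have dK : (#|dilat| < #|subfield_set multK|)%N.
  have K0 : 0 \in subfield_set multK.
    by apply: (introT (multKP 0)) => a _; rewrite mul0r trans0.
  rewrite (cardsD1 0 (subfield_set _)) K0 ltnS.
  apply/subset_leq_card/subsetP => m dm; rewrite in_setD1.
  by rewrite [m \in _](dilat_multK dm) andbT; move: dm; rewrite inE => /andP[].
have KK : (#|subfield_set multK| * #|subfield_set multK| <= q)%N.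
  rewrite -card_trans -cardsX -(card_in_imset (f := fun p : F * F => p.1 + p.2 * v)).
    apply/subset_leq_card/subsetP => _ /imsetP[[x y] /setXP[/= Kx Ky] ->].
    apply: transD; first exact: multK_trans.
    by have /multKP := Ky; apply.
  move=> [x y] [x' y'] /setXP[/= Kx Ky] /setXP[/= Kx' Ky'] e.
  have e' : (y - y') * v = x' - x.
    by apply/eqP; rewrite -subr_eq0; apply/eqP; transitivity ((x + y * v) - (x' + y' * v));
       [ring | rewrite e subrr].
  have [yy|yy] := eqVneq y y'.
    by move: e; rewrite yy => /addIr->.
  case/negP: vK; have -> : v = (x' - x) / (y - y').
    by rewrite -e' mulrC mulrA mulVf ?mul1r // subr_eq0.
  by apply: (rpred_div (S := in_subfield multK)); apply: rpredB.
have le : (q.-1 <= 2 * #|dilat|)%N.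
  have n0 : (0 < 2 * #|stab None|)%N by rewrite muln_gt0 cardG_gt0.
  have := dvdn_leq n0 q_dvd; have := stab_inf_le.
  have q0 : (0 < q)%N by apply: ltn_trans q3.
  move=> l1 l2; rewrite -(leq_pmul2r q0); apply: leq_trans l2 _.
  by rewrite -mulnA leq_mul2l mulnC l1 orbT.
by move: dK KK le q3; move: #|dilat| #|subfield_set multK|; clear; nia.
Qed.

Lemma card_multK : #|multK| = q.
Proof. by rewrite -card_trans trans_multK card_sub; apply: eq_card => x; rewrite inE. Qed.

Lemma inK x : (x \in in_subfield multK) = (x \in trans).
Proof. by rewrite trans_multK. Qed.

Lemma w_images a b c e : mx2 a b c e \in unitmx -> pgl (mx2 a b c e) \in H ->
  [/\ c != 0 -> a / c \in trans, e != 0 -> b / e \in trans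
    & c + e != 0 -> (a + b) / (c + e) \in trans].
Proof.
move=> uM HM.
have img z : omap iota z \in w -> omap iota (mob (mx2 a b c e) z) \in w.
  by move=> wz; rewrite -lact_rat //; apply: lact_w.
split=> nz.
- have := img None (orbit_refl _ _ _).
  by rewrite /mob ap_mx2 /pt /= !mulr1 !mulr0 !addr0 (negPf nz) /= some_w.
- have := img (Some 0) w0.
  by rewrite /mob ap_mx2 /pt /= !mulr1 !mulr0 !add0r (negPf nz) /= some_w.
have := img (Some 1) w1.
by rewrite /mob ap_mx2 /pt /= !mulr1 (negPf nz) /= some_w.
Qed.

(** The images of 0, 1 and infinity under the matrix and its inverse are infinite or in K;
    as the trace is 1, this puts the entries themselves in K. *)
Lemma trdet_entries d a b c e : d != 0 -> mx2 a b c e \in trdet d ->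
  pgl (mx2 a b c e) \in H -> [/\ a \in trans, b \in trans, c \in trans & e \in trans].
Proof.
move=> d0 TM HM; have uM := trdet_unit d0 TM.
have [tM dM] := trdetP _ _ TM.
have {}tM : a + e = 1 by rewrite -tM tr_mx2.
have {}dM : a * e - b * c != 0 by rewrite -det_mx2 dM.
have eE : e = 1 - a by rewrite -tM addrC addKr.
have HV : pgl (mx2 e (- b) (- c) a) \in H.
  rewrite (_ : mx2 _ _ _ _ = 1%:M - mx2 a b c e) -?(pgl_trdetV d0 TM) ?groupV //.
  by rewrite scalar_mx2 oppmx2 addmx2 !sub0r; congr mx2; rewrite eE ?subKr.
have uV : mx2 e (- b) (- c) a \in unitmx.
  by rewrite unitmxE unitfE det_mx2 mulrNN mulrC.
have [ac be abce] := w_images uM HM; have [ec ba _] := w_images uV HV.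
have K1 : 1 \in trans by rewrite -inK rpred1.
have KD x y : x \in trans -> y \in trans -> x + y \in trans by apply: transD.
have KV x : x^-1 \in trans -> x \in trans.
  by rewrite -!inK => h; rewrite -[x]invrK rpredV.
have KM x y : x \in trans -> y \in trans -> x * y \in trans.
  by rewrite -!inK; apply: rpredM.
have KN x : - x \in trans -> x \in trans by rewrite -!inK rpredN.
have [c0|c0] := eqVneq c 0.
  have /andP[a0 e0] : (a != 0) && (e != 0).
    by rewrite -negb_or -mulf_eq0; move: dM; rewrite c0 mulr0 subr0.
  have Kbe := be e0; rewrite c0 add0r in abce; have Kabe := abce e0.
  have Ke : e \in trans.
    apply: (KV); have -> : e^-1 = (a + b) / e - b / e + 1.
      rewrite -mulrBl addrK -[1](divff e0) -mulrDl tM mul1r //.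
    apply: (KD) => //; apply: (KD) => //; apply: (KN); rewrite opprK //.
  have Ka : a \in trans.
    by have -> : a = 1 + - e; [rewrite -tM addrK | apply: (KD) => //; apply: (KN); rewrite opprK].
  split=> //; last by rewrite c0 trans0.
  by rewrite -(divfK e0 b); apply: (KM).
have Kac := ac c0; rewrite oppr_eq0 in ec; have Kec := ec c0.
rewrite invrN mulrN in Kec; have {}Kec := KN _ Kec.
have Kc : c \in trans by apply: (KV); rewrite -[c^-1]mul1r -tM mulrDl; apply: (KD).
have Ka : a \in trans by rewrite -(divfK c0 a); apply: (KM).
have Ke : e \in trans by rewrite -(divfK c0 e); apply: (KM).
split=> //.
have [e0|e0] := eqVneq e 0; last by rewrite -(divfK e0 b); apply: (KM) => //; apply: (be).
have a0 : a != 0 by move: tM; rewrite e0 addr0 => ->; apply: oner_neq0.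
by have := ba a0; rewrite mulNr => /KN h; rewrite -(divfK a0 b); apply: (KM).
Qed.

Definition low (c : F) : PGL2_type F := pgl (mx2 1 0 c 1).

Lemma low_unit (c : F) : mx2 1 0 c 1 \in unitmx.
Proof. by rewrite unitmxE unitfE det_mx2 mulr1 mul0r subr0 oner_neq0. Qed.

(** A conjugate of the translation group fixes 0 instead of infinity; this provides as many
    lower unitriangular elements as there are translations. *)
Lemma low_trans c : (low c \in H) = (c \in trans).
Proof.
pose L := [set c | low c \in H].
suff -> : trans = L by rewrite inE.
apply/esym/eqP; rewrite eqEcard; apply/andP; split.
  apply/subsetP => x; rewrite inE => HL.
  have [->|x0] := eqVneq x 0; first exact: trans0.
  have [+ _ _] := w_images (low_unit x) HL => /(_ x0).
  by rewrite -!inK => h; rewrite -[x]invrK -[x^-1]mul1r rpredV.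
have [h Hh h0] : exists2 h, h \in H & lact h None = Some (iota 0).
  by have [g Hg e] := orbitP w0; exists g^-1%g; rewrite ?groupV.
pose s : PGL2_type F := pgl (mx2 0 1 1 0).
have us : mx2 (0 : F) 1 1 0 \in unitmx.
  by rewrite unitmxE unitfE det_mx2 mulr1 mul0r sub0r oppr_eq0 oner_neq0.
have sinf : lact s None = Some (iota 0).
  by rewrite -[None]/(omap iota None) lact_rat // /mob ap_mx2 /pt /= !mulr1 !mulr0 !addr0 oner_eq0 mul0r.
have s0 : lact s (Some (iota 0)) = None.
  by rewrite -[Some _]/(omap iota (Some 0)) lact_rat // /mob ap_mx2 /pt /= !mulr1 !mulr0 !addr0 eqxx.
have sV : (s * s = 1)%g.
  by rewrite -pglM // mulmx2 !mulr0 !mulr1 !addr0 !add0r -one_mx2 pgl1.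
have sL x : (s * aff 1%R x * s = low x)%g.
  by rewrite -!pglM ?unitmx_mul ?us ?aff_unit ?oner_neq0 // !mulmx2; congr pgl; congr mx2; ring.
have -> : #|trans| = #|urad None| by rewrite card_trans qE.
rewrite -(card_imset _ (@conj_op_inj _ h)).
apply: leq_trans (leq_imset_card low L); apply/subset_leq_card/subsetP => _ /imsetP[g /mem_unirad[Hg gN ug] ->].
have hg : conj_op h g = (g ^ h^-1)%g by rewrite /conj_op conjgE invgK mulgA.
have Hgh : conj_op h g \in H by rewrite hg groupJ ?groupV.
have hV : lact h^-1%g (Some (iota 0)) = None by rewrite -h0 lactK.
have f0 : lact (s * conj_op h g * s)%g None = None.
  by rewrite !lactM sinf hV gN h0 s0.
have [x xE] : exists x, (s * conj_op h g * s)%g = aff 1%R x.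
  apply: uni_inf => //; have sE : s = s^-1%g by apply: (mulgI s); rewrite sV mulgV.
  by rewrite {1}sE -mulgA -conjgE uniJ hg uniJ.
have lowE : conj_op h g = low x.
  rewrite -sL -xE; move: (conj_op h g) => y.
  by rewrite -!mulgA sV mulg1 mulgA sV mul1g.
by apply/imsetP; exists x; rewrite ?inE -?lowE.
Qed.

Lemma SL2_multK (P : 'M[multK]_2) : \det P = 1 -> pgl (embM P) \in H.
Proof.
have memT (x : multK) : sfval x \in trans.
  by rewrite -inK; apply: (valP x).
have HU (x : multK) : aff 1%R (sfval x) \in H by have := memT x; rewrite inE.
have HL (x : multK) : low (sfval x) \in H by rewrite low_trans.
have HM (a b c e : multK) : c != 0 -> a * e - b * c = 1 -> pgl (embM (mx2 a b c e)) \in H.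
  move=> c0 D; rewrite (sl2_ulu c0 D).
  rewrite /embM !map_mxM !map_mx2 !rmorph1 !rmorph0.
  rewrite !pglM ?unitmx_mul ?low_unit ?aff_unit ?oner_neq0 //.
  by apply: groupM; [apply: groupM; [exact: HU | exact: HL] | exact: HU].
have [a [b [c [e ->]]]] := mx2P P; rewrite det_mx2 => D.
have [c0|c0] := eqVneq c 0; last exact: HM.
rewrite c0 mulr0 subr0 in D *.
have a0 : a != 0 by apply: contra_eq_neq D => ->; rewrite mul0r eq_sym oner_neq0.
have := HM a b a (b + e) a0; rewrite mulrDr D [b * a]mulrC addrAC subrr add0r => /(_ erefl).
have -> : mx2 a b a (b + e) = mx2 1 0 1 1 *m mx2 a b 0 e by rewrite mulmx2 !mul1r !mul0r !addr0.
rewrite /embM map_mxM !map_mx2 !rmorph1 !rmorph0 pglM ?low_unit //; last first.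
  rewrite unitmxE unitfE det_mx2 mulr0 subr0 -rmorphM D rmorph1; exact: oner_neq0.
rewrite groupMl // -[pgl _]/(low 1) low_trans -inK; exact: rpred1.
Qed.

(** Conjugation by SL(2,K) is transitive on the matrices of trace 1 and given determinant
    over the field of multipliers K. *)
Lemma big_subT d (X : {set PGL2_type F}) : d != 0 -> 1 - 4 * d != 0 ->
  X \subset pglT d -> X != set0 -> X \subset H ->
  (forall h, h \in H -> {in X, forall y, conj_op h y \in X}) ->
  exists2 e : multK, sfval e = d & X = subT e.
Proof.
move=> d0 disc sX /set0Pn[y Xy] sXH Xn.
have lift x : x \in X -> exists2 N : 'M[multK]_2, embM N \in trdet d & x = pgl (embM N).
  move=> Xx; have /imsetP[N TN xE] := subsetP sX _ Xx.
  have [a [b [c [e NE]]]] := mx2P N; rewrite NE in TN xE.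
  have HN : pgl (mx2 a b c e) \in H by rewrite -xE; apply: (subsetP sXH).
  have [] := trdet_entries d0 TN HN; rewrite -!inK => Ka Kb Kc Ke.
  exists (mx2 (SubfieldElt Ka) (SubfieldElt Kb) (SubfieldElt Kc) (SubfieldElt Ke)).
    by rewrite /embM map_mx2.
  by rewrite /embM map_mx2.
have [N TN yE] := lift _ Xy.
pose e := \det N; have [trN detN] := trdetP _ _ TN.
have eE : sfval e = d by rewrite -detN /embM det_map_mx.
have TeN : N \in trdet e by rewrite -embM_trdet eE.
have e0 : e != 0 by rewrite -(fmorph_eq0 (sfm multK)) sfmE eE.
have edisc : 1 - 4 * e != 0 by rewrite -sfval_disc eE.
exists e => //; apply/eqP; rewrite eqEsubset; apply/andP; split; apply/subsetP => x.
  move=> /lift[M TM ->]; apply: imset_f; by rewrite -embM_trdet eE.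
case/imsetP => M TM ->.
have [P dP NP] := trdet_SL_conj edisc TM TeN.
have uP : P \in unitmx by rewrite unitmxE dP unitr1.
have uN := trdet_unit e0 TeN.
have -> : M = P *m N *m invmx P by rewrite -NP mulmxK.
rewrite /embM !map_mxM map_invmx pgl_conj ?map_unitmx // -yE.
by apply: Xn Xy; apply: SL2_multK.
Qed.

End Big.

(** * Moving an orbit to the standard position *)

Section Transport.
Variables (F E : finFieldType) (iota : {rmorphism F -> E}).
Local Notation pact := (proj_act iota).
Implicit Type H : {group PGL2_type F}.

Lemma stab_conj H g z : ('C_(H :^ g)[pact z g | pact] = 'C_H[z | pact] :^ g)%g.
Proof. by rewrite astab1_act -conjIg. Qed.

Lemma unirad_conj H g z :
  (unirad pact (H :^ g) (@uni F) (pact z g) = (unirad pact H (@uni F) z) :^ g)%g.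
Proof.
apply/setP => x; rewrite mem_conjg [x \in _]inE [(x ^ _)%g \in _]inE stab_conj mem_conjg uniJ; exact: erefl.
Qed.

Lemma card_orbit_conj H g z :
  #|orbit pact (H :^ g)%g (pact z g)| = #|orbit pact H z|.
Proof.
rewrite -(card_imset (orbit pact H z) (act_inj pact g)); apply: eq_card => x.
rewrite -{1}[x](actKV pact g) orbit_conjsg.
apply/idP/imsetP => [?|[y Hy ->]]; last by rewrite actK.
by exists (pact x g^-1)%g; rewrite // actKV.
Qed.

Lemma unirad_orbit H z u : u \in orbit pact H z ->
  #|unirad pact H (@uni F) u| = #|unirad pact H (@uni F) z|.
Proof.
case/orbitP => g Hg <-; have HJ : (H :^ g)%G = H by apply/val_inj/conjGid.
by rewrite -{1}HJ unirad_conj cardJg.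
Qed.

Lemma three_points (T : finType) (A : {set T}) (z : T) : z \in A -> (2 < #|A|)%N ->
  exists u v, [/\ u \in A, v \in A, z != u, z != v & u != v].
Proof.
rewrite (cardsD1 z) => -> /=; rewrite add1n ltnS => /card_gt1P[u [v [Au Av uv]]].
by exists u, v; move: Au Av; rewrite !inE !(eq_sym z) => /andP[-> ->] /andP[-> ->].
Qed.

Variables (d : F) (X : {set PGL2_type F}).
Hypotheses (d0 : d != 0%R) (disc : (1 - 4 * d != 0)%R).
Hypotheses (Xc : {in X &, forall x y, conj_op x y \in X}) (sX : X \subset pglT d) (X0 : X != set0).
Let H := <<X>>%G.

(** Points with a nontrivial unipotent radical are rational, and PGL(2,q) is transitive on
    triples of rational points, so three points of the orbit can be moved to infinity, 0, 1. *)
Lemma big_case z : let q := #|unirad pact H (@uni F) z| in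
  (2 < q)%N -> #|orbit pact H z| = q.+1 -> (q.-1 * q %| 2 * #|'C_H[z | pact]%g|)%N ->
  exists (K : subfield F) (e : K), [/\ sfval e = d, (2 < #|K|)%N & rack_isom X (pglT e)].
Proof.
move=> q q3 wE qd.
have rat u : u \in orbit pact H z -> exists u0, u = omap iota u0.
  move=> /unirad_orbit uq; have : (0 < #|unirad pact H (@uni F) u :\ 1%g|)%N.
    have := cardsD1 1%g (unirad pact H (@uni F) u); rewrite uq -/q.
    by move: q3; rewrite -/q; case: (1%g \in _); move: #|_ :\ _| (q) => m k; clear; lia.
  case/card_gt0P => g /setD1P[g1 /mem_unirad[_ gu ug]].
  exact: (uni_rational g1 ug gu).
have wz : z \in orbit pact H z by apply: orbit_refl.
have [|u [v [wu wv zu zv uv]]] := three_points wz; first by rewrite wE (ltn_trans q3).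
have [z0 z0E] := rat _ wz; have [z1 z1E] := rat _ wu; have [z2 z2E] := rat _ wv.
have [|||g [g0 g1 g2]] := @flact_triple F z0 z1 z2.
- by apply: contraNneq zu => e; rewrite z0E z1E e.
- by apply: contraNneq zv => e; rewrite z0E z2E e.
- by apply: contraNneq uv => e; rewrite z1E z2E e.
have toE t t' : lact (idfun : {rmorphism F -> F}) g t = t' -> pact (omap iota t') g = omap iota t.
  move=> e; rewrite proj_actE; apply: (canLR (lactK iota g)); rewrite -e.
  by rewrite -[g]pglmxK lact_rat ?lact_idfun ?unit_pglmx.
have zN : pact z g = None by rewrite z0E (toE _ _ g0).
have q' : #|unirad pact (H :^ g)%G (@uni F) None| = q by rewrite -zN unirad_conj cardJg.
have w' : #|orbit pact (H :^ g)%G None| = q.+1 by rewrite -zN card_orbit_conj.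
have qd' : (q.-1 * q %| 2 * #|('C_(H :^ g)[None | pact])%g|)%N by rewrite -zN stab_conj cardJg.
have inw t t' x : lact (idfun : {rmorphism F -> F}) g t = t' -> x = omap iota t' ->
  x \in orbit pact H z -> omap iota t \in orbit pact (H :^ g)%g None.
  by move=> e xE wx; rewrite -(toE _ _ e) -xE -zN orbit_conjsg.
have w0 := inw _ _ _ g1 z1E wu; have w1 := inw _ _ _ g2 z2E wv.
pose X' := [set conj_op g^-1%g x | x in X].
have sXH : X' \subset (H :^ g)%g.
  apply/subsetP => _ /imsetP[x Xx ->].
  by rewrite /conj_op invgK -mulgA -conjgE memJ_conjg mem_gen.
have [||||e eE X'E] := big_subT q' q3 w' qd' w0 w1 d0 disc (X := X').
- by apply/subsetP => _ /imsetP[x Xx ->]; apply: pglT_conj => //; apply: (subsetP sX).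
- by apply/set0Pn; have /set0Pn[x Xx] := X0; exists (conj_op g^-1%g x); apply: imset_f.
- exact: sXH.
- move=> h; rewrite mem_conjg => Hh _ /imsetP[x Xx ->].
  apply/imsetP; exists (conj_op (h ^ g^-1)%g x); first exact: subrack_norm Hh _ Xx.
  by rewrite /conj_op !conjgE !invMg !invgK !mulgA !mulVg !mul1g ?mulgKV ?mulgK.
exists (multK (H :^ g)%G), e; split=> //.
  by rewrite (card_multK q' q3 w' qd' w0 w1).
apply: rack_isom_trans (rack_isom_conj X g^-1%g) _.
rewrite -/X' X'E; apply: subT_isom; by rewrite -(fmorph_eq0 (sfm _)) sfmE eE.
Qed.
End Transport.

(** * Quadratic extensions, divisibility, and the smallest fields *)

Section Ext.
Local Open Scope ring_scope.

(** A splitting field of the product of all monic quadratic polynomials. *)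
Lemma quadratic_closure (F : finFieldType) :
  exists (E : finFieldType) (iota : {rmorphism F -> E}),
    forall t d : F, exists a : E, a ^+ 2 - iota t * a + iota d = 0.
Proof.
pose Q (td : F * F) : {poly F} := 'X^2 - td.1 *: 'X + td.2%:P.
have sQ td : size (Q td) = 3%N.
  rewrite /Q -addrA size_polyDl size_polyXn //.
  rewrite (leq_ltn_trans (size_polyD _ _)) // gtn_max size_polyN.
  by rewrite (leq_ltn_trans (size_scale_leq _ _)) ?size_polyX // (leq_ltn_trans (size_polyC_leq1 _)).
have Q0 td : Q td != 0 by rewrite -size_poly_eq0 sQ.
have P0 : \prod_td Q td != 0 by apply/prodf_neq0 => td _.
have [L [rs splitL _]] := FinSplittingFieldFor P0.
exists (FinFieldExtType L), (in_alg L : {rmorphism F -> L}) => t d.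
have div : map_poly (in_alg L) (Q (t, d)) %| \prod_(z <- rs) ('X - z%:P).
  by rewrite -(eqp_dvdr _ splitL) dvdp_map (bigD1 (t, d)) //= dvdp_mulr.
have [m mE] := dvdp_prod_XsubC div.
have : size (map_poly (in_alg L) (Q (t, d))) = (size (mask m rs)).+1.
  by rewrite (eqp_size mE) size_prod_XsubC.
rewrite size_map_poly sQ; case rE: (mask m rs) => [|a s] // _.
have : root (map_poly (in_alg L) (Q (t, d))) a.
  by rewrite (eqp_root mE) root_prod_XsubC rE mem_head.
rewrite /root /Q rmorphD rmorphB /= map_polyXn map_polyZ map_polyX map_polyC /= => /eqP aE.
by exists a; rewrite !hornerE in aE.
Qed.

Lemma card_nat0 (L : finFieldType) : (#|L|%:R : L) = 0.
Proof. by rewrite -[_%:R]/(1 *+ _) -FinRing.zmodXgE -cardsT expg_cardG ?inE. Qed.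

Section Frob.
Variables (p k : nat) (F : finFieldType).
Hypotheses (p_prime : prime p) (card_F : #|F| = (p ^ k)%N).
Variables (E : finFieldType) (iota : {rmorphism F -> E}).

Lemma char_ext : p \in [pchar E].
Proof.
rewrite inE p_prime /= -(rmorph_nat iota) fmorph_eq0.
by have /eqP := card_nat0 F; rewrite card_F natrX expf_eq0 => /andP[].
Qed.

(** The Frobenius map of F permutes the two roots of a quadratic polynomial over F. *)
Lemma frob_root r (a : E) : a ^+ 2 - iota r * a + 1 = 0 ->
  a ^+ (#|F| - 1) = 1 \/ a ^+ (#|F| + 1) = 1.
Proof.
move=> ra; set q := #|F|.
have a0 : a != 0.
  by apply: contra_eq_neq ra => ->; rewrite expr0n mulr0 subr0 add0r oner_neq0.
have pE : [pchar E].-nat q by rewrite /q card_F pnatX (pi_pnat (pnat_id p_prime)) ?char_ext.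
have q0 : (0 < q)%N by rewrite (ltn_trans _ (finNzRing_gt1 F)).
have rE : iota r = a + a^-1.
  by apply: (mulIf a0); rewrite mulrDl mulVf // -expr2; apply/eqP; rewrite eq_sym -subr_eq0 addrAC ra.
have rq : iota r = a ^+ q + a^-1 ^+ q.
  by rewrite -exprDn_pchar // -rE -rmorphXn expf_card.
have aq0 : a ^+ q != 0 by rewrite expf_neq0.
have : (a ^+ q - a) * (a ^+ q * a - 1) == 0.
  have -> : (a ^+ q - a) * (a ^+ q * a - 1) = a ^+ q * a * ((a ^+ q + a^-1 ^+ q) - (a + a^-1)).
    by rewrite exprVn; field; rewrite a0.
  by rewrite -rq rE subrr mulr0.
rewrite mulf_eq0 !subr_eq0 => /orP[]/eqP e; [left|right].
  by apply: (mulIf a0); rewrite -exprSr mul1r -[X in X.+1]/(q - 1)%N subn1 prednK.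
by rewrite addn1 exprSr.
Qed.

Hypothesis quad : forall t d : F, exists a : E, a ^+ 2 - iota t * a + iota d = 0.

(** The roots of x^2 - x / s + 1 are primitive 8th roots of unity, so 8 divides q - 1 or
    q + 1, and the other factor is even. *)
Lemma dvd_card8 (s : F) : 2 * s ^+ 2 = 1 -> (16 %| #|F| ^ 2 - 1)%N.
Proof.
move=> s2; have [a] := quad s^-1 1; rewrite rmorph1 => aE.
have s0 : s != 0 by apply: contra_eq_neq s2 => ->; rewrite expr0n mulr0 eq_sym oner_neq0.
have a4 : a ^+ 4 = -1.
  have h : (iota s)^-1 ^+ 2 = 2.
    rewrite -fmorphV -rmorphXn -(rmorph_nat iota); congr (iota _).
    by rewrite exprVn; apply: (mulIf (expf_neq0 2 s0)); rewrite mulVf ?expf_neq0 // s2.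
  have e : a ^+ 2 + 1 = (iota s)^-1 * a.
    by apply/eqP; rewrite -subr_eq0 -fmorphV addrAC aE.
  have : (a ^+ 2 + 1) ^+ 2 = 2 * a ^+ 2 by rewrite e exprMn h.
  move=> f; apply/eqP; rewrite -subr_eq0; apply/eqP.
  transitivity ((a ^+ 2 + 1) ^+ 2 - 2 * a ^+ 2); last by rewrite f subrr.
  by ring.
have a8 : a ^+ 8 = 1 by rewrite (exprM a 4 2) a4 sqrrN expr1n.
have two0 : (2 : E) != 0.
  by rewrite -(rmorph_nat iota) fmorph_eq0; apply: contra_eq_neq s2 => ->; rewrite mul0r eq_sym oner_neq0.
have a41 : a ^+ 4 != 1.
  by rewrite a4 -subr_eq0 -opprD oppr_eq0.
have prim : 8.-primitive_root a.
  have [m pm m8] := prim_order_exists (isT : (0 < 8)%N) a8.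
  have : ~~ (m %| 4)%N by rewrite (prim_order_dvd pm).
  by have := dvdn_leq (isT : (0 < 8)%N) m8; move: m pm m8; do 9?[case=> //].
have odd_q : odd #|F|.
  rewrite card_F oddX; apply/orP; right; apply: contraNT two0 => /(prime_oddPn p_prime) e.
  by have := char_ext; rewrite inE e => /andP[].
have : (8 %| #|F| - 1)%N \/ (8 %| #|F| + 1)%N.
  by have [] := frob_root aE; move/eqP; rewrite -(prim_order_dvd prim); [left|right].
move: odd_q (finNzRing_gt1 F); move: #|F| => q oq q1 q8; clear -oq q1 q8.
have -> : (q ^ 2 - 1 = (q - 1) * (q + 1))%N by rewrite -subn_sqr.
have [h1 h2] : (2 %| q - 1)%N /\ (2 %| q + 1)%N by rewrite !dvdn2 oddD oddB ?oq // ltnW.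
case: q8 => h; first exact: (dvdn_mul h h2).
by rewrite mulnC; exact: (dvdn_mul h h1).
Qed.

(** The roots of x^2 + t x + 1 are primitive 5th roots of unity; in characteristic 5, where
    there are none, the discriminant vanishes. *)
Lemma dvd_card5 (t : F) : t ^+ 2 = t + 1 -> 1 - 4 * t ^+ 2 != 0 -> (5 %| #|F| ^ 2 - 1)%N.
Proof.
move=> t2 disc; have [a] := quad (- t) 1; rewrite rmorph1 rmorphN mulNr opprK => aE.
have aE' : a ^+ 2 - iota (- t) * a + 1 = 0 by rewrite rmorphN mulNr opprK.
have t2' : iota t ^+ 2 = iota t + 1 by rewrite -rmorphXn t2 rmorphD rmorph1.
have a5 : a ^+ 5 = 1.
  apply/eqP; rewrite -subr_eq0; apply/eqP.
  transitivity ((a - 1) * ((a ^+ 2 + iota t * a + 1) * (a ^+ 2 + (1 - iota t) * a + 1)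
                 + a ^+ 2 * (iota t ^+ 2 - (iota t + 1)))); first by ring.
  by rewrite aE t2' subrr mul0r mulr0 addr0 mulr0.
have a1 : a != 1.
  apply: contraNneq disc => e; rewrite e expr1n mulr1 in aE.
  have tE : iota t = - 2.
    by apply/eqP; rewrite -subr_eq0 opprK -aE; apply/eqP; ring.
  rewrite -(fmorph_eq0 iota) rmorphB rmorphM rmorph1 rmorph_nat rmorphXn tE.
  have five : (5 : E) = 0.
    transitivity ((- 2) ^+ 2 - (- 2 + 1) : E); first by ring.
    by rewrite -tE t2' subrr.
  by apply/eqP; transitivity (- (3 * 5) : E); [ring | rewrite five mulr0 oppr0].
have prim : 5.-primitive_root a.
  have [m pm m5] := prim_order_exists (isT : (0 < 5)%N) a5.
  have /primeP[_ /(_ m m5)/orP[]/eqP mE] : prime 5 by []; last by rewrite -mE.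
  by move: pm; rewrite mE => /prim_expr_order/eqP; rewrite expr1 (negPf a1).
have -> : (#|F| ^ 2 - 1 = (#|F| - 1) * (#|F| + 1))%N by rewrite -subn_sqr.
have [] := frob_root aE'; move/eqP; rewrite -(prim_order_dvd prim) => h.
  exact: dvdn_mulr.
exact: dvdn_mull.
Qed.

End Frob.

(** Without eigenvalues in L the entry N01 is not 0, and the first row determines N. *)
Lemma card_trdet_irr (L : finFieldType) (e : L) : (forall a, a * (1 - a) != e) ->
  (#|trdet e| <= #|L| * #|L|.-1)%N.
Proof.
move=> irr; pose f (N : 'M[L]_2) := (N 0 0, N 0 1).
have ent N : N \in trdet e -> exists a b c, [/\ N = mx2 a b c (1 - a), b * c = a * (1 - a) - e & b != 0].
  have [a [b [c [g ->]]]] := mx2P N; case/trdetP; rewrite tr_mx2 det_mx2 => tN dN.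
  have gE : g = 1 - a by rewrite -tN addrC addKr.
  exists a, b, c; rewrite gE in dN *; split=> //; first by rewrite -dN; ring.
  by apply: contra_eq_neq dN => ->; rewrite mul0r subr0.
rewrite -(card_in_imset (f := f)).
  rewrite -(cardsC1 (0 : L)) -(cardsT L) -cardsX.
  apply/subset_leq_card/subsetP => _ /imsetP[N /ent[a [b [c [-> _ b0]]]] ->].
  by rewrite in_setX !inE !mxE.
move=> N M /ent[a [b [c [-> h b0]]]] /ent[a' [b' [c' [-> h' b0']]]].
rewrite /f !mxE /= => -[aa bb]; rewrite -aa -bb in b0' h' *.
by have -> : c = c' by apply: (mulfI b0); rewrite h h'.
Qed.

Lemma card_pglT_le (L : finFieldType) (e : L) : (#|pglT e| <= #|trdet e|)%N.
Proof. exact: leq_imset_card. Qed.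

(** Over three elements the class has at most 6 elements, which is the size of the octahedral
    rack that it contains. *)
Lemma pglT_F3 (L : finFieldType) (e : L) : #|L| = 3%N -> e != 0 -> 1 - 4 * e != 0 ->
  2 * e = 1 /\ rack_isom (pglT e) (long_cycle 4 ^: 'Sym_('I_4))%g.
Proof.
move=> cL e0 disc; have := card_nat0 L; rewrite cL => three.
have exp3 (x : L) : x ^+ 3 = x by rewrite -{1}cL expf_card.
have e1 : e != 1.
  apply: contraNneq disc => ->; rewrite mulr1 -opprB oppr_eq0.
  by apply/eqP; transitivity (3 : L); [ring|].
have eN : e = - 1.
  apply/eqP; rewrite -subr_eq0 opprK.
  have : e * ((e - 1) * (e + 1)) == 0.
    by apply/eqP; transitivity (e ^+ 3 - e); [ring | rewrite exp3 subrr].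
  by rewrite !mulf_eq0 (negPf e0) subr_eq0 (negPf e1).
have e2 : 2 * e = 1.
  by apply/eqP; rewrite -subr_eq0 eN; apply/eqP; transitivity (- 3 : L); [ring | rewrite three oppr0].
split=> //.
have [N1 [N2 [T1 T2 tr12]]] := trdet_pair e0 disc.
have [Y [sY [iso _ cY _ _]]] := trdet_table_Sym4 e0 e2 T1 T2 tr12.
suff <- : Y = pglT e by [].
apply/eqP; rewrite eqEcard sY cY (leq_trans (card_pglT_le e)) //.
rewrite (leq_trans (card_trdet_irr _)) ?cL // => a; rewrite eN.
apply/eqP => h.
have h2 : a ^+ 2 = a + 1.
  by apply/eqP; rewrite -subr_eq0; apply/eqP; transitivity (- (a * (1 - a) - -1)); [ring | rewrite h subrr oppr0].
have aE : a = - 1.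
  apply/eqP; rewrite -subr_eq0 opprK; apply/eqP.
  transitivity (a ^+ 3 - a - ((a + 1) * (a ^+ 2 - (a + 1)))); last by rewrite exp3 h2 !subrr mulr0 subr0.
  by ring.
move/eqP: h; rewrite aE -subr_eq0; apply/negP.
by rewrite (_ : -1 * (1 - -1) - -1 = -1 :> L) ?oppr_eq0 ?oner_eq0 //; ring.
Qed.

(** Over four elements the class has at most 12 elements, which is the size of the icosahedral
    rack that it contains. *)
Lemma pglT_F4 (L : finFieldType) (e : L) : #|L| = 4%N -> e != 0 -> e != 1 ->
  e ^+ 2 - 3 * e + 1 = 0 /\ rack_isom (pglT e) (long_cycle 5 ^: 'Alt_('I_5))%g.
Proof.
move=> cL e0 e1; have := card_nat0 L; rewrite cL => four.
have two : (2 : L) = 0.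
  by apply/eqP; rewrite -sqrf_eq0; apply/eqP; transitivity (4 : L); [ring|].
have disc : 1 - 4 * e != 0 by rewrite four mul0r subr0 oner_neq0.
have exp4 (x : L) : x ^+ 4 = x by rewrite -{1}cL expf_card.
have e2 : e ^+ 2 + e + 1 = 0.
  have : (e * (e - 1)) * (e ^+ 2 + e + 1) == 0.
    by apply/eqP; transitivity (e ^+ 4 - e); [ring | rewrite exp4 subrr].
  by rewrite !mulf_eq0 (negPf e0) subr_eq0 (negPf e1) => /eqP.
split; first by transitivity (e ^+ 2 + e + 1 - 4 * e); [ring | rewrite e2 four mul0r subr0].
have [N1 [N2 [T1 T2 tr12]]] := trdet_pair e0 disc.
have ee : e = (e ^+ 2) ^+ 2 by rewrite -exprM exp4.
have t2 : (e ^+ 2) ^+ 2 = e ^+ 2 + 1.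
  rewrite -ee; apply/eqP; rewrite -subr_eq0; apply/eqP.
  transitivity (2 * e - (e ^+ 2 + e + 1)); first by ring.
  by rewrite two mul0r e2 subr0.
have [Y [sY [iso _ cY _ _]]] := trdet_table_Alt5 e0 disc t2 ee T1 T2 tr12.
suff <- : Y = pglT e by [].
apply/eqP; rewrite eqEcard sY cY (leq_trans (card_pglT_le e)) //.
rewrite (leq_trans (card_trdet_irr _)) ?cL // => a; apply: contraNneq e1 => h.
have : e * (e - 1) == 0.
  have -> : e * (e - 1) = (a * (1 - a)) ^+ 2 - a * (1 - a) by rewrite h; ring.
  have -> : (a * (1 - a)) ^+ 2 - a * (1 - a) = a ^+ 4 - a + 2 * (a ^+ 2 - a ^+ 3) by ring.
  by rewrite exp4 subrr two mul0r addr0.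
by rewrite mulf_eq0 (negPf e0) subr_eq0.
Qed.
End Ext.

(** * Classification *)

Section Classify.
Variables (F : finFieldType) (d : F) (o : nat).
Hypotheses (d0 : d != 0%R) (disc : (1 - 4 * d != 0)%R) (sq : d \in squares F).
Hypothesis ord : forall y, y \in pglT d -> #[y]%g = o.
Hypothesis o4 : (4 <= o)%N.

Lemma order_eq4 : (2 * d = 1)%R -> o = 4%N.
Proof.
move=> d2; have [N [_ [TN _ _]]] := trdet_pair d0 disc.
have : (pgl N ^+ 4 == 1)%g by rewrite (pgl_trdet_exp4 d0 disc) // d2 subrr.
rewrite -order_dvdn (ord (imset_f _ TN)) => /dvdn_leq; lia.
Qed.

Lemma order_eq5 : (d ^+ 2 - 3 * d + 1 = 0)%R -> o = 5%N.
Proof.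
move=> d2; have [N [_ [TN _ _]]] := trdet_pair d0 disc.
have : (pgl N ^+ 5 == 1)%g by rewrite (pgl_trdet_exp5 d0 disc) // d2.
rewrite -order_dvdn (ord (imset_f _ TN)).
by move: o o4; do 6?[case=> //].
Qed.

Lemma eq4_order : o = 4%N -> (2 * d = 1)%R.
Proof.
move=> o_4; have [N [_ [TN _ _]]] := trdet_pair d0 disc.
have : (pgl N ^+ 4 == 1)%g by rewrite -order_dvdn (ord (imset_f _ TN)) o_4.
by rewrite (pgl_trdet_exp4 d0 disc) // subr_eq0 eq_sym => /eqP.
Qed.

Lemma eq5_order : o = 5%N -> (d ^+ 2 - 3 * d + 1 = 0)%R.
Proof.
move=> o_5; have [N [_ [TN _ _]]] := trdet_pair d0 disc.
have : (pgl N ^+ 5 == 1)%g by rewrite -order_dvdn (ord (imset_f _ TN)) o_5.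
by rewrite (pgl_trdet_exp5 d0 disc) // => /eqP.
Qed.

Variable X : {set PGL2_type F}.
Hypotheses (Xc : {in X &, forall x y, conj_op x y \in X}) (sX : X \subset pglT d).
Let H : {group PGL2_type F} := [group of <<X>>%g].

Lemma comm_case y : y \in X -> (forall x, x \in X -> commute y x) ->
  X = [set y] \/ X = [set y; y^-1]%g.
Proof.
move=> Xy comm; have sXy : X \subset [set y; y^-1]%g.
  apply/subsetP => x Xx; have := comm x Xx.
  by case/(pglT_comm d0 disc (subsetP sX _ Xy) (subsetP sX _ Xx)) => ->; rewrite !inE eqxx ?orbT.
have [Xv|Xv] := boolP (y^-1%g \in X); [right|left]; apply/eqP; rewrite eqEsubset.
  by rewrite sXy; apply/subsetP => x; rewrite !inE => /orP[]/eqP->.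
rewrite sub1set Xy andbT; apply/subsetP => x Xx.
have := subsetP sXy _ Xx; rewrite !inE => /orP[->|/eqP xE] //.
by rewrite -xE Xx in Xv.
Qed.

(** The four outcomes of [count_outcome] for the group generated by X. A global fixed point
    gives the affine racks; a dihedral group is impossible, as its rotation subgroup would be
    abelian and contain X; the polyhedral groups and the projective lines give the other
    racks. *)
Lemma noncomm_case y y2 : y \in X -> y2 \in X -> ~ commute y y2 ->
  [\/ o = 4%N /\ rack_isom X (long_cycle 4 ^: 'Sym_('I_4))%g,
      o = 5%N /\ rack_isom X (long_cycle 5 ^: 'Alt_('I_5))%g,
      affine_rack d o X
    | exists (K : subfield F) (e : K),
        [/\ sfval e = d, (4 < #|K|)%N & rack_isom X (pglT e)]].
Proof.
move=> Xy Xy2 nc; have [E [iota quad]] := quadratic_closure F.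
pose pact := proj_act iota.
have XH x : x \in X -> x \in H by move=> Xx; apply: mem_gen.
have Ty := subsetP sX _ Xy; have uy := pglT_uni d0 disc Ty.
have T1 x : x \in pglT d -> x != 1%g.
  by move=> Tx; have := pglT_exp_neq1 d0 disc ord o4 Tx (isT : (0 < 1 < 4)%N).
have fixE (x : PGL2_type F) z : (z \in ('Fix_pact[x])%g) = (pact z x == z).
  by apply/afix1P/eqP.
have [x fx] : exists x, pact x y = x.
  have : (0 < #|('Fix_pact[y])%g|)%N by rewrite (fix_card quad (T1 _ Ty)) (negPf uy).
  by case/card_gt0P => x; rewrite fixE => /eqP; exists x.
have fxl : lact iota y x = x by apply/proj_act_fix.
have nab : ~ abelian (H : {set PGL2_type F}).
  by move/centsP => ab; apply: nc; apply: ab; apply: XH.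
have [] := @count_outcome _ _ pact H (@uni F) (@uni1 F) (@uniJ F)
   (fun g _ g1 => fix_card quad g1) (@unirad_group _ _ iota H) (@unirad_abelian _ _ iota H)
   y x (XH _ Xy) uy fx.
- by rewrite (ord Ty).
- case=> z zH; have Hz g : g \in H -> lact iota g z = z.
    by rewrite -zH => /mem_stab[].
  have [q1|qn1] := eqVneq #|unirad pact H (@uni F) z| 1%N.
    by case: nab; rewrite -zH; apply: stab_abelian q1.
  have : (0 < #|unirad pact H (@uni F) z :\ 1%g|)%N.
    have := cardsD1 1%g (unirad pact H (@uni F) z).
    have -> : 1%g \in unirad pact H (@uni F) z by apply/mem_unirad; rewrite group1 lact1 uni1.
    by move: qn1; move: #|_| #|_ :\ _| => a b; clear; lia.
  case/card_gt0P => g /setD1P[g1 /mem_unirad[_ gz ug]].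
  have [z0 zE] := uni_rational g1 ug gz.
  constructor 3; apply: (affine_case d0 disc sq ord o4 (z0 := z0)) => //.
    move=> a Xa; have := Hz a (XH a Xa); rewrite zE -[a]pglmxK.
    have uM := unit_pglmx a; rewrite lact_rat // lact_idfun //.
    exact: (inj_omap (fmorph_inj iota)).
  by exists y, y2.
- case=> q1 hE; case: nab.
  (* The square of an element of X fixes x, and it has the same fixed points as the
     element itself: X lies in the abelian stabiliser of x. *)
  have wE : #|orbit pact H x| = 2%N.
    have := card_orbit_stab pact H x; rewrite hE => /eqP.
    by rewrite eqn_pmul2r ?cardG_gt0 // => /eqP.
  have fixX a : a \in X -> pact x a = x.
    move=> Xa; apply/eqP; apply: contraT => ax.
    have Ta := subsetP sX _ Xa.
    have a2 : pact x (a * a)%g = x.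
      apply/eqP; apply: contraT => aax.
      have : (#|[set x; pact x a; pact x (a * a)%g]| <= 2)%N.
        rewrite -wE; apply/subset_leq_card/subsetP => u; rewrite !inE -orbA.
        have Ha := XH _ Xa.
        by case/or3P => /eqP->; rewrite ?orbit_refl ?mem_orbit ?groupM.
      rewrite -setUA cardsU1 cards2 actM (inj_eq (act_inj _ _)) eq_sym !inE.
      by rewrite negb_or !(eq_sym x) ax -actM aax.
    have a21 : (a * a != 1)%g.
      by have := pglT_exp_neq1 d0 disc ord o4 Ta (isT : (0 < 2 < 4)%N); rewrite expgS expg1.
    have sub : ('Fix_pact[a] \subset 'Fix_pact[a * a])%g.
      by apply/subsetP => z; rewrite !fixE actM => /eqP e; rewrite !e.
    have : ('Fix_pact[a] == 'Fix_pact[a * a])%g.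
      rewrite eqEcard sub (fix_card quad a21) (fix_card quad (T1 _ Ta)).
      by rewrite (negPf (pglT_uni d0 disc Ta)); case: ifP.
    by move/eqP/setP/(_ x); rewrite !fixE a2 eqxx (negPf ax).
  have sHx : H \subset 'C_H[x | pact]%g.
    rewrite gen_subG; apply/subsetP => a Xa; apply/mem_stab; split; first exact: XH.
    by apply/proj_act_fix; apply: fixX.
  exact: abelianS sHx (stab_abelian q1).
- case=> q1 hn only.
  have [] := small_case quad d0 disc ord o4 Xc sX Xy Xy2 nc fxl q1 hn erefl only.
    by constructor 1.
  by constructor 2.
case=> z [q3 wE qd].
have X0 : X != set0 by apply/set0Pn; exists y.
have [K [e [eE K2 iso]]] := big_case d0 disc Xc sX X0 q3 wE qd.
have e0 : (e != 0)%R by rewrite -(fmorph_eq0 (sfm K)) sfmE eE.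
have edisc : (1 - 4 * e != 0)%R by rewrite -sfval_disc eE.
have [K4|K4] := ltnP 4 #|K|; first by constructor 4; exists K, e.
have [K3|K3] : #|K| = 3%N \/ #|K| = 4%N by move: K2 K4; move: #|K|; clear; lia.
  have [e2 iso'] := pglT_F3 K3 e0 edisc.
  constructor 1; split; last exact: rack_isom_trans iso iso'.
  by apply: order_eq4; rewrite -eE -sfmE -(rmorph_nat (sfm K)) -rmorphM e2 rmorph1.
have e1 : (e != 1)%R.
  have [N [_ [TN _ _]]] := trdet_pair d0 disc.
  apply/eqP => e1; have := pglT_exp_neq1 d0 disc ord o4 (imset_f _ TN) (isT : (0 < 3 < 4)%N).
  by rewrite (pgl_trdet_exp3 d0 disc) // -eE e1 -sfmE rmorph1 subrr eqxx.
have [e2 iso'] := pglT_F4 K3 e0 e1.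
constructor 2; split; last exact: rack_isom_trans iso iso'.
apply: order_eq5; have := congr1 (sfm K) e2.
by rewrite rmorphD rmorphB rmorphXn rmorphM rmorph_nat rmorph1 rmorph0 sfmE eE.
Qed.

End Classify.

Section Split.
Local Open Scope ring_scope.
Variables (F : finFieldType) (d : F).
Hypotheses (d0 : d != 0).

Lemma split_pgl_diag : split_class (pglT d) ->
  1 - 4 * d != 0 -> exists z : {unit F}, pgl_diag z \in pglT d.
Proof.
case=> _ two disc; have [N [_ [TN _ _]]] := trdet_pair d0 disc.
have uN := trdet_unit d0 TN.
have : (0 < #|fixed_points (pgl N)|)%N by rewrite two ?imset_f.
case/card_gt0P => L; have [LP|] := boolP (L \in proj_line F); last by rewrite inE => /negPf->.
have [v v0 ->] := proj_lineP LP; move/(fixed_pointsP uN v0) => [c cE].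
exact: (root_pgl_diag d0 (eig_root TN v0 cE)).
Qed.

(** The first basis vector spans a fixed line. *)
Lemma diag_not_nonsplit (z : {unit F}) : pgl_diag z \in pglT d -> ~ nonsplit_class (pglT d).
Proof.
move=> Tz [_ /(_ _ Tz)]; rewrite pgl_diagE /aff.
have uM := aff_unit (0 : F) (uval_neq0 z).
pose v : 'cV[F]_2 := \col_i (i == 0)%:R.
have v0 : v != 0 by apply/eqP => /matrixP/(_ 0 0)/eqP; rewrite !mxE eqxx oner_eq0.
move/eqP; rewrite cards_eq0 => /eqP/setP/(_ (proj_point v)); rewrite in_set0.
suff -> : proj_point v \in fixed_points (pgl (mx2 (FinRing.uval z) 0 0 1)) by [].
apply/(fixed_pointsP uM v0); exists (FinRing.uval z).
apply/matrixP => i j; rewrite !mxE big_ord_recl big_ord1 !mxE.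
by case: (ord2P i) => -> /=; ring.
Qed.
End Split.

Local Open Scope group_scope.

Theorem proposition5p19 (p k : nat) (F : finFieldType)
    (O : {set PGL2_type F}) (o : nat)
    (p_prime : prime p) (k_gt0 : (0 < k)%N) (card_F : #|F| = (p ^ k)%N)
    (O_class : O \in classes (PSL2 F)) (O_semisimple : semisimple_class O)
    (O_order : forall y, y \in O -> #[y] = o) (o_ge4 : (4 <= o)%N) :
  (* The listed subracks occur in O. *)
  ((forall y, y \in O ->
      is_subrack O [set y] /\ is_subrack O [set y; y^-1]) /\
   ((16 %| #|F| ^ 2 - 1)%N -> o = 4 ->
      has_subrack O (long_cycle 4 ^: 'Sym_('I_4))) /\
   ((5 %| #|F| ^ 2 - 1)%N -> o = 5 ->
      has_subrack O (long_cycle 5 ^: 'Alt_('I_5))) /\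
   (split_class O ->
      (exists z : {unit F}, eigenvalue_ratio O o z) /\
      forall z : {unit F}, eigenvalue_ratio O o z ->
      forall A : finLmodType (base_field <[z]>%G), (1 < #|A| <= #|F|)%N ->
        has_subrack O (sdprodq_set A [set z]) /\
        has_subrack O (sdprodq_set A [set z; z^-1])) /\
   (forall (K : subfield F) (d : K), (4 < #|K|)%N -> d != 0%R ->
      class_charpoly O ('X^2 + 'X + (sfval d)%:P)%R ->
      (exists Odot : {set PGL2_type K}, class_with_charpoly d Odot) /\
      forall Odot : {set PGL2_type K}, class_with_charpoly d Odot ->
        has_subrack O Odot))
  /\
  (* Every subrack of O is in the list, up to isomorphism. *)
  (forall X : {set PGL2_type F}, is_subrack O X ->
   (exists2 y, y \in O & X = [set y] \/ X = [set y; y^-1]) \/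
   ([/\ (16 %| #|F| ^ 2 - 1)%N, o = 4
      & rack_isom X (long_cycle 4 ^: 'Sym_('I_4))]) \/
   ([/\ (5 %| #|F| ^ 2 - 1)%N, o = 5
      & rack_isom X (long_cycle 5 ^: 'Alt_('I_5))]) \/
   (split_class O /\
    exists z : {unit F}, eigenvalue_ratio O o z /\
    exists A : finLmodType (base_field <[z]>%G),
      (1 < #|A| <= #|F|)%N /\
      (rack_isom X (sdprodq_set A [set z]) \/
       rack_isom X (sdprodq_set A [set z; z^-1]))) \/
   (exists (K : subfield F) (d : K),
      [/\ (4 < #|K|)%N, d != 0%R,
          class_charpoly O ('X^2 + 'X + (sfval d)%:P)%R
        & exists Odot : {set PGL2_type K},
            class_with_charpoly d Odot /\ rack_isom X Odot])).
Proof.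
have [d [d0 disc sq OE]] := class_pglT O_class O_semisimple O_order o_ge4.
subst O; set O := pglT d in O_class O_semisimple O_order *.
have Oc : {in O &, forall x y, conj_op x y \in O} by move=> x y _; apply: pglT_conj.
have subO (X : {set PGL2_type F}) : X != set0 -> X \subset O ->
    {in X &, forall x y, conj_op x y \in X} -> is_subrack O X.
  by move=> X0 sX Xc; apply/is_subrackP.
have [N1 [N2 [T1 T2 tr12]]] := trdet_pair d0 disc.
split; [split; [|split; [|split; [|split]]]|].
- move=> y Oy; have cV x u : commute x u -> conj_op x u = u.
    by move=> c; rewrite /conj_op c mulgK.
  split; apply: subO.
  + by apply/set0Pn; exists y; rewrite set11.
  + by rewrite sub1set.
  + by move=> x u /set1P-> /set1P->; rewrite cV // set11.
  + by apply/set0Pn; exists y; rewrite set21.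
  + by rewrite subUset !sub1set Oy; apply: pglTV.
  + by move=> x u /set2P[]-> /set2P[]->; rewrite cV ?set21 ?set22 //;
       rewrite /commute ?mulgV ?mulVg.
- move=> _ o4; have d2 := eq4_order d0 disc O_order o4.
  have [Y [sY [iso Yc cY _ _]]] := trdet_table_Sym4 d0 d2 T1 T2 tr12.
  by exists Y => //; apply: subO => //; rewrite -card_gt0 cY.
- move=> _ o5; have [t t2 dt] := golden (eq5_order d0 disc O_order o5).
  have [Y [sY [iso Yc cY _ _]]] := trdet_table_Alt5 d0 disc t2 dt T1 T2 tr12.
  by exists Y => //; apply: subO => //; rewrite -card_gt0 cY.
- move=> spl; split.
    have [z Tz] := split_pgl_diag d0 spl disc.
    by exists z; apply: eigenvalue_ratioP.
  by move=> z [_ _ Tz] A cA; apply: split_has_subrack.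
- move=> K e K4 e0 ch.
  have eE : sfval e = d by apply: charpoly_pglT_eq ch => //; apply: sfval_neq0.
  have edisc : (1 - 4 * e != 0)%R by rewrite -sfval_disc eE.
  split; first by exists (pglT e); apply/class_with_charpolyP.
  move=> Odot /(class_with_charpolyP _ e0 edisc) ->.
  exists (subT e); last exact: subT_isom.
  apply: subO; last exact: subT_conj.
    have [M [_ [TM _ _]]] := trdet_pair e0 edisc.
    by apply/set0Pn; exists (pgl (embM M)); apply: imset_f.
  by rewrite /O -eE; apply: subT_sub.
move=> X /is_subrackP[X0 Xc sX].
have [y Xy] := set0Pn _ X0.
have [/existsP[u /existsP[v /and3P[Xu Xv nc]]]|comm] :=
  boolP [exists u, exists v, [&& u \in X, v \in X & u * v != v * u]]; last first.
  left; exists y; first exact: (subsetP sX).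
  apply: (comm_case d0 disc sX) => // x Xx; apply/eqP; apply: contraNT comm => nc.
  by apply/existsP; exists y; apply/existsP; exists x; rewrite Xy Xx.
have {}nc : ~ commute u v by move/eqP: nc.
right; have [[o4 iso]|[o5 iso]|[z [zr [A [cA iso]]]]|[K [e [eE K4 iso]]]] :=
  noncomm_case d0 disc sq O_order o_ge4 Xc sX Xu Xv nc.
- left; split=> //; have d2 := eq4_order d0 disc O_order o4.
  have [s _ sE] := imsetP sq.
  have [E [iota quad]] := quadratic_closure F.
  by apply: (dvd_card8 p_prime card_F quad (s := s)); rewrite -sE.
- right; left; split=> //; have [t t2 dt] := golden (eq5_order d0 disc O_order o5).
  have [E [iota quad]] := quadratic_closure F.
  by apply: (dvd_card5 p_prime card_F quad t2); rewrite -dt.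
- right; right; left; split; last by exists z; split=> //; exists A.
  by case: O_semisimple => // /diag_not_nonsplit ns; case: (ns z); case: zr.
right; right; right; exists K, e.
have e0 : e != 0%R by rewrite -(fmorph_eq0 (sfm K)) sfmE eE.
have edisc : (1 - 4 * e != 0)%R by rewrite -sfval_disc eE.
split=> //; first by rewrite eE; apply: pglT_charpoly.
by exists (pglT e); split=> //; apply/class_with_charpolyP.
Qed.
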